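(* Every weakly bialgebraic subset of $\mathbf{H}$ is either a single point or a special geodesic.
   Context: $\mathbf{H}=\{x+iy: y>0\}$ is the Poincaré upper half-plane, identified with $\{(x,y)\in\mathbb{R}^2: y>0\}\subset\mathbf{A}^2(\mathbb{R})$. For a congruence subgroup $\Gamma\subset SL_2(\mathbb{Z})$, the Riemann surface $\Gamma\backslash\mathbf{H}$ is the analytification of a complex algebraic curve; its Weil restriction from $\mathbb{C}$ to $\mathbb{R}$ is a real algebraic surface $Y_\Gamma$ with $Y_\Gamma(\mathbb{R})\cong\Gamma\backslash\mathbf{H}$, and $p_\Gamma:\mathbf{H}\to Y_\Gamma(\mathbb{R})$ denotes the projection (for $\Gamma=SL_2(\mathbb{Z})$, $Y_\Gamma=\mathbf{A}^2_{\mathbb{R}}$ and $p_\Gamma(z)=(\mathrm{Re}\,j(z),\mathrm{Im}\,j(z))$). A subset $\mathcal{V}\subsetneq\mathbf{H}$ is weakly bialgebraic if, for some congruence subgroup $\Gamma$ (the notion does not depend on the choice), (1) there exist algebraic (closed) subvarieties $V\subset\mathbf{A}^2_{\mathbb{R}}$ and $W\subsetneq Y_\Gamma$ with $\mathcal{V}=V(\mathbb{R})\cap\mathbf{H}$ and $p_\Gamma(\mathcal{V})\subset W(\mathbb{R})$; and (2) $\mathcal{V}$ cannot be written as $(V_1(\mathbb{R})\cap\mathbf{H})\cup(V_2(\mathbb{R})\cap\mathbf{H})$ with $V_1,V_2\subset\mathbf{A}^2_{\mathbb{R}}$ algebraic subvarieties and both inclusions $V_i(\mathbb{R})\cap\mathbf{H}\subset\mathcal{V}$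 proper. $GL_2(\mathbb{R})$ acts on $\mathbf{P}^1(\mathbb{C})$ by Möbius transformations. A special geodesic is a geodesic of $\mathbf{H}$ whose endpoints in $\mathbf{P}^1(\mathbb{R})$ are the two points fixed by $\iota(E^\times)$ for some $\mathbb{Q}$-algebra embedding $\iota:E\to M_2(\mathbb{Q})$ with $E=\mathbb{Q}\times\mathbb{Q}$ or $E$ a real quadratic field; equivalently, a set $\{z\in\mathbf{H}: Az=\bar z\}$ with $A\in M_2(\mathbb{Q})$ of trace zero and negative determinant.
   Formalization: Weakly bialgebraic subsets are required to be nonempty: the empty set satisfies conditions (1) and (2) as literally stated but is neither a point nor a special geodesic. *)

(* Defs.v *)
From HB Require Import structures.
From mathcomp Require Import all_boot all_order all_algebra all_field.
From mathcomp Require Import complex.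
From mathcomp Require Import all_classical all_reals all_analysis.
Set Implicit Arguments.
Unset Strict Implicit.
Unset Printing Implicit Defensive.
Import Order.TTheory GRing.Theory Num.Theory numFieldNormedType.Exports.
Local Open Scope ring_scope.
Local Open Scope classical_set_scope.
Local Open Scope complex_scope.

Definition upper_half_plane (R : realType) : set R[i] :=
  [set z | 0 < complex.Im z].

Definition moebius (F : fieldType) (g : 'M[F]_2) (z : F) : F :=
  (g 0 0 * z + g 0 1) / (g 1 0 * z + g 1 1).

(* Points of the projective line over F are elements of [option F], with
   [None] the point at infinity. *)
Definition moebius_P1 (F : fieldType) (g : 'M[F]_2) (p : option F) : option F :=
  match p with
  | Some z => if g 1 0 * z + g 1 1 == 0 then None else Some (moebius g z)
  | None => if g 1 0 == 0 then None else Some (g 0 0 / g 1 0)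
  end.

Definition SL2Z : set 'M[int]_2 := [set g | \det g = 1].

Definition principal_congruence (N : nat) : set 'M[int]_2 :=
  [set g | SL2Z g /\
    forall i j : 'I_2, (g i j = (1%:M : 'M[int]_2) i j %[mod N%:Z])%Z].

Definition congruence_subgroup (G : set 'M[int]_2) : Prop :=
  [/\ G `<=` SL2Z,
      G 1%:M,
      forall g h, G g -> G h -> G (g *m h),
      forall g, G g -> G (invmx g)
    & exists2 N : nat, (0 < N)%N & principal_congruence N `<=` G].

Definition act (R : realType) (g : 'M[int]_2) (z : R[i]) : R[i] :=
  moebius (map_mx intr g) z.

(* e^(2 pi i z / h) *)
Definition qparam (R : realType) (h : nat) (z : R[i]) : R[i] :=
  (expR (- (2 * pi * complex.Im z / h%:R)))%:C *
  (cos (2 * pi * complex.Re z / h%:R) +i* sin (2 * pi * complex.Re z / h%:R)).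

(* At the cusp g(oo), q^m f(g z) is a convergent power series in
   q = e^(2 pi i z / h), for some width h and some pole order m. *)
Definition meromorphic_at_cusps (R : realType) (f : R[i] -> R[i]) : Prop :=
  forall g, SL2Z g ->
  exists (h m : nat) (a : nat -> R[i]), (0 < h)%N /\
    forall z, upper_half_plane z ->
      series (fun n => a n * qparam h z ^+ n : R[i]^o) @ \oo -->
        (qparam h z ^+ m * f (act g z) : R[i]^o).

(* The regular functions on the affine complex algebraic curve whose
   analytification is G\H, pulled back to H.  Only the values of [f] on H are
   relevant; differentiability is over the field R[i], i.e. holomorphy.  For
   G = SL2Z these are the polynomials in j. *)
Definition curve_function (R : realType) (G : set 'M[int]_2)
    (f : R[i] -> R[i]) : Prop :=
  [/\ forall z, upper_half_plane z -> derivable (f : R[i]^o -> R[i]^o) z 1,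
      forall g z, G g -> upper_half_plane z -> f (act g z) = f z
    & meromorphic_at_cusps f].

(* The coordinate ring of the real surface Y_G, the Weil restriction of that
   curve: the R-algebra generated by the real and imaginary parts of the
   regular functions on the curve.  As Y_G is integral with Zariski-dense real
   points, its elements are identified with functions on Y_G(R) = G\H, here
   pulled back to H.  For G = SL2Z they are the real polynomials in Re j and
   Im j, i.e. the polynomial functions on the affine plane. *)
Inductive surface_function (R : realType) (G : set 'M[int]_2) :
    (R[i] -> R) -> Prop :=
| surface_cst (c : R) : surface_function G (fun=> c)
| surface_Re (f : R[i] -> R[i]) of curve_function G f :
    surface_function G (fun z => complex.Re (f z))
| surface_Im (f : R[i] -> R[i]) of curve_function G f :
    surface_function G (fun z => complex.Im (f z))
| surface_add (u v : R[i] -> R) of surface_function G u & surface_function G v :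
    surface_function G (fun z => u z + v z)
| surface_mul (u v : R[i] -> R) of surface_function G u & surface_function G v :
    surface_function G (fun z => u z * v z).

(* The projection p_G : H -> Y_G(R) = G\H, a point of G\H being an orbit. *)
Definition proj (R : realType) (G : set 'M[int]_2) (z : R[i]) : set R[i] :=
  [set act g z | g in G].

Definition surface (R : realType) (G : set 'M[int]_2) : set (set R[i]) :=
  [set proj G z | z in @upper_half_plane R].

(* [W] is the set of real points of a closed subvariety of Y_G, namely of the
   one cut out by the elements of [S]. *)
Definition surface_algebraic (R : realType) (G : set 'M[int]_2)
    (W : set (set R[i])) : Prop :=
  exists S : set (R[i] -> R), S `<=` surface_function G /\
    W = [set proj G z | z in
          [set z | upper_half_plane z /\ forall u, S u -> u z = 0]].

(* V(R) /\ H for the closed subvariety V of the affine plane cut out by the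
   elements P(x)(y) of [S] (the inner variable being x = Re z, the outer one
   y = Im z). *)
Definition plane_zeros (R : realType) (S : set {poly {poly R}}) : set R[i] :=
  [set z | upper_half_plane z /\
    forall P, S P -> P.[(complex.Im z)%:P].[complex.Re z] = 0].

Definition plane_algebraic (R : realType) (X : set R[i]) : Prop :=
  exists S : set {poly {poly R}}, X = plane_zeros S.

(* The empty set is not irreducible, by convention. *)
Definition plane_irreducible (R : realType) (X : set R[i]) : Prop :=
  X !=set0 /\
  ~ exists X1 X2 : set R[i],
      [/\ plane_algebraic X1, plane_algebraic X2, X = X1 `|` X2,
          X1 `<` X & X2 `<` X].

(* Since the real points of Y_G are Zariski-dense, a closed subvariety of Y_G
   is proper if and only if its set of real points is. *)
Definition weakly_bialgebraic (R : realType) (X : set R[i]) : Prop :=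
  X `<` @upper_half_plane R /\
  exists G : set 'M[int]_2,
    [/\ congruence_subgroup G,
        plane_algebraic X,
        exists W : set (set R[i]),
          [/\ surface_algebraic G W, W `<` surface G & proj G @` X `<=` W]
      & plane_irreducible X].

Definition geodesic (R : realType) (p q : option R) : set R[i] :=
  match p, q with
  | Some a, Some b =>
      [set z | upper_half_plane z /\
        (complex.Re z - (a + b) / 2) ^+ 2 + complex.Im z ^+ 2 =
        ((a - b) / 2) ^+ 2]
  | Some a, None | None, Some a =>
      [set z | upper_half_plane z /\ complex.Re z = a]
  | None, None => set0
  end.

Definition torus_fixed_points (R : realType) (E : comUnitAlgType rat)
    (iota : {lrmorphism E -> 'M[rat]_2}) : set (option R[i]) :=
  [set p | forall u : E, u \is a GRing.unit ->
    moebius_P1 (map_mx ratr (iota u)) p = p].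

Definition geodesic_of_embedding (R : realType) (E : comUnitAlgType rat)
    (iota : {lrmorphism E -> 'M[rat]_2}) (X : set R[i]) : Prop :=
  exists p q : option R,
    [/\ p <> q,
        torus_fixed_points iota =
          [set omap (real_complex R) p; omap (real_complex R) q]
      & X = geodesic p q].

(* A quadratic field is real when it embeds into R. *)
Definition special_geodesic (R : realType) (X : set R[i]) : Prop :=
  (exists iota : {lrmorphism (rat^o * rat^o)%type -> 'M[rat]_2},
      injective iota /\ geodesic_of_embedding iota X) \/
  (exists (E : fieldExtType rat) (iota : {lrmorphism E -> 'M[rat]_2}),
      [/\ \dim {:E} = 2%N, inhabited {rmorphism E -> R}, injective iota
        & geodesic_of_embedding iota X]).

(* Main.v *)
(* Let X be infinite and let u be a nonzero function of the surface vanishing on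
   X.  Writing u as sum_i a_i(z) conj(b_i(z)) with modular a_i, b_i, polarization
   gives V(z, w) on H x H^- (H^- the lower half-plane) with V(z, conj z) = u(z),
   and X lies on a complex curve Q(z, w) = 0, with w = conj z on X.  As X has
   dimension 1, V vanishes on Q = 0 near a point of X, hence along every
   continuation of that branch inside H x H^-.  As z moves in H, w cannot leave
   H^- through a real point, because near a rational number V(z, w) has the
   exponential size dictated by the cusp; so above every good z in H some w in
   H^- satisfies Q(z, w) = V(z, w) = 0.  For fixed z the zeros w of V(z, .) form
   finitely many orbits under a congruence subgroup, and V is invariant under
   z -> z + N: by pigeonhole some g in SL2(Z) and l > 0 satisfy
   Q(z + l, g w) = 0 for infinitely many points (z, w) of the curve, hence for
   almost all of them.  Iterating, the points (z + j l, g^j w) lie on the curve,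
   and according to the type of g this makes Q a fractional linear relation
   between z and w, with a rational value of w at z = oo.  Doing this at the cusps
   oo, 0 and 1 shows that X lies on a circle or line with rational equation
   p |z|^2 + 2 q Re z + r = 0; irreducibility gives equality, and the
   equation is that of the special geodesic A z = conj z for
   A = (-q, -r; p, q). *)
Require Import Defs.
From HB Require Import structures.
From mathcomp Require Import all_boot all_order all_algebra all_field.
From mathcomp Require Import complex ring lra zify.
From mathcomp Require Import all_classical all_reals all_analysis.
Set Implicit Arguments.
Unset Strict Implicit.
Unset Printing Implicit Defensive.
Import Order.TTheory GRing.Theory Num.Theory numFieldNormedType.Exports.
Local Open Scope ring_scope.
Local Open Scope classical_set_scope.
Local Open Scope complex_scope.

(** * Moduli and holomorphy by jets *)

(** Every function that occurs is built from q-expansions or from branches of an algebraic curve.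
    For both, all Taylor polynomials can be exhibited, so holomorphy is taken in the form of jets,
    and the identity theorem follows from a maximum principle on small squares. The curve Q = 0 may
    branch over z; a polynomial beta collects all bad z, and paths are chosen to avoid its zeros.
    The cusp argument compares two rates: as w tends to a rational point, the leading coefficient of
    V(z, w) at that cusp is holomorphic in z and so at least a power of the distance, while
    vanishing of V would make it exponentially small. The pigeonhole yields l and g depending on z;
    they range over a countable set and z over an uncountable segment, so one pair serves infinitely
    many points. For hyperbolic g the w-orbit tends geometrically to a fixed point while z grows
    linearly, so w is constant on the curve. Three cusps are used because the condition at a cusp is
    void when the circle passes through it, and because a centre at 0 makes the conditions at oo and
    0 silent on the radius. *)

Section Modulus.
Context {R : realType}.
Implicit Types z w : R[i].

Definition nm z : R := Normc.normc z.

Lemma ReD z w : complex.Re (z + w) = complex.Re z + complex.Re w.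
Proof. by case: z w => [? ?] [? ?]. Qed.

Lemma ImD z w : complex.Im (z + w) = complex.Im z + complex.Im w.
Proof. by case: z w => [? ?] [? ?]. Qed.

Lemma ReN z : complex.Re (- z) = - complex.Re z.
Proof. by case: z. Qed.

Lemma ImN z : complex.Im (- z) = - complex.Im z.
Proof. by case: z. Qed.

Lemma ReM z w : complex.Re (z * w) =
  complex.Re z * complex.Re w - complex.Im z * complex.Im w.
Proof. by case: z w => [? ?] [? ?]. Qed.

Lemma ImM z w : complex.Im (z * w) =
  complex.Re z * complex.Im w + complex.Im z * complex.Re w.
Proof. by case: z w => [? ?] [? ?]. Qed.

Lemma complex_ext z w : complex.Re z = complex.Re w ->
  complex.Im z = complex.Im w -> z = w.
Proof. by case: z w => [? ?] [? ?] /= -> ->. Qed.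

Definition ReImE := (ReD, ImD, ReN, ImN, ReM, ImM).

Lemma nm_ge0 z : 0 <= nm z.
Proof. by case: z => a b; rewrite /nm /= sqrtr_ge0. Qed.

Lemma nm0 : nm 0 = 0.
Proof. exact: Normc.normc0. Qed.

Lemma nm1 : nm 1 = 1.
Proof. exact: Normc.normc1. Qed.

Lemma nm_eq0 z : (nm z == 0) = (z == 0).
Proof.
apply/eqP/eqP => [|->]; last exact: nm0.
exact: Normc.eq0_normc.
Qed.

Lemma nm_gt0 z : (0 < nm z) = (z != 0).
Proof. by rewrite lt_neqAle nm_ge0 andbT eq_sym nm_eq0. Qed.

Lemma nmM z w : nm (z * w) = nm z * nm w.
Proof. exact: Normc.normcM. Qed.

Lemma nmV z : nm z^-1 = (nm z)^-1.
Proof. exact: Normc.normcV. Qed.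

Lemma nmX z n : nm (z ^+ n) = nm z ^+ n.
Proof. by elim: n => [|n IH]; rewrite ?expr0 ?nm1 // !exprS nmM IH. Qed.

Lemma nmN z : nm (- z) = nm z.
Proof. exact: normcN. Qed.

Lemma nmBC z w : nm (z - w) = nm (w - z).
Proof. by rewrite -nmN opprB. Qed.

Lemma nmD z w : nm (z + w) <= nm z + nm w.
Proof. exact: le_normcD. Qed.

Lemma nm_dist z w : nm z - nm w <= nm (z - w).
Proof. by rewrite lerBlDr (le_trans _ (nmD _ _)) // subrK. Qed.

Lemma nm_tri z w u : nm (z - u) <= nm (z - w) + nm (w - u).
Proof. by rewrite (le_trans _ (nmD _ _)) // addrA subrK. Qed.

Lemma nm_real (x : R) : nm x%:C = `|x|.
Proof. by rewrite /nm /= expr0n addr0 sqrtr_sqr. Qed.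

Lemma nmJ z : nm z^* = nm z.
Proof. by case: z => a b; rewrite /nm /= sqrrN. Qed.

Lemma nm_sqr z : nm z ^+ 2 = complex.Re z ^+ 2 + complex.Im z ^+ 2.
Proof. by case: z => a b; rewrite /nm /= sqr_sqrtr // addr_ge0 ?sqr_ge0. Qed.

Lemma nm_Re z : `|complex.Re z| <= nm z.
Proof.
rewrite -(@ler_pXn2r _ 2) ?nnegrE ?nm_ge0 // nm_sqr.
by rewrite real_normK ?num_real // lerDl sqr_ge0.
Qed.

Lemma nm_Im z : `|complex.Im z| <= nm z.
Proof.
rewrite -(@ler_pXn2r _ 2) ?nnegrE ?nm_ge0 // nm_sqr.
by rewrite real_normK ?num_real // lerDr sqr_ge0.
Qed.

Lemma nm_Cauchy z : nm z <= `|complex.Re z| + `|complex.Im z|.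
Proof.
rewrite -(@ler_pXn2r _ 2) ?nnegrE ?nm_ge0 ?addr_ge0 // nm_sqr sqrrD.
rewrite !real_normK ?num_real //.
by rewrite lerD2r lerDl mulrn_wge0 // mulr_ge0.
Qed.

Lemma nm_sum (I : Type) (r : seq I) (F : I -> R[i]) :
  nm (\sum_(i <- r) F i) <= \sum_(i <- r) nm (F i).
Proof.
elim: r => [|i r IH]; first by rewrite !big_nil nm0.
by rewrite !big_cons (le_trans (nmD _ _)) // lerD2l.
Qed.

End Modulus.

(** * Holomorphy by Taylor polynomials with remainder *)

Section Jets.
Context {R : realType}.
Local Notation C := R[i].
Implicit Types (p z t : C) (F G : C -> C) (T : {poly C}).

Lemma horner_bounded T (r : R) : exists2 B : R, 0 < B &
  forall t, nm t <= r -> nm T.[t] <= B.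
Proof.
elim/poly_ind: T => [|T c [B B0 HB]].
  by exists 1 => // t _; rewrite horner0 nm0.
exists (B * Num.max r 0 + nm c + 1).
  by rewrite ltr_wpDl // addr_ge0 ?nm_ge0 // mulr_ge0 ?(ltW B0) // le_max lexx orbT.
move=> t tr; rewrite hornerMXaddC (le_trans (nmD _ _)) // nmM.
rewrite -addrA lerD //; last by rewrite lerDl.
by rewrite ler_pM ?nm_ge0 ?HB // le_max tr.
Qed.

Lemma horner_lip T (r : R) : exists2 B : R, 0 < B &
  forall s t, nm s <= r -> nm t <= r -> nm (T.[s] - T.[t]) <= B * nm (s - t).
Proof.
elim/poly_ind: T => [|T c [B B0 HB]].
  by exists 1 => // s t _ _; rewrite !horner0 subrr nm0 mul1r nm_ge0.
have [D D0 HD] := horner_bounded T r.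
exists (B * Num.max r 0 + D).
  by rewrite ltr_wpDl // mulr_ge0 ?(ltW B0) // le_max lexx orbT.
move=> s t sr tr; rewrite !hornerMXaddC.
have -> : T.[s] * s + c - (T.[t] * t + c) =
          (T.[s] - T.[t]) * s + T.[t] * (s - t) by ring.
rewrite (le_trans (nmD _ _)) // !nmM mulrDl lerD //.
  rewrite mulrAC ler_pM ?nm_ge0 ?HB // le_max sr //.
by rewrite ler_wpM2r ?nm_ge0 ?HD.
Qed.

(** T is not truncated at degree n: products and composites of approximating polynomials then serve
    as they are, without any bookkeeping of coefficients. *)
Definition jet (n : nat) F p := exists (T : {poly C}) (K r : R),
  0 < r /\ forall t, nm t < r -> nm (F (p + t) - T.[t]) <= K * nm t ^+ n.

(* A function all of whose Taylor expansions at p exist, in the sense of Peano: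
   every property of holomorphic functions needed here follows from this. *)
Definition hol F p := forall n, jet n F p.

Lemma jetP n F p : jet n F p -> exists (T : {poly C}) (K r : R),
  [/\ 0 < K, 0 < r & r <= 1] /\
  forall t, nm t < r -> nm (F (p + t) - T.[t]) <= K * nm t ^+ n.
Proof.
move=> [T [K [r [r0 H]]]]; exists T, (Num.max K 1), (Num.min r 1); split.
  by split; rewrite ?lt_max ?lt_min ?r0 ?ltr01 ?orbT // ge_min lexx orbT.
move=> t; rewrite lt_min => /andP[tr t1].
apply: le_trans (H _ tr) _; rewrite ler_wpM2r ?exprn_ge0 ?nm_ge0 //.
by rewrite le_max lexx.
Qed.

Lemma jet_le m n F p : (m <= n)%N -> jet n F p -> jet m F p.
Proof.
move=> mn /jetP[T [K [r [[K0 r0 r1] H]]]]; exists T, K, r; split => // t tr.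
apply: le_trans (H _ tr) _; rewrite ler_wpM2l ?(ltW K0) //.
by rewrite ler_wiXn2l ?nm_ge0 // ltW // (lt_le_trans tr).
Qed.

(** Lets a proof start at order one, where the bound at t = 0 already forces the constant term of T
    to be F(p). *)
Lemma jet_pos F p : (forall n, jet n.+1 F p) -> hol F p.
Proof. by move=> H n; apply: jet_le (H n). Qed.

Lemma jet0 n F p T K r : 0 < r ->
  (forall t, nm t < r -> nm (F (p + t) - T.[t]) <= K * nm t ^+ n.+1) ->
  T.[0] = F p.
Proof.
move=> r0 /(_ 0); rewrite nm0 r0 addr0 exprS mul0r mulr0 => /(_ isT) h.
by apply/eqP; rewrite eq_sym -subr_eq0 -nm_eq0 eq_le h nm_ge0.
Qed.

Lemma hol_near F G p (r : R) : 0 < r ->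
  (forall t, nm t < r -> F (p + t) = G (p + t)) -> hol F p -> hol G p.
Proof.
move=> r0 FG h n; have [T [K [s [s0 H]]]] := h n.
exists T, K, (Num.min r s); split; first by rewrite lt_min r0.
by move=> t; rewrite lt_min => /andP[tr ts]; rewrite -FG // H.
Qed.

Lemma hol_poly T p : hol (fun z => T.[z]) p.
Proof.
move=> n; exists (T \Po (p%:P + 'X)), 0, 1; split => // t _.
by rewrite horner_comp !hornerE subrr nm0.
Qed.

Lemma hol_cst c p : hol (fun=> c) p.
Proof.
by apply: (hol_near ltr01 _ (hol_poly c%:P p)) => t _; rewrite hornerC.
Qed.

Lemma hol_id p : hol id p.
Proof.
by apply: (hol_near ltr01 _ (hol_poly 'X p)) => t _; rewrite hornerX.
Qed.

Lemma hol_add F G p : hol F p -> hol G p -> hol (fun z => F z + G z) p.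
Proof.
move=> hF hG n.
have [T [K [r [[K0 r0 r1] H]]]] := jetP (hF n).
have [T' [K' [r' [[K'0 r'0 r'1] H']]]] := jetP (hG n).
exists (T + T'), (K + K'), (Num.min r r'); split; first by rewrite lt_min r0.
move=> t; rewrite lt_min => /andP[tr tr']; rewrite hornerD opprD addrACA.
by rewrite (le_trans (nmD _ _)) // mulrDl lerD ?H ?H'.
Qed.

Lemma hol_mul F G p : hol F p -> hol G p -> hol (fun z => F z * G z) p.
Proof.
move=> hF hG n.
have [T [K [r [[K0 r0 r1] H]]]] := jetP (hF n).
have [T' [K' [r' [[K'0 r'0 r'1] H']]]] := jetP (hG n).
have [B B0 HB] := horner_bounded T 1; have [B' B'0 HB'] := horner_bounded T' 1.
exists (T * T'), ((B + K) * K' + K * B'), (Num.min r r'); split.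
  by rewrite lt_min r0.
move=> t; rewrite lt_min => /andP[tr tr'].
have t1 : nm t <= 1 by rewrite ltW // (lt_le_trans tr).
have tn1 : nm t ^+ n <= 1 by rewrite exprn_ile1 ?nm_ge0.
have tn0 : 0 <= nm t ^+ n by rewrite exprn_ge0 ?nm_ge0.
have FB : nm (F (p + t)) <= B + K.
  have := nmD (F (p + t) - T.[t]) T.[t]; rewrite subrK => /le_trans -> //.
  rewrite addrC lerD ?HB // (le_trans (H _ tr)) //.
  by rewrite -[leRHS]mulr1 ler_wpM2l ?(ltW K0).
rewrite hornerM.
have -> : F (p + t) * G (p + t) - T.[t] * T'.[t] =
  F (p + t) * (G (p + t) - T'.[t]) + (F (p + t) - T.[t]) * T'.[t] by ring.
rewrite (le_trans (nmD _ _)) // !nmM mulrDl lerD //.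
  by rewrite -mulrA ler_pM ?nm_ge0 ?H'.
by rewrite mulrAC ler_pM ?nm_ge0 ?H ?HB'.
Qed.

Lemma hol_comp F G p : hol F p -> hol G (F p) -> hol (fun z => G (F z)) p.
Proof.
move=> hF hG; apply: jet_pos => n.
have [T [K [r [[K0 r0 r1] H]]]] := jetP (hF n.+1).
have [S [L [s [[L0 s0 s1] HS]]]] := jetP (hG n.+1).
have T0 := jet0 r0 H.
have [B B0 HB] := horner_lip T 1.
have [D D0 HD] := horner_lip S (B + K + 1).
pose q := Num.min r (s / (B + K)).
(* B + K is a Lipschitz constant of F at p. The first summand is the remainder of G at displacement
   F(p + t) - F(p); in the second, D is the Lipschitz constant by which S transports the remainder
   of F. *)
exists (S \Po (T - (F p)%:P)), (L * (B + K) ^+ n.+1 + D * K), q; split.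
  by rewrite lt_min r0 divr_gt0 // addr_gt0.
move=> t; rewrite lt_min => /andP[tr]; rewrite ltr_pdivlMr ?addr_gt0 // => ts.
have t1 : nm t <= 1 by rewrite ltW // (lt_le_trans tr).
have Tt : nm (T.[t] - F p) <= B * nm t.
  by rewrite -T0 (le_trans (HB _ _ _ _)) ?nm0 ?ler01 // subr0.
have Ft : nm (F (p + t) - F p) <= (B + K) * nm t.
  rewrite (le_trans (nm_tri _ T.[t] _)) // mulrDl addrC lerD //.
  rewrite (le_trans (H _ tr)) // ler_wpM2l ?(ltW K0) // exprS.
  by rewrite ler_piMr ?nm_ge0 // exprn_ile1 ?nm_ge0.
rewrite horner_comp !hornerE.
apply: le_trans (nm_tri _ S.[F (p + t) - F p] _) _; rewrite mulrDl lerD //.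
  have h := HS (F (p + t) - F p); rewrite subrKC in h.
  apply: le_trans (h _) _; first by rewrite (le_lt_trans Ft) // mulrC.
  rewrite -mulrA -exprMn ler_wpM2l ?(ltW L0) //.
  by apply: lerXn2r; rewrite ?nnegrE ?nm_ge0 // mulr_ge0 ?nm_ge0 // addr_ge0 ?ltW.
have BKt a : 0 < a -> a <= B + K -> a * nm t <= B + K + 1.
  move=> a0 aB; rewrite ler_wpDr ?ler01 // (le_trans _ aB) // ler_piMr //.
  exact: ltW.
apply: (le_trans (HD (F (p + t) - F p) (T.[t] - F p) _ _)).
- by rewrite (le_trans Ft) // BKt // addr_gt0.
- by rewrite (le_trans Tt) // BKt // lerDl ltW.
have -> : F (p + t) - F p - (T.[t] - F p) = F (p + t) - T.[t] by ring.
by rewrite -mulrA ler_wpM2l ?(ltW D0) ?H.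
Qed.

Lemma hol_inv p : p != 0 -> hol (fun z => z^-1) p.
Proof.
move=> p0 n; have np0 : 0 < nm p by rewrite nm_gt0.
exists (\sum_(k < n) ((- 1) ^+ k / p ^+ k.+1) *: 'X^k).
exists (2 / nm p ^+ n.+1), (nm p / 2); split; first by rewrite divr_gt0.
move=> t tp.
have pt : nm p / 2 <= nm (p + t).
  have := nm_dist p (- t); rewrite nmN opprK; lra.
have pt0 : p + t != 0 by rewrite -nm_gt0; lra.
(* Exact remainder of the geometric series cut at n. *)
have -> : (p + t)^-1 - (\sum_(k < n) ((- 1) ^+ k / p ^+ k.+1) *: 'X^k).[t] =
          (- t) ^+ n / (p ^+ n * (p + t)).
  rewrite horner_sum; elim: n => [|n IH].
    by rewrite big_ord0 !expr0 subr0 mul1r mul1r.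
  rewrite big_ord_recr /= opprD addrA IH hornerZ hornerXn.
  rewrite !exprS [(- t) ^+ n]exprNn.
    have : p ^+ n != 0 by rewrite expf_neq0.
    move: ((- 1) ^+ n) (t ^+ n) (p ^+ n) => a b c c0; field.
    by rewrite p0 pt0 c0.
rewrite nmM nmV nmM !nmX nmN mulrC exprS.
rewrite ler_wpM2r ?exprn_ge0 ?nm_ge0 //.
have pn0 : 0 < nm p ^+ n by rewrite exprn_gt0.
have -> : 2 / (nm p * nm p ^+ n) = (nm p ^+ n * (nm p / 2))^-1.
  by field; rewrite !gt_eqF.
rewrite lef_pV2 ?posrE ?mulr_gt0 ?invr_gt0 //; last by lra.
by rewrite ler_wpM2l // ltW.
Qed.

Lemma hol_div F G p : hol F p -> hol G p -> G p != 0 ->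
  hol (fun z => F z / G z) p.
Proof.
move=> hF hG G0; apply: hol_mul => //.
exact: (hol_comp hG (hol_inv G0)).
Qed.

Lemma hol_exp F p n : hol F p -> hol (fun z => F z ^+ n) p.
Proof.
move=> hF; elim: n => [|n IH]; first exact: hol_cst.
by apply: (hol_near ltr01 _ (hol_mul hF IH)) => t _; rewrite exprS.
Qed.

Lemma hol_sum (I : Type) (r : seq I) (F : I -> C -> C) p :
  (forall i, hol (F i) p) -> hol (fun z => \sum_(i <- r) F i z) p.
Proof.
move=> hF; elim: r => [|i r IH].
  by apply: (hol_near ltr01 _ (hol_cst 0 p)) => t _; rewrite big_nil.
by apply: (hol_near ltr01 _ (hol_add (hF i) IH)) => t _; rewrite big_cons.
Qed.

Lemma hol_lip F p : hol F p -> exists (K r : R), [/\ 0 < K, 0 < r &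
  forall t, nm t < r -> nm (F (p + t) - F p) <= K * nm t].
Proof.
move=> /(_ 1%N) /jetP[T [K [r [[K0 r0 r1] H]]]].
have [B B0 HB] := horner_lip T 1; have T0 := jet0 r0 H.
exists (K + B), r; split => //; first by rewrite addr_gt0.
move=> t tr; rewrite (le_trans (nm_tri _ T.[t] _)) // mulrDl lerD ?H //.
rewrite -T0 (le_trans (HB _ _ _ _)) ?nm0 ?ler01 ?subr0 //.
by rewrite ltW // (lt_le_trans tr).
Qed.

Lemma hol_cont F p : hol F p -> forall e : R, 0 < e -> exists2 d : R, 0 < d &
  forall z, nm (z - p) < d -> nm (F z - F p) < e.
Proof.
move=> /hol_lip[K [r [K0 r0 H]]] e e0.
exists (Num.min r (e / K)); first by rewrite lt_min r0 divr_gt0.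
move=> z; rewrite lt_min ltr_pdivlMr // => /andP[zr ze].
have h := H _ zr; rewrite subrKC in h.
by rewrite (le_lt_trans h) // mulrC.
Qed.

(** For a function with all jets this amounts to the vanishing of every Taylor coefficient, but it
    needs no uniqueness of expansions. *)
Definition flat F p := forall n, exists (K r : R),
  0 < r /\ forall t, nm t < r -> nm (F (p + t)) <= K * nm t ^+ n.

(** If some order n admits no expansion with zero coefficients below n, then in any expansion of
    order n the nonzero coefficient of least index d < n dominates near p, because |t|^n <= |t|
    |t|^d there. Otherwise every order of decay is available and F is flat. *)
Lemma flat_or_order F p : hol F p -> flat F p \/
  exists (d : nat) (c r : R), [/\ 0 < c, 0 < r &
    forall t, nm t < r -> c * nm t ^+ d <= nm (F (p + t))].
Proof.
move=> hF.
have [H|] := pselect (forall n, exists (T : {poly C}) (K r : R), [/\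
    forall k, (k < n)%N -> T`_k = 0, 0 < r &
    forall t, nm t < r -> nm (F (p + t) - T.[t]) <= K * nm t ^+ n]).
  left=> n; have [T [K [r [T0 r0 Tr]]]] := H n.
  have ET : T = drop_poly n T * 'X^n.
    have := poly_take_drop n T => {1}<-; rewrite [X in X + _](_ : _ = 0) ?add0r //.
    by apply/polyP => i; rewrite coef_take_poly coef0; case: ifP => // /T0.
  have [B B0 HB] := horner_bounded (drop_poly n T) 1.
  exists (K + B), (Num.min r 1); split; first by rewrite lt_min r0 ltr01.
  move=> t; rewrite lt_min => /andP[tr t1].
  rewrite -[F _](subrK T.[t]) (le_trans (nmD _ _)) // mulrDl lerD ?Tr //.
  rewrite ET hornerM hornerXn nmM nmX ler_wpM2r ?exprn_ge0 ?nm_ge0 //.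
  by rewrite HB // ltW.
move=> /existsNP[n Hn]; right.
have [T [K [r [[K0 r0 r1] Tr]]]] := jetP (hF n).
have [d dn Td0] : exists2 d, (d < n)%N & T`_d != 0.
  apply: contra_notP Hn => /forall2NP Hd; exists T, K, r; split => // k kn.
  by have [//|/negP/negPn/eqP] := Hd k.
have exd : exists d, (d < n)%N && (T`_d != 0) by exists d; rewrite dn.
case: (ex_minnP exd) => {dn Td0}d' {exd d}; move: d' => d /andP[dn Td0] dmin.
have ET : T = drop_poly d T * 'X^d.
  have := poly_take_drop d T => {1}<-; rewrite [X in X + _](_ : _ = 0) ?add0r //.
  apply/polyP => i; rewrite coef_take_poly coef0; case: ifP => // id.
  apply/eqP; apply: contraTT id => Ti0; rewrite -leqNgt.
  case: (ltnP i n) => [ilt|/(leq_trans (ltnW dn))//].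
  by apply: dmin; rewrite ilt.
have [B B0 HB] := horner_lip (drop_poly d T) 1.
have c0 : 0 < nm (T`_d) by rewrite nm_gt0.
exists d, (nm T`_d / 2), (Num.min r (nm T`_d / (2 * (B + K)))).
have BK : 0 < 2 * (B + K) by rewrite mulr_gt0 // addr_gt0.
split; rewrite ?divr_gt0 ?lt_min ?r0 ?divr_gt0 //.
move=> t; rewrite lt_min ltr_pdivlMr // => /andP[tr tc].
have t1 : nm t < 1 by rewrite (lt_le_trans tr).
have D0 : (drop_poly d T).[0] = T`_d by rewrite horner_coef0 coef_drop_poly.
have h1 : nm T`_d - B * nm t <= nm (drop_poly d T).[t].
  rewrite lerBlDl -lerBlDr (le_trans (nm_dist _ _)) // -D0 nmBC.
  by rewrite (le_trans (HB _ _ _ _)) ?nm0 ?subr0 // ltW.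
have h2 : nm T.[t] - K * nm t ^+ n <= nm (F (p + t)).
  rewrite lerBlDl -lerBlDr (le_trans (nm_dist _ _)) // nmBC.
  by rewrite Tr.
have Tt : T.[t] = (drop_poly d T).[t] * t ^+ d.
  by rewrite {1}ET hornerM hornerXn.
apply: le_trans h2; rewrite Tt nmM nmX.
have tn : nm t ^+ n <= nm t * nm t ^+ d.
  by rewrite -exprS ler_wiXn2l ?nm_ge0 // ltW.
have td : 0 <= nm t ^+ d by rewrite exprn_ge0 ?nm_ge0.
have := ler_wpM2l (ltW K0) tn; have := ler_wpM2r td h1.
have : (B + K) * nm t * nm t ^+ d <= nm T`_d / 2 * nm t ^+ d.
  by rewrite ler_wpM2r //; lra.
by move=> ? ? ?; lra.
Qed.

End Jets.

(** * Compactness of rectangles *)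

Section Compactness.
Context {R : realType}.
Local Notation C := R[i].

(** Compactness in filter form: a parameter that works near each point works on the whole rectangle.
    It is applied to bounds tending to infinity, to gaps tending to 0 and to finite sets ordered by
    inclusion. *)
Lemma box_near_covering (a b c d : R) (I : Type) (F : set_system I)
    (P : I -> C -> Prop) : Filter F ->
  (forall z, a <= complex.Re z <= b -> c <= complex.Im z <= d ->
     exists2 e : R, 0 < e & \forall i \near F, forall z',
       nm (z' - z) < e -> P i z') ->
  \forall i \near F, forall z, a <= complex.Re z <= b ->
    c <= complex.Im z <= d -> P i z.
Proof.
move=> FF H.
have /compact_near_coveringP cK :
    compact (`[a, b]%classic `*` `[c, d]%classic : set (R * R)).
  by apply: compact_setX; apply: segment_compact.
have kH : \forall i \near F, `[a, b]%classic `*` `[c, d]%classic `<=`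
    (fun p => P i (p.1 +i* p.2)%C).
  apply: cK.
  move=> -[x y] [/= /[!in_itv]/= xab ycd].
  have [e e0 He] := H (x +i* y)%C xab ycd.
  exists ([set p | `|x - p.1| < e / 2 /\ `|y - p.2| < e / 2],
          [set i | forall z', nm (z' - (x +i* y)%C) < e -> P i z']) => /=.
    split; last exact: He.
    exists ([set u | `|x - u| < e / 2], [set u | `|y - u| < e / 2]) => /=.
      by split; apply/nbhs_ballP; exists (e / 2) => //=; rewrite divr_gt0.
    by move=> p [].
  move=> [[u v] k] /= [[xu yv] Hk]; apply: Hk.
  apply: le_lt_trans (nm_Cauchy _) _; rewrite /= distrC [X in _ + X]distrC.
  by rewrite [ltRHS](splitr e) ltrD.
apply: filterS kH => i Hi -[x y] /= xab ycd.
by apply: (Hi (x, y)); split; rewrite /= in_itv.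
Qed.

(** Bolzano-Weierstrass. Without an accumulation point each point has a neighbourhood meeting Z at
    most in itself, and compactness along the filter of finite sets puts all of Z into one finite
    set. *)
Lemma accumulation (Z : set C) (a b c d : R) : infinite_set Z ->
  (forall z, Z z -> a <= complex.Re z <= b /\ c <= complex.Im z <= d) ->
  exists p, [/\ a <= complex.Re p <= b, c <= complex.Im p <= d &
    forall e : R, 0 < e -> exists z, [/\ Z z, z != p & nm (z - p) < e]].
Proof.
move=> infZ Zbox; apply: contrapT => /forallNP noacc.
pose F : set_system (set C) := [set A | exists2 F0, finite_set F0 &
  forall G, finite_set G -> F0 `<=` G -> A G].
have FF : Filter F.
  split.
  - by exists set0.
  - move=> A B [F1 f1 H1] [F2 f2 H2]; exists (F1 `|` F2).
      by rewrite finite_setU.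
    move=> G fG; rewrite subUset => -[G1 G2]; split; [exact: H1|exact: H2].
  - by move=> A B AB [F1 f1 H1]; exists F1 => // G fG F1G; apply/AB/H1.
have : \forall G \near F, forall z, a <= complex.Re z <= b ->
    c <= complex.Im z <= d -> Z z -> G z.
  apply: box_near_covering => z zab zcd.
  have [e e0 He] : exists2 e : R, 0 < e &
      forall z', Z z' -> nm (z' - z) < e -> z' = z.
    apply: contrapT => /forall2NP H; apply: (noacc z).
    split => // e e0; have [//|/existsNP[z' /not_implyP[Zz']]] := H e.
    by move=> /not_implyP[z'e /eqP z'z]; exists z'.
  exists e => //; exists [set z] => // G _ Gz z' /[swap] Zz' /He -> //.
  exact: Gz.
case=> F0 f0 /(_ F0 f0 (subset_refl _)) HF0; apply: infZ.
by apply: sub_finite_set f0 => z Zz; have [? ?] := Zbox z Zz; apply: HF0.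
Qed.

(** Upper semicontinuity suffices: were the supremum S not attained, f <= S - k would hold near
    every point for small k > 0, and compactness makes one k serve everywhere. *)
Lemma box_max (a b c d : R) (K : set C) (f : C -> R) (z0 : C) : K z0 ->
  (forall z, K z -> a <= complex.Re z <= b /\ c <= complex.Im z <= d) ->
  (forall z, ~ K z -> exists2 e : R, 0 < e &
     forall z', nm (z' - z) < e -> ~ K z') ->
  (forall z, K z -> forall e : R, 0 < e -> exists2 r : R, 0 < r &
     forall z', K z' -> nm (z' - z) < r -> f z' < f z + e) ->
  exists2 z, K z & forall z', K z' -> f z' <= f z.
Proof.
move=> Kz0 Kbox Kclosed fusc.
have [M fM] : exists M : R, forall z, K z -> f z <= M.
  have : \forall M \near +oo, forall z, a <= complex.Re z <= b ->
      c <= complex.Im z <= d -> K z -> f z <= M.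
    apply: box_near_covering => z _ _.
    have [Kz|/Kclosed[e e0 He]] := pselect (K z); last first.
      by exists e => //; apply: nearW => M z' /He.
    have [r r0 Hr] := fusc z Kz 1 ltr01; exists r => //.
    apply: filterS (nbhs_pinfty_ge (num_real (f z + 1))) => M zM z' z'r Kz'.
    by rewrite (le_trans _ zM) // ltW // Hr.
  move=> /(@filter_ex _ _ _)[M HM]; exists M => z Kz.
  by have [? ?] := Kbox z Kz; apply: HM.
pose S := sup (f @` K).
have hasS : has_sup (f @` K).
  by split; [exists (f z0), z0|exists M => _ [z Kz <-]; exact: fM].
have fS z : K z -> f z <= S by move=> Kz; apply: ub_le_sup hasS.2 _ _; exists z.
apply: contrapT => /forall2NP nomax.
have ltS z : K z -> f z < S.
  move=> Kz; rewrite lt_neqAle fS // andbT; apply/eqP => fzS.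
  by have [//|[]] := nomax z; move=> z' /fS; rewrite fzS.
have : \forall k \near 0^'+, forall z, a <= complex.Re z <= b ->
    c <= complex.Im z <= d -> K z -> f z <= S - k.
  apply: box_near_covering => z _ _.
  have [Kz|/Kclosed[e e0 He]] := pselect (K z); last first.
    by exists e => //; apply: nearW => k z' /He.
  have e0 : 0 < (S - f z) / 2 by rewrite divr_gt0 // subr_gt0 ltS.
  have [r r0 Hr] := fusc z Kz _ e0; exists r => //.
  apply: filterS (nbhs_right_lt e0) => k ke z' z'r Kz'.
  by have := Hr z' Kz' z'r; lra.
move=> h; have [k [k0 Hk]] :=
  @filter_ex _ _ (at_right_proper_filter (0 : R)) _
    (filterI (nbhs_right_gt (0 : R)) h).
have : S <= S - k.
  apply: ge_sup; first by exists (f z0), z0.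
  by move=> _ [z Kz <-]; have [? ?] := Kbox z Kz; apply: Hk.
by rewrite /= in k0; lra.
Qed.

End Compactness.

(** * Maximum principle and identity theorem *)

Section Identity.
Context {R : realType}.
Local Notation C := R[i].
Implicit Types (p z t : C) (F G : C -> C).

(* The mean of |F|^2 over the vertices p + i^j r of a small square exceeds
   |F p|^2 up to O(r^3), because 1, i^j, i^2j are orthogonal. *)
Lemma hol_submean F p : hol F p -> exists (K r0 : R), [/\ 0 < K, 0 < r0 &
  forall r, 0 < r -> r < r0 ->
    4 * nm (F p) ^+ 2 - K * r ^+ 3 <=
    nm (F (p + r%:C)) ^+ 2 + nm (F (p - r%:C)) ^+ 2 +
    nm (F (p + (r *i)%C)) ^+ 2 + nm (F (p - (r *i)%C)) ^+ 2].
Proof.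
move=> hF; have [T [K [r0 [[K0 r00 r01] H]]]] := jetP (hF 3%N).
have T0 := jet0 r00 H.
have [B B0 HB] := horner_bounded (drop_poly 3 T) 1.
pose c0 := T`_0; pose c1 := T`_1; pose c2 := T`_2.
pose L := K + B.
pose Q t := c0 + c1 * t + c2 * t ^+ 2.
have HQ t : nm t < r0 -> nm (F (p + t) - Q t) <= L * nm t ^+ 3.
  move=> tr; rewrite (le_trans (nm_tri _ T.[t] _)) // mulrDl lerD ?H //.
  have -> : T.[t] - Q t = (drop_poly 3 T).[t] * t ^+ 3.
    rewrite -{1}(poly_take_drop 3 T) hornerD hornerM hornerXn addrAC.
    rewrite (_ : (take_poly 3 T).[t] = Q t) ?subrr ?add0r //.
    rewrite (@horner_coef_wide _ 3) ?size_take_poly //.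
    by rewrite !big_ord_recr big_ord0 /= !coef_take_poly /= add0r expr0 mulr1.
  rewrite nmM nmX ler_wpM2r ?exprn_ge0 ?nm_ge0 // HB // ltW //.
  exact: lt_le_trans tr r01.
have [D D0 HD] := horner_bounded (take_poly 3 T) 1.
have QD t : nm t < r0 -> nm (Q t) <= D.
  move=> tr; rewrite (_ : Q t = (take_poly 3 T).[t]).
    by rewrite HD // ltW // (lt_le_trans tr).
  rewrite (@horner_coef_wide _ 3) ?size_take_poly //.
  by rewrite !big_ord_recr big_ord0 /= !coef_take_poly /= add0r expr0 mulr1.
have L0 : 0 < L by rewrite addr_gt0.
exists (8 * D * L), r0; split; rewrite ?mulr_gt0 // => r rr0 rr.
have low t : nm t = r ->
    nm (Q t) ^+ 2 - 2 * D * L * r ^+ 3 <= nm (F (p + t)) ^+ 2.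
  move=> tr; have trr : nm t < r0 by rewrite tr.
  have h1 := HQ _ trr; have h2 := QD _ trr.
  have h3 : nm (Q t) - L * r ^+ 3 <= nm (F (p + t)).
    rewrite -{1}tr lerBlDl -lerBlDr (le_trans (nm_dist _ _)) // nmBC //.
  have h4 := nm_ge0 (Q t); have h5 := nm_ge0 (F (p + t)).
  have h6 : 0 <= L * r ^+ 3 by rewrite mulr_ge0 ?exprn_ge0 ?ltW.
  have -> : 2 * D * L * r ^+ 3 = 2 * D * (L * r ^+ 3) by ring.
  move: h3 h6; move: (L * r ^+ 3) => x h3 h6.
  case: (lerP (nm (Q t)) x) => xq; nra.
have nr : nm r%:C = r by rewrite nm_real ger0_norm ?ltW.
have ni : nm (r *i)%C = r.
  by rewrite /nm /= expr0n add0r sqrtr_sqr ger0_norm ?ltW.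
have := low _ nr; have := low (- r%:C); rewrite nmN => /(_ nr).
have := low _ ni; have := low (- (r *i)%C); rewrite nmN => /(_ ni).
move=> l1 l2 l3 l4.
suff : 4 * nm (F p) ^+ 2 <= nm (Q r%:C) ^+ 2 + nm (Q (- r%:C)) ^+ 2 +
    nm (Q (r *i)%C) ^+ 2 + nm (Q (- (r *i)%C)) ^+ 2 by lra.
rewrite -T0 horner_coef0 -/c0 /Q !nm_sqr.
rewrite -subr_ge0 !expr2 !ReImE /=.
(* The difference of the two sides is exactly this sum, the cross terms cancelling over the four
   vertices. *)
apply: (@le_trans _ _ (4 * r ^+ 2 * nm c1 ^+ 2 + 4 * r ^+ 4 * nm c2 ^+ 2)).
  by rewrite addr_ge0 // mulr_ge0 ?exprn_ge0 ?nm_ge0 // mulr_ge0 ?exprn_ge0 ?ltW.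
by rewrite le_eqVlt !nm_sqr; apply/orP; left; apply/eqP; ring.
Qed.

(** The term e |z - c|^2 makes the function strictly subharmonic: over the four vertices it gains
    exactly 4 e r^2, which beats the error K r^3 once K r <= 2 e. *)
Lemma hol_no_max F p (e : R) (c : C) : hol F p -> 0 < e ->
  forall r1 : R, 0 < r1 -> exists z, nm (z - p) < r1 /\
    nm (F p) ^+ 2 + e * nm (p - c) ^+ 2 < nm (F z) ^+ 2 + e * nm (z - c) ^+ 2.
Proof.
move=> hF e0 r1 r10; apply: contrapT => /forallNP noz.
have le z : nm (z - p) < r1 ->
    nm (F z) ^+ 2 + e * nm (z - c) ^+ 2 <= nm (F p) ^+ 2 + e * nm (p - c) ^+ 2.
  by move=> zr; rewrite leNgt; apply/negP => lt; apply: (noz z).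
have [K [r0 [K0 r00 H]]] := hol_submean hF.
pose r := Num.min (r0 / 2) (Num.min (r1 / 2) (2 * e / K)).
have r_gt0 : 0 < r by rewrite !lt_min !divr_gt0 ?mulr_gt0.
have rr0 : r < r0 by rewrite !gt_min; apply/orP; left; lra.
have rr1 : r < r1 by rewrite !gt_min; apply/orP; right; apply/orP; left; lra.
have rK : K * r <= 2 * e.
  by rewrite mulrC -ler_pdivlMr // !ge_min lexx !orbT.
have nr : nm r%:C = r by rewrite nm_real ger0_norm ?ltW.
have ni : nm (r *i)%C = r.
  by rewrite /nm /= expr0n add0r sqrtr_sqr ger0_norm ?ltW.
have a1 : nm (p + r%:C - p) < r1 by rewrite addrC addKr nr.
have a2 : nm (p - r%:C - p) < r1 by rewrite addrC addKr nmN nr.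
have a3 : nm (p + (r *i)%C - p) < r1 by rewrite addrC addKr ni.
have a4 : nm (p - (r *i)%C - p) < r1 by rewrite addrC addKr nmN ni.
have := H _ r_gt0 rr0; move: (le _ a1) (le _ a2) (le _ a3) (le _ a4).
set f0 := nm (F p) ^+ 2; set f1 := nm (F _) ^+ 2; set f2 := nm (F _) ^+ 2.
set f3 := nm (F _) ^+ 2; set f4 := nm (F _) ^+ 2.
rewrite !nm_sqr !ReImE /= => b1 b2 b3 b4 b5.
have : 0 < r ^+ 2 * (4 * e - K * r).
  by rewrite mulr_gt0 ?exprn_gt0 // subr_gt0 (le_lt_trans rK) // ltr_pM2r ?ltr_nat.
nra.
Qed.

Lemma sqr_perturb (a b y : R) : 0 <= a -> 0 <= b -> 0 <= y -> y <= 1 ->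
  b - a <= y -> b ^+ 2 <= a ^+ 2 + y * (2 * a + 1).
Proof.
move=> a0 b0 y0 y1 bay; have : b ^+ 2 <= (a + y) ^+ 2.
  by rewrite lerXn2r ?nnegrE ?addr_ge0 //; lra.
have : y * y <= y by rewrite ler_piMr.
rewrite !expr2; nra.
Qed.

Lemma exprn_small (q e : R) : 0 <= q -> q < 1 -> 0 < e ->
  exists n, q ^+ n < e.
Proof.
move=> q0 q1 e0; have := @cvg_expr R q; rewrite ger0_norm // => /(_ q1).
move=> /cvgrPdist_lt /(_ e e0)[N _ /(_ N (leqnn N))] /=.
by rewrite sub0r normrN ger0_norm ?exprn_ge0 // => h; exists N.
Qed.

(* Maximum principle for F / (z - p)^n, then n tends to infinity. *)
Lemma flat_disc F p (r : R) : (forall z, nm (z - p) <= r -> hol F z) ->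
  flat F p -> forall z, nm (z - p) < r -> F z = 0.
Proof.
move=> hF fF z zr; have [->|zp] := eqVneq z p.
  have [K [s [s0 H]]] := fF 1%N.
  have := H 0; rewrite nm0 addr0 expr1 mulr0 => /(_ s0) h.
  by apply/eqP; rewrite -nm_eq0 eq_le h nm_ge0.
have dz : 0 < nm (z - p) by rewrite nm_gt0 subr_eq0.
have r0 : 0 < r by apply: lt_trans zr.
pose D := [set w : C | nm (w - p) <= r].
have Dbox w : D w -> complex.Re p - r <= complex.Re w <= complex.Re p + r /\
    complex.Im p - r <= complex.Im w <= complex.Im p + r.
  move=> Dw; have := le_trans (nm_Re _) Dw; have := le_trans (nm_Im _) Dw.
  by rewrite !ReImE !ler_norml => /andP[? ?] /andP[? ?]; split; lra.
have Dclosed w : ~ D w -> exists2 e : R, 0 < e &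
    forall w', nm (w' - w) < e -> ~ D w'.
  move=> /negP; rewrite -ltNge => rw; exists (nm (w - p) - r).
    by rewrite subr_gt0.
  move=> w' w'w Dw'; have := nm_tri w w' p; rewrite /D /= in Dw'.
  by rewrite [X in _ <= X + _]nmBC; lra.
have usc (f : C -> C) (c : C) (e : R) w : 0 < e -> hol f w ->
    forall d : R, 0 < d -> exists2 s : R, 0 < s & forall w', nm (w' - w) < s ->
      nm (f w') ^+ 2 + e * nm (w' - c) ^+ 2 <
      nm (f w) ^+ 2 + e * nm (w - c) ^+ 2 + d.
  move=> e0 hf d d0.
  pose A := 2 * nm (f w) + 1; pose B := 2 * nm (w - c) + 1.
  have A0 : 0 < A by rewrite ltr_wpDl ?mulr_ge0 ?nm_ge0.
  have B0 : 0 < B by rewrite ltr_wpDl ?mulr_ge0 ?nm_ge0.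
  have m0 : 0 < Num.min 1 (d / (2 * A)) by rewrite lt_min ltr01 divr_gt0 ?mulr_gt0.
  have [s s0 Hs] := hol_cont hf m0.
  exists (Num.min s (Num.min 1 (d / (2 * e * B)))).
    by rewrite !lt_min s0 ltr01 divr_gt0 // !mulr_gt0.
  move=> w'; rewrite !lt_min => /and3P[/Hs + w'1].
  rewrite lt_min !ltr_pdivlMr ?mulr_gt0 // => /andP[f1 fA] wB.
  have h2 := nm_dist (f w') (f w).
  have h3 := nm_dist (w' - c) (w - c).
  have e1 : w' - c - (w - c) = w' - w by ring.
  rewrite e1 in h3.
  have k1 := sqr_perturb (nm_ge0 _) (nm_ge0 _) (nm_ge0 _) (ltW f1) h2.
  have k2 := sqr_perturb (nm_ge0 _) (nm_ge0 _) (nm_ge0 _) (ltW w'1) h3.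
  have := ler_wpM2l (ltW e0) k2; rewrite -/A -/B in k1 *; lra.
have [M M0 HM] : exists2 M : R, 0 <= M &
    forall w, nm (w - p) = r -> nm (F w) ^+ 2 <= M.
  have Dp : D p by rewrite /D /= subrr nm0 ltW.
  have [w Dw Hw] := box_max Dp Dbox Dclosed
    (fun w Dw d d0 => let: ex_intro2 s s0 H := usc F p 1 w ltr01 (hF w Dw) d d0
      in ex_intro2 _ _ s s0 (fun w' _ => H w')).
  exists (nm (F w) ^+ 2 + 1 * nm (w - p) ^+ 2).
    by rewrite addr_ge0 ?mul1r ?exprn_ge0 ?nm_ge0.
  move=> w' w'r; apply: le_trans (Hw w' _); last by rewrite /D /= w'r.
  by rewrite lerDl mul1r exprn_ge0 ?nm_ge0.
have key n : nm (F z) ^+ 2 <= M * ((nm (z - p) / r) ^+ 2) ^+ n.+1.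
  pose G w := F w * ((w - p)^-1) ^+ n.+1.
  (* As 0^-1 = 0, G takes the value 0 at p; flatness of order n + 2 will make this its limit. *)
  have Gp : G p = 0 by rewrite /G subrr invr0 expr0n mulr0.
  have hG w : D w -> w != p -> hol G w.
    move=> Dw wp; apply: hol_mul; first exact: hF.
    apply/hol_exp/(hol_comp (F := fun w => w - p)).
      exact: hol_add (hol_id _) (hol_cst _ _).
    by apply: hol_inv; rewrite subr_eq0.
  (* The summand e |w - p|^2 excludes a maximum at any other interior point by [hol_no_max], so it
     sits at p, where the function is 0, or on the boundary circle; e then tends to 0. *)
  have Gz (e : R) : 0 < e ->
      nm (G z) ^+ 2 <= M * (r^-1 ^+ 2) ^+ n.+1 + e * r ^+ 2.
    move=> e0.
    have Dp : D p by rewrite /D /= subrr nm0 ltW.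
    pose f w := nm (G w) ^+ 2 + e * nm (w - p) ^+ 2.
    have fusc w : D w -> forall d : R, 0 < d -> exists2 s : R, 0 < s &
        forall w', D w' -> nm (w' - w) < s -> f w' < f w + d.
      move=> Dw d d0; have [->|wp] := eqVneq w p; last first.
        by have [s s0 Hs] := usc G p e w e0 (hG w Dw wp) d d0; exists s => // w' _ /Hs.
      have [K [s [s0 HK]]] := fF n.+2.
      have L0 : 0 < K ^+ 2 + e by rewrite ltr_wpDl ?sqr_ge0.
      exists (Num.min s (Num.min 1 (d / (K ^+ 2 + e)))).
        by rewrite !lt_min s0 ltr01 divr_gt0.
      move=> w' _; rewrite !lt_min ltr_pdivlMr // => /and3P[w's w'1 w'd].
      rewrite /f Gp subrr nm0 expr0n /= mulr0 !add0r.
      have [->|w'p] := eqVneq w' p.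
        by rewrite Gp subrr nm0 expr0n /= mulr0 addr0.
      have x0 : 0 < nm (w' - p) by rewrite nm_gt0 subr_eq0.
      have GK : nm (G w') <= K * nm (w' - p).
        rewrite /G nmM nmX nmV exprVn ler_pdivrMr ?exprn_gt0 //.
        by rewrite -mulrA -exprS; have := HK _ w's; rewrite subrKC.
      have := nm_ge0 (G w'); move: (nm (G w')) (nm (w' - p)) x0 w'1 w'd GK.
      move=> g x x0 x1 xd gK g0.
      have k1 : g ^+ 2 <= (K * x) ^+ 2.
        by rewrite lerXn2r ?nnegrE // (le_trans g0).
      have k2 : (K ^+ 2 + e) * x ^+ 2 <= (K ^+ 2 + e) * x.
        by rewrite ler_wpM2l ?(ltW L0) // expr2 ler_piMr // ltW.
      rewrite exprMn in k1; lra.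
    have [w Dw wmax] := box_max Dp Dbox Dclosed fusc.
    have zw : nm (G z) ^+ 2 <= f w.
      apply: le_trans (wmax z (ltW zr)); rewrite /f lerDl.
      by rewrite mulr_ge0 ?exprn_ge0 ?nm_ge0 // ltW.
    apply: le_trans zw _.
    have [->|wp] := eqVneq w p.
      rewrite /f Gp subrr nm0 expr0n /= mulr0 addr0.
      by rewrite addr_ge0 // mulr_ge0 ?exprn_ge0 ?invr_ge0 // ltW.
    have [wr|wr] := eqVneq (nm (w - p)) r.
      rewrite /f wr lerD2r /G nmM nmX nmV wr exprMn.
      by rewrite -!exprM mulnC ler_wpM2r ?exprn_ge0 ?invr_ge0 ?(ltW r0) ?HM.
    have wr' : nm (w - p) < r by rewrite lt_neqAle wr.
    have rw0 : 0 < r - nm (w - p) by rewrite subr_gt0.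
    have [w' [w'w]] := hol_no_max p (hG w Dw wp) e0 rw0.
    rewrite ltNge -/(f w) -/(f w') wmax // /D /=.
    by rewrite (le_trans (nm_tri _ w _)) // -lerBrDr ltW.
  have Gz' : nm (G z) ^+ 2 <= M * (r^-1 ^+ 2) ^+ n.+1.
    apply/ler_addgt0Pr => e e0.
    have e1 : 0 < e / r ^+ 2 by rewrite divr_gt0 ?exprn_gt0.
    by have := Gz _ e1; rewrite divfK ?expf_neq0 ?gt_eqF.
  have -> : F z = G z * (z - p) ^+ n.+1.
    by rewrite /G -mulrA -exprMn mulVf ?subr_eq0 // expr1n mulr1.
  rewrite nmM nmX exprMn; set x := nm (z - p).
  have -> : ((x / r) ^+ 2) ^+ n.+1 = (r^-1 ^+ 2) ^+ n.+1 * (x ^+ n.+1) ^+ 2.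
    by rewrite expr_div_n exprMn exprVn mulrC -!exprM mulnC.
  by rewrite [leRHS]mulrA ler_wpM2r ?sqr_ge0.
apply/eqP; rewrite -nm_eq0 eq_le nm_ge0 andbT leNgt; apply/negP => Fz0.
have q0 : 0 <= (nm (z - p) / r) ^+ 2 by rewrite sqr_ge0.
have q1 : (nm (z - p) / r) ^+ 2 < 1.
  by rewrite expr_lt1 ?ltr_pdivrMr ?mul1r // divr_ge0 ?nm_ge0 ?ltW.
have e0 : 0 < nm (F z) ^+ 2 / (M + 1) by rewrite divr_gt0 ?exprn_gt0 ?ltr_wpDl.
have [n] := exprn_small q0 q1 e0; rewrite ltr_pdivlMr ?ltr_wpDl // => qn.
have := key n; set q := (_ / _) ^+ 2 in q0 q1 qn *.
have qSn : q ^+ n.+1 <= q ^+ n by rewrite ler_wiXn2l ?(ltW q1).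
have qn0 : 0 <= q ^+ n.+1 by rewrite exprn_ge0.
have := ler_wpM2l M0 qSn; lra.
Qed.

Lemma flat_of_zero F p (r : R) : 0 < r ->
  (forall z, nm (z - p) < r -> F z = 0) -> flat F p.
Proof.
move=> r0 F0 n; exists 0, r; split => // t tr.
by rewrite mul0r F0 ?nm0 // addrC addKr.
Qed.

(** Identity theorem along a segment: the steps are shorter than r/4, and F vanishes on the disc of
    radius r/2 about each centre, hence on a disc of radius r/4 about the next one. *)
Lemma flat_segment F p z (r : R) : 0 < r ->
  (forall (s : R) w, 0 <= s <= 1 -> nm (w - (p + s%:C * (z - p))) < r ->
     hol F w) ->
  flat F p -> F z = 0.
Proof.
move=> r0 hF fF.
have r20 : 0 < r / 2 by rewrite divr_gt0.
have step (s : R) w : 0 <= s <= 1 -> flat F (p + s%:C * (z - p)) ->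
    nm (w - (p + s%:C * (z - p))) < r / 2 -> F w = 0.
  move=> s01 fs ws; apply: (flat_disc (r := r / 2) _ fs ws) => w' w'r.
  apply: hF s01 _.
  by rewrite (le_lt_trans w'r) // gtr_pMr // invf_lt1 ?ltr1n.
pose N := Num.bound (nm (z - p) / (r / 4)).
have zN : nm (z - p) < N.+1%:R * (r / 4).
  rewrite -ltr_pdivrMr ?divr_gt0 //.
  apply: lt_trans (archi_boundP _) _; last by rewrite ltr_nat.
  by rewrite divr_ge0 ?nm_ge0 // divr_ge0 ?ltW.
have all k : (k <= N.+1)%N -> flat F (p + (k%:R / N.+1%:R)%:C * (z - p)).
  elim: k => [|k IH] kN; first by rewrite mul0r mul0r addr0.
  apply: (flat_of_zero (r := r / 4)); first by rewrite divr_gt0.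
  move=> w wr; apply: step (IH (ltnW kN)) _.
    by rewrite divr_ge0 ?ler0n // ler_pdivrMr ?ltr0n // mul1r ler_nat ltnW.
  pose p' := p + (k.+1%:R / N.+1%:R)%:C * (z - p).
  apply: le_lt_trans (nm_tri _ p' _) _.
  have -> : r / 2 = r / 4 + r / 4 by field.
  rewrite ltrD // (_ : _ - _ = (N.+1%:R^-1)%:C * (z - p)).
    by rewrite nmM nm_real ger0_norm ?invr_ge0 ?ler0n // mulrC ltr_pdivrMr ?ltr0n // mulrC.
  rewrite opprD addrACA subrr add0r -mulrBl -rmorphB /= -mulrBl.
  by rewrite -natrB ?leqnSn // subSnn mul1r.
have := all _ (leqnn _); rewrite divff ?pnatr_eq0 // => f1.
apply: (step 1 z _ f1); first by rewrite ler01 lexx.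
by rewrite mul1r subrKC subrr nm0.
Qed.

End Identity.

(** * Plane curves and analytic continuation *)

Section PlaneCurves.
Context {R : realType}.
Local Notation C := R[i].
Implicit Types (Q G H : {poly {poly C}}) (p : {poly C}) (z w : C).

(* The outer variable is w, the inner one is z. *)
Definition ev Q z w : C := Q.[w%:P].[z].

Lemma ev0 z w : ev 0 z w = 0.
Proof. by rewrite /ev !horner0. Qed.

Lemma evC p z w : ev p%:P z w = p.[z].
Proof. by rewrite /ev hornerC. Qed.

Lemma evX z w : ev 'X z w = w.
Proof. by rewrite /ev hornerX hornerC. Qed.

Lemma evD Q G z w : ev (Q + G) z w = ev Q z w + ev G z w.
Proof. by rewrite /ev !hornerD. Qed.

Lemma evN Q z w : ev (- Q) z w = - ev Q z w.
Proof. by rewrite /ev !hornerN. Qed.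

Lemma evM Q G z w : ev (Q * G) z w = ev Q z w * ev G z w.
Proof. by rewrite /ev !hornerM. Qed.

Lemma evZ p Q z w : ev (p *: Q) z w = p.[z] * ev Q z w.
Proof. by rewrite /ev hornerZ hornerM. Qed.

Lemma evMXaddC Q p z w : ev (Q * 'X + p%:P) z w = ev Q z w * w + p.[z].
Proof. by rewrite evD evM evX evC. Qed.

Definition fiber Q z : {poly C} := map_poly (horner_eval z) Q.

Lemma fiberE Q z w : (fiber Q z).[w] = ev Q z w.
Proof. by rewrite -{1}(hornerC w z) /fiber (horner_map (horner_eval z)). Qed.

Lemma fiber_deriv Q z w : ((fiber Q z)^`()).[w] = ev Q^`() z w.
Proof. by rewrite /fiber deriv_map fiberE. Qed.

Lemma fiber_deg Q z : (size (fiber Q z) <= size Q)%N.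
Proof. exact: size_poly. Qed.

Lemma ev_swap Q z w : ev (swapXY Q) z w = ev Q w z.
Proof. exact: horner2_swapXY. Qed.

Lemma finite_roots p : p != 0 -> finite_set [set z | p.[z] = 0].
Proof.
move=> p0; have [s ps] := closed_field_poly_normal p.
apply: (sub_finite_set (B := [set` s])); last exact: finite_seq.
move=> z /= pz; move: p0 pz; rewrite -lead_coef_eq0 => p0.
rewrite {1}ps hornerZ => /eqP; rewrite mulf_eq0 (negPf p0) /=.
by rewrite horner_prod prodf_seq_eq0 => /hasP[y ys]; rewrite !hornerE subr_eq0 => /eqP->.
Qed.

(** Irreducibility in C(z)[w] with denominators cleared: p absorbs them, and factors depending on z
    alone count as units. *)
Definition irr Q := (1 < size Q)%N /\ forall p G H, p != 0 ->
  p *: Q = G * H -> (1 < size G)%N -> (size H <= 1)%N.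

Lemma bezout_or_gcd Q G : Q != 0 -> (1 < size (gcdp Q G))%N \/
  exists (U V : {poly {poly C}}) p, p != 0 /\ U * Q + V * G = p%:P.
Proof.
move=> Q0; case: (ltnP 1 (size (gcdp Q G))) => h; [by left|right].
have g0 : gcdp Q G != 0 by rewrite gcdp_eq0 (negPf Q0).
have [[U V] /= /eqpP[[a b] /= /andP[a0 b0] E]] := Bezoutp Q G.
have gC := size1_polyC h; exists (a *: U), (a *: V), (b * (gcdp Q G)`_0).
split; last by rewrite -!scalerAl -scalerDr E [in LHS]gC polyCM mul_polyC.
by rewrite mulf_neq0 //; apply: contraNneq g0 => g0; rewrite gC g0.
Qed.

(** A Bezout identity would place all common points above the finitely many zeros of a polynomial in
    z. Hence the gcd is nonconstant in w, equals Q up to factors in C[z], and Q divides G; p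
    collects these factors. *)
Lemma irr_common Q G : irr Q ->
  infinite_set [set z | exists w, ev Q z w = 0 /\ ev G z w = 0] ->
  exists2 p, p != 0 & forall z w, p.[z] != 0 -> ev Q z w = 0 -> ev G z w = 0.
Proof.
move=> [sQ irrQ] inf.
have Q0 : Q != 0 by rewrite -size_poly_gt0 ltnW.
have [sg|[U [V [p [p0 E]]]]] := bezout_or_gcd G Q0; last first.
  case: inf; apply: sub_finite_set (finite_roots p0) => z [w [Qz Gz]] /=.
  by rewrite -(evC p z w) -E evD !evM Qz Gz !mulr0 addr0.
have /Pdiv.WeakIdomain.dvdpP[[c H] /= c0 cQ] := dvdp_gcdl Q G.
have /Pdiv.WeakIdomain.dvdpP[[d K] /= d0 dG] := dvdp_gcdr Q G.
have /size1_polyC Hh : (size H <= 1)%N by apply: irrQ c0 _ sg; rewrite mulrC.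
have h0 : H`_0 != 0.
  apply: contraNneq Q0 => h0; move/eqP: cQ.
  by rewrite Hh h0 polyC0 mul0r scale_poly_eq0 (negPf c0).
exists (H`_0 * d); first by rewrite mulf_neq0.
move=> z w; rewrite hornerM mulf_eq0 negb_or => /andP[hz dz] Qz.
have := congr1 (fun P => ev P z w) cQ; rewrite evZ Qz mulr0 evM Hh evC.
move/eqP; rewrite eq_sym mulf_eq0 (negPf hz) /= => /eqP gz.
have := congr1 (fun P => ev P z w) dG; rewrite evZ evM gz mulr0.
by move/eqP; rewrite mulf_eq0 (negPf dz) => /eqP.
Qed.

Lemma ev_bounded Q (r : R) : exists2 B : R, 0 < B &
  forall z w, nm z <= r -> nm w <= r -> nm (ev Q z w) <= B.
Proof.
elim/poly_ind: Q => [|Q c [B B0 HB]].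
  by exists 1 => // z w _ _; rewrite ev0 nm0.
have [D D0 HD] := horner_bounded c r.
exists (B * Num.max r 0 + D).
  by rewrite ltr_wpDl // mulr_ge0 ?(ltW B0) // le_max lexx orbT.
move=> z w zr wr; rewrite evMXaddC (le_trans (nmD _ _)) // lerD ?HD // nmM.
by rewrite ler_pM ?nm_ge0 ?HB // le_max wr.
Qed.

Lemma ev_lip Q (r : R) : exists2 B : R, 0 < B & forall z w z' w',
  nm z <= r -> nm w <= r -> nm z' <= r -> nm w' <= r ->
  nm (ev Q z w - ev Q z' w') <= B * (nm (z - z') + nm (w - w')).
Proof.
elim/poly_ind: Q => [|Q c [B B0 HB]].
  exists 1 => // z w z' w' _ _ _ _.
  by rewrite !ev0 subrr nm0 mul1r addr_ge0 ?nm_ge0.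
have [D D0 HD] := horner_lip c r; have [A A0 HA] := ev_bounded Q r.
have m0 : 0 <= Num.max r 0 by rewrite le_max lexx orbT.
exists (B * Num.max r 0 + A + D).
  by rewrite ltr_wpDl // ltW // ltr_wpDl // mulr_ge0 // ltW.
move=> z w z' w' zr wr z'r w'r; rewrite !evMXaddC.
have -> : ev Q z w * w + c.[z] - (ev Q z' w' * w' + c.[z']) =
  (ev Q z w - ev Q z' w') * w + ev Q z' w' * (w - w') + (c.[z] - c.[z']) by ring.
rewrite (le_trans (nmD _ _)) // [leRHS]mulrDl lerD //; last first.
  rewrite (le_trans (HD _ _ _ _)) // ler_wpM2l ?(ltW D0) //.
  by rewrite lerDl nm_ge0.
rewrite (le_trans (nmD _ _)) // [leRHS]mulrDl !nmM lerD //.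
  by rewrite mulrAC ler_pM ?nm_ge0 ?HB // le_max wr.
by rewrite ler_pM ?nm_ge0 ?HA // lerDr nm_ge0 //.
Qed.

Lemma ev_cont Q z w (e : R) : 0 < e -> exists2 r : R, 0 < r & forall z' w',
  nm (z' - z) < r -> nm (w' - w) < r -> nm (ev Q z' w' - ev Q z w) < e.
Proof.
move=> e0; have [B B0 HB] := ev_lip Q (nm z + nm w + 1).
exists (Num.min 1 (e / (2 * B))).
  by rewrite lt_min ltr01 divr_gt0 ?mulr_gt0.
move=> z' w'; rewrite !lt_min !ltr_pdivlMr ?mulr_gt0 //.
move=> /andP[z1 ze] /andP[w1 we].
have := nm_dist z' z; have := nm_dist w' w.
have nz := nm_ge0 z; have nw := nm_ge0 w => h1 h2.
apply: le_lt_trans (HB _ _ _ _ _ _ _ _) _; lra.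
Qed.

Lemma ev_cont_neq0 Q z w : ev Q z w != 0 -> exists2 r : R, 0 < r &
  forall z' w', nm (z' - z) < r -> nm (w' - w) < r -> ev Q z' w' != 0.
Proof.
rewrite -nm_gt0 => h; have [r r0 Hr] := ev_cont Q z w h; exists r => // z' w' hz hw.
apply: contraTneq (Hr _ _ hz hw) => ->.
by rewrite sub0r nmN ltxx.
Qed.

(** Strict differentiability in the second variable, uniform in the first: near a simple root it
    makes the fibres of Q injective, with a linear lower bound. *)
Lemma ev_strict Q z w (e : R) : 0 < e -> exists2 r : R, 0 < r &
  forall z' a b, nm (z' - z) < r -> nm (a - w) < r -> nm (b - w) < r ->
  nm (ev Q z' a - ev Q z' b - (a - b) * ev Q^`() z w) <= e * nm (a - b).
Proof.
elim/poly_ind: Q e => [|Q c IH] e e0.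
  exists 1 => // z' a b _ _ _.
  by rewrite deriv0 !ev0 mulr0 !subrr nm0 mulr_ge0 ?nm_ge0 ?ltW.
have e30 : 0 < e / 3 by rewrite divr_gt0.
pose W := nm w + 1; have W0 : 0 < W by rewrite ltr_wpDl ?nm_ge0.
have [r r0 Hr] := IH (e / (3 * W)) (divr_gt0 e0 (mulr_gt0 (ltr0Sn _ 2) W0)).
have [s s0 Hs] := ev_cont Q z w e30.
pose D := nm (ev Q^`() z w) + 1; have D0 : 0 < D by rewrite ltr_wpDl ?nm_ge0.
exists (Num.min (Num.min r s) (Num.min 1 (e / (3 * D)))).
  by rewrite !lt_min r0 s0 ltr01 divr_gt0 // mulr_gt0.
move=> z' a b; rewrite !lt_min.
move=> /andP[/andP[z'r z's] _] /andP[/andP[ar as_] /andP[a1 aD]] /andP[/andP[br bs] _].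
rewrite derivD derivM derivX derivC addr0 mulr1 !evMXaddC evD evM evX.
have -> : ev Q z' a * a + c.[z'] - (ev Q z' b * b + c.[z']) -
  (a - b) * (ev Q^`() z w * w + ev Q z w) =
  (ev Q z' a - ev Q z' b - (a - b) * ev Q^`() z w) * a +
  (a - b) * ((a - w) * ev Q^`() z w) + (a - b) * (ev Q z' b - ev Q z w).
  by ring.
have -> : e * nm (a - b) = e / 3 * nm (a - b) + e / 3 * nm (a - b) + e / 3 * nm (a - b).
  by field.
rewrite (le_trans (nmD _ _)) // lerD //; last first.
  by rewrite nmM mulrC ler_wpM2r ?nm_ge0 // ltW // Hs.
rewrite (le_trans (nmD _ _)) // lerD // !nmM.
  have aW : nm a <= W by have := nm_dist a w; rewrite /W; lra.
  apply: le_trans (ler_pM _ _ (Hr _ _ _ z'r ar br) aW) _; rewrite ?nm_ge0 //.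
  by rewrite mulrAC le_eqVlt; apply/orP; left; apply/eqP; field; rewrite gt_eqF.
rewrite mulrC ler_wpM2r ?nm_ge0 //.
have h : nm (ev Q^`() z w) <= D by rewrite /D lerDl.
apply: le_trans (ler_wpM2l (nm_ge0 _) h) _.
by rewrite ltW // mulrC -ltr_pdivlMl // mulrC -mulrA -invfM.
Qed.

Lemma horner_deriv_roots (s : seq C) w : w \notin s ->
  ((\prod_(x <- s) ('X - x%:P))^`()).[w] =
  (\prod_(x <- s) ('X - x%:P)).[w] * \sum_(x <- s) (w - x)^-1.
Proof.
elim: s => [|x s IH]; first by rewrite !big_nil -polyC1 derivC horner0 mulr0.
rewrite inE negb_or => /andP[wx /IH E]; rewrite !big_cons derivM derivXsubC mul1r.
rewrite hornerD !hornerM hornerXsubC E.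
move: _.[w] (\sum_(j <- s) _) => a b; field.
by rewrite subr_eq0.
Qed.

(** Since p'/p is the sum of 1/(w - x) over the roots x, the largest term of this sum belongs to a
    root close to w. *)
Lemma root_near p w : p^`().[w] != 0 -> exists2 x, p.[x] = 0 &
  nm (w - x) * nm p^`().[w] <= (size p)%:R * nm p.[w].
Proof.
move=> p'w; have [pw|pw] := eqVneq p.[w] 0.
  by exists w; rewrite // subrr nm0 mul0r pw nm0 mulr0.
have [s ps] := closed_field_poly_normal p; set c := lead_coef p in ps.
have p0 : p != 0 by apply: contraNneq pw => ->; rewrite horner0.
have c0 : c != 0 by rewrite lead_coef_eq0.
have ws : w \notin s.
  apply: contraNN pw => ws; rewrite ps hornerZ horner_prod mulf_eq0 (negPf c0) /=.
  rewrite prodf_seq_eq0; apply/hasP; exists w => //.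
  by rewrite /= !hornerE subrr.
have dE : p^`().[w] = p.[w] * \sum_(x <- s) (w - x)^-1.
  rewrite {1}ps derivZ hornerZ horner_deriv_roots // mulrA -hornerZ -ps //.
have ss : size p = (size s).+1 by rewrite ps size_scale // size_prod_XsubC.
have [x xs Hx] : exists2 x, x \in s &
    nm (w - x) * nm (\sum_(x <- s) (w - x)^-1) <= (size p)%:R.
  apply: contrapT => /forall2NP noroot.
  have S0 : 0 < nm (\sum_(x <- s) (w - x)^-1).
    by rewrite nm_gt0; apply: contraNneq p'w => h; rewrite dE h mulr0.
  have := nm_sum s (fun x => (w - x)^-1).
  set S := nm _ in noroot S0 *; apply/negP; rewrite -ltNge.
  apply: (@le_lt_trans _ _ (\sum_(x <- s) S / (size p)%:R)).
    rewrite big_seq [leRHS]big_seq; apply: ler_sum => x xs.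
    have [//|/negP] := noroot x; rewrite -ltNge => h.
    have wx : 0 < nm (w - x).
      by rewrite nm_gt0 subr_eq0; apply: contraNneq ws => ->.
    rewrite nmV ler_pdivlMr ?ltr0n ?size_poly_gt0 // mulrC ler_pdivrMr //.
    by rewrite mulrC ltW.
  rewrite big_const_seq iter_addr_0 count_predT ss -[ltLHS]mulr_natl.
  by rewrite mulrA ltr_pdivrMr ?ltr0n // mulrC ltr_pM2l // ltr_nat.
exists x.
  rewrite ps hornerZ horner_prod; apply/eqP; rewrite mulf_eq0; apply/orP; right.
  by rewrite prodf_seq_eq0; apply/hasP; exists x => //; rewrite /= !hornerE subrr.
by rewrite dE nmM mulrCA mulrC ler_wpM2r ?nm_ge0.
Qed.

(** Roots of nearby fibres stay bounded because the leading coefficient stays away from 0, so |Q(z,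
    w')| < l e^n for z' close to z. In the factorization of Q(z, w') some factor w' - x then has
    modulus below e. *)
Lemma roots_cont Q z (e : R) : (lead_coef Q).[z] != 0 -> 0 < e ->
  exists2 r : R, 0 < r & forall z' w', nm (z' - z) < r -> ev Q z' w' = 0 ->
    exists2 w, ev Q z w = 0 & nm (w' - w) < e.
Proof.
move=> lz e0.
have Q0 : Q != 0 by rewrite -lead_coef_eq0; apply: contraNneq lz => ->; rewrite horner0.
have [n sQ] : exists n, size Q = n.+1.
  by exists (size Q).-1; rewrite prednK // size_poly_gt0.
have lQ : lead_coef Q = Q`_n by rewrite lead_coefE sQ.
have l0 : 0 < nm (lead_coef Q).[z] by rewrite nm_gt0.
set l := nm _ in l0.
have [r1 r10 Hr1] : exists2 r : R, 0 < r & forall z', nm (z' - z) < r ->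
    l / 2 < nm (lead_coef Q).[z'].
  have [r r0 Hr] := hol_cont (hol_poly (lead_coef Q) z) (divr_gt0 l0 (ltr0Sn _ 1)).
  exists r => // z' /Hr; have := nm_dist (lead_coef Q).[z] (lead_coef Q).[z'].
  by rewrite nmBC -/l; lra.
have [B B0 HB] : exists2 B : R, 0 < B & forall z' w', nm (z' - z) < Num.min r1 1 ->
    ev Q z' w' = 0 -> nm w' <= B.
  have [D D0 HD] : exists2 D : R, 0 < D & forall i : 'I_n, forall z',
      nm z' <= nm z + 1 -> nm (Q`_i).[z'] <= D.
    elim: n {sQ lQ} => [|n [D D0 HD]]; first by exists 1 => // -[].
    have [D' D'0 HD'] := horner_bounded Q`_n (nm z + 1).
    exists (D + D'); first by rewrite addr_gt0.
    move=> i z' zz'; case: (unliftP ord_max i) => [j|] ->.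
      by rewrite lift_max (le_trans (HD j _ zz')) // lerDl ltW.
    by rewrite /= (le_trans (HD' _ zz')) // lerDr ltW.
  have t0 : 0 <= n%:R * D / (l / 2).
    by rewrite !(mulr_ge0, invr_ge0, ler0n, ltW D0, ltW l0).
  exists (1 + n%:R * D / (l / 2)); first by rewrite ltr_wpDr.
  move=> z' w'; rewrite lt_min => /andP[/Hr1 lz' z'1] Qw'.
  have [w1|w1] := lerP (nm w') 1.
    by rewrite (le_trans w1) // lerDl.
  have z'b : nm z' <= nm z + 1 by have := nm_dist z' z; lra.
  rewrite ler_wpDl ?ler01 // ler_pdivlMr ?divr_gt0 //.
  move: Qw'; rewrite -fiberE (@horner_coef_wide _ n.+1) -?sQ ?fiber_deg //.
  rewrite sQ big_ord_recr /= !coef_map /= -lQ => /eqP; rewrite addrC addr_eq0 => /eqP E.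
  have : nm (lead_coef Q).[z'] * nm w' ^+ n <= n%:R * D * nm w' ^+ n.-1.
    rewrite -nmX -nmM E nmN (le_trans (nm_sum _ _)) //.
    rewrite -[n in n%:R]card_ord -sum1_card natr_sum !mulr_suml; apply: ler_sum => i _.
    rewrite mul1r nmM nmX coef_map /= ler_pM ?nm_ge0 ?exprn_ge0 ?nm_ge0 ?HD //.
    by rewrite ler_weXn2l ?(ltW w1) // -ltnS prednK // (leq_ltn_trans _ (ltn_ord i)).
  case: (n) => [|m]; rewrite ?exprS /=.
    rewrite !expr0 mulr1 mul0r mul0r => /(lt_le_trans lz').
    by rewrite ltNge divr_ge0 // ltW.
  rewrite mulrA ler_pM2r ?exprn_gt0 ?(lt_trans _ w1) //.
  by apply: le_trans; rewrite mulrC ler_wpM2r ?nm_ge0 // ltW.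
have m0 : 0 < l * e ^+ n by rewrite mulr_gt0 ?exprn_gt0.
have [A A0 HA] := ev_lip Q (nm z + B + 1).
exists (Num.min (Num.min r1 1) (l * e ^+ n / A)).
  by rewrite !lt_min r10 ltr01 divr_gt0.
move=> z' w'; rewrite lt_min ltr_pdivlMr // => /andP[z'1 z'A] Qw'.
have wB := HB _ _ z'1 Qw'.
have zb : nm z' <= nm z + B + 1.
  by move: z'1; rewrite lt_min => /andP[_]; have := nm_dist z' z; lra.
have small : nm (ev Q z w') < l * e ^+ n.
  apply: le_lt_trans z'A; rewrite mulrC -[ev Q z w']subr0 -Qw'.
  apply: le_trans (HA _ _ _ _ _ _ _ _) _ => //.
  - by have := nm_ge0 z; lra.
  - by have := nm_ge0 z; lra.
  - by have := nm_ge0 z; lra.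
  by rewrite [w' - w']subrr nm0 addr0 nmBC.
have [s] := closed_field_poly_normal (fiber Q z).
have lf : lead_coef (fiber Q z) = (lead_coef Q).[z] by rewrite lead_coef_map_eq.
have sf : size (fiber Q z) = n.+1 by rewrite size_map_poly_id0 ?sQ //.
rewrite lf => Es; apply: contrapT => /forall2NP far.
have ss : size s = n.
  by apply: succn_inj; rewrite -sf Es size_scale ?size_prod_XsubC.
have : l * e ^+ n <= nm (ev Q z w'); last by rewrite leNgt small.
rewrite -fiberE Es hornerZ nmM ler_wpM2l ?(ltW l0) // -ss.
have {}far x : x \in s -> e <= nm (w' - x).
  move=> xs; have [|/negP] := far x; last by rewrite -leNgt.
  case; rewrite -fiberE Es hornerZ horner_prod; apply/eqP; rewrite mulf_eq0.
  by apply/orP; right; rewrite prodf_seq_eq0; apply/hasP; exists x => //; rewrite /= !hornerE subrr.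
elim: (s) far => [|x t IH] far; first by rewrite big_nil hornerC nm1.
rewrite big_cons hornerM nmM !hornerE /= exprS ler_pM ?exprn_ge0 ?(ltW e0) //.
  by apply: far; rewrite inE eqxx.
by apply: IH => y yt; apply: far; rewrite inE yt orbT.
Qed.

End PlaneCurves.

(** * Holomorphic branches of a plane curve *)

Section ImplicitFunction.
Context {R : realType}.
Local Notation C := R[i].
Implicit Types (Q : {poly {poly C}}) (z w t : C) (T : {poly C}).

Lemma horner_taylor2 (A : comNzRingType) (G : {poly A}) a b :
  exists V, G.[a + b] = G.[a] + b * G^`().[a] + b ^+ 2 * V.
Proof.
elim/poly_ind: G => [|G c [V E]].
  by exists 0; rewrite deriv0 !horner0 !mulr0 !addr0.
exists (V * (a + b) + G^`().[a]).
rewrite !hornerMXaddC E derivD derivM derivX derivC addr0 mulr1.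
by rewrite hornerD hornerM hornerX; ring.
Qed.

Definition recenter Q z : {poly {poly C}} := map_poly (comp_poly (z%:P + 'X)) Q.

Lemma recenterE Q z T t : ((recenter Q z).[T]).[t] = ev Q (z + t) T.[t].
Proof.
elim/poly_ind: Q => [|Q c IH]; first by rewrite /recenter map_poly0 !horner0 ev0.
rewrite evMXaddC -IH /recenter rmorphD rmorphM /= map_polyX map_polyC /=.
by rewrite hornerMXaddC hornerD hornerM horner_comp !hornerE.
Qed.

Lemma root0_factor (p : {poly C}) : p.[0] = 0 -> exists U, p = U * 'X.
Proof.
by move=> /rootP/factor_theorem[U ->]; exists U; rewrite subr0.
Qed.

(** Hensel lifting in t: the new coefficient c = - U(0) / Q_w(z, w) cancels the term of order n + 1.
    It builds the Taylor polynomials of the branch through (z, w). *)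
Lemma hensel Q z w n : ev Q z w = 0 -> ev Q^`() z w != 0 ->
  exists T U, T.[0] = w /\ (recenter Q z).[T] = U * 'X^(n.+1).
Proof.
move=> Qw Q'w; elim: n => [|n [T [U [T0 E]]]].
  have [|U E] := @root0_factor (recenter Q z).[w%:P].
    by rewrite recenterE addr0 hornerC.
  by exists w%:P, U; rewrite hornerC expr1.
have D0 : ((recenter Q z)^`().[T]).[0] = ev Q^`() z w.
  by rewrite /recenter deriv_map recenterE addr0 T0.
pose c := - U.[0] / ev Q^`() z w.
have [V EV] := horner_taylor2 (recenter Q z) T (c%:P * 'X^(n.+1)).
have [|W EW] := @root0_factor
    (U + c%:P * (recenter Q z)^`().[T] + c%:P ^+ 2 * 'X^(n.+1) * V).
  rewrite !hornerD !hornerM D0 hornerXn expr0n /= mulr0 mul0r addr0 hornerC.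
  by rewrite /c divfK // subrr.
exists (T + c%:P * 'X^(n.+1)), W; split.
  by rewrite hornerD hornerM hornerXn expr0n /= mulr0 addr0.
rewrite EV E [in RHS]exprS [RHS]mulrA -EW; ring.
Qed.

(** Existence comes from [root_near], uniqueness from the injectivity bound [Hinj]. The jets come
    from [hensel]: Q(z + t, T(t)) has order n + 1 in t, and [Hinj] converts this into a bound on the
    distance from S to T. *)
Lemma implicit_function Q z0 w0 (e0 : R) : 0 < e0 ->
  ev Q z0 w0 = 0 -> ev Q^`() z0 w0 != 0 ->
  exists (S : C -> C) (r e : R), [/\ 0 < r, 0 < e, e <= e0 &
    forall z, nm (z - z0) < r -> [/\ nm (S z - w0) < e, ev Q z (S z) = 0,
      hol S z & forall w, nm (w - w0) < e -> ev Q z w = 0 -> w = S z]].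
Proof.
move=> e00 Qw0 Q'w0; set D := ev Q^`() z0 w0 in Q'w0.
have D0 : 0 < nm D by rewrite nm_gt0.
have D20 : 0 < nm D / 2 by rewrite divr_gt0.
have [r1 r10 Hr1] := ev_strict Q z0 w0 D20.
have [r2 r20 Hr2] := ev_cont_neq0 Q'w0.
have [r4 r40 Hr4] := ev_cont Q^`() z0 w0 D20.
pose e := Num.min e0 (Num.min r1 r2).
have e_gt0 : 0 < e by rewrite !lt_min e00 r10 r20.
have er1 : e <= r1 by rewrite !ge_min lexx orbT.
have er2 : e <= r2 by rewrite !ge_min lexx !orbT.
have n0 : 0 < (size Q).+1%:R :> R by rewrite ltr0n.
(* Makes |Q(z, w0)| small enough for [root_near] to place a root within e of w0. *)
have [r3 r30 Hr3] := ev_cont Q z0 w0 (divr_gt0 (mulr_gt0 e_gt0 D20) n0).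
pose r := Num.min (Num.min r1 r2) (Num.min r3 r4).
have r_gt0 : 0 < r by rewrite !lt_min r10 r20 r30 r40.
have Hinj z a b : nm (z - z0) < r -> nm (a - w0) < e -> nm (b - w0) < e ->
    nm D / 2 * nm (a - b) <= nm (ev Q z a - ev Q z b).
  move=> zr ae be; have zr1 : nm (z - z0) < r1.
    by move: zr; rewrite !lt_min => /andP[/andP[]].
  have h := Hr1 z a b zr1 (lt_le_trans ae er1) (lt_le_trans be er1).
  have := nm_dist ((a - b) * D) (ev Q z a - ev Q z b).
  by rewrite [leRHS]nmBC nmM; lra.
have HS z : exists w, nm (z - z0) < r -> nm (w - w0) < e /\ ev Q z w = 0.
  have [zr|] := boolP (nm (z - z0) < r); last by exists 0.
  move: (zr); rewrite !lt_min => /andP[/andP[zr1 zr2] /andP[zr3 zr4]].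
  have d1 : nm D / 2 < nm ((fiber Q z)^`().[w0]).
    have := Hr4 z w0 zr4; rewrite subrr nm0 => /(_ r40).
    have := nm_dist D (ev Q^`() z w0); rewrite fiber_deriv nmBC -/D; lra.
  have [|w fw Hw] := @root_near _ (fiber Q z) w0.
    by rewrite -nm_gt0 (lt_trans _ d1).
  exists w => _; split; last by rewrite -fiberE.
  have := Hr3 z w0 zr3; rewrite subrr nm0 => /(_ r30).
  rewrite Qw0 subr0 ltr_pdivlMr // => q1.
  have q2 : (size (fiber Q z))%:R * nm (ev Q z w0) < e * (nm D / 2).
    apply: le_lt_trans q1; rewrite mulrC ler_wpM2l ?nm_ge0 // ler_nat.
    by rewrite (leq_trans (fiber_deg _ _)).
  rewrite fiberE in Hw; have q3 := le_lt_trans Hw q2.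
  rewrite nmBC -(ltr_pM2r D20); apply: le_lt_trans q3.
  by rewrite ler_wpM2l ?nm_ge0 // ltW.
pose S z := projT1 (cid (HS z)).
have SP z : nm (z - z0) < r -> nm (S z - w0) < e /\ ev Q z (S z) = 0.
  by rewrite /S; case: (cid (HS z)).
exists S, r, e; split => //; first by rewrite ge_min lexx.
move=> z zr; have [Se Sz] := SP z zr; split => //; last first.
  move=> w we Qw; apply/eqP; rewrite -subr_eq0 -nm_eq0 eq_le nm_ge0 andbT.
  by have := Hinj z w (S z) zr we Se; rewrite Qw Sz subrr nm0 pmulr_rle0.
apply: jet_pos => n.
have Q'z : ev Q^`() z (S z) != 0.
  move: zr; rewrite !lt_min => /andP[/andP[_ zr2] _].
  by apply: Hr2 => //; exact: lt_le_trans er2.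
have [T [U [T0 E]]] := hensel n Sz Q'z.
have [B B0 HB] := horner_bounded U 1.
have [s s0 Hs] : exists2 s : R, 0 < s & forall t, nm t < s -> nm (T.[t] - w0) < e.
  have d0 : 0 < e - nm (S z - w0) by rewrite subr_gt0.
  have [s s0 Hs] := hol_cont (hol_poly T 0) d0; exists s => // t ts.
  have := Hs t; rewrite subr0 => /(_ ts); rewrite T0.
  by have := nm_tri T.[t] (S z) w0; lra.
exists T, (B / (nm D / 2)), (Num.min (Num.min s 1) (r - nm (z - z0))).
split; first by rewrite !lt_min s0 ltr01 subr_gt0.
move=> t; rewrite !lt_min => /andP[/andP[ts t1] tr].
have ztr : nm (z + t - z0) < r.
  by have := nmD (z - z0) t; rewrite addrAC; lra.
have [Se' Sz'] := SP _ ztr.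
have := Hinj _ _ _ ztr (Hs _ ts) Se'; rewrite Sz' subr0 nmBC.
rewrite -recenterE E hornerM hornerXn nmM nmX => h.
rewrite mulrAC ler_pdivlMr // mulrC (le_trans h) //.
by rewrite ler_wpM2r ?exprn_ge0 ?nm_ge0 // HB // ltW.
Qed.

End ImplicitFunction.

(** * Continuation of vanishing along the curve *)

Section Continuation.
Context {R : realType}.
Local Notation C := R[i].
Implicit Types (Q : {poly {poly C}}) (z w t : C).

Lemma deriv_neq0 (A : {poly {poly C}}) : (1 < size A)%N -> deriv A != 0.
Proof.
move=> sA; apply/eqP => A'0.
have lA : lead_coef A != 0 by rewrite lead_coef_eq0 -size_poly_gt0 ltnW.
have := congr1 (fun B : {poly {poly C}} => B`_(size A).-2) A'0.
rewrite coef_deriv coef0; case: (size A) (lead_coefE A) sA => [|[|n]] //= E _.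
rewrite -E => /eqP; rewrite -mulr_natr mulf_eq0 (negPf lA) /=.
by rewrite -polyC_natr polyC_eq0 pnatr_eq0.
Qed.

(** A nonconstant common factor with the derivative would have the full degree of Q in w, too much
    for the derivative. So a Bezout identity exists, and double roots occur only above the zeros of
    its right side p. *)
Lemma irr_separable Q : irr Q -> exists2 p : {poly C}, p != 0 &
  forall z w, p.[z] != 0 -> ev Q z w = 0 -> ev (deriv Q) z w != 0.
Proof.
move=> [sQ irrQ]; have Q0 : Q != 0 by rewrite -size_poly_gt0 ltnW.
have [sg|[U [V [p [p0 E]]]]] := bezout_or_gcd (deriv Q) Q0; last first.
  exists p => // z w pz Qz; apply: contraNneq pz => Q'z.
  by rewrite -(evC p z w) -E evD !evM Qz Q'z !mulr0 addr0.
have /Pdiv.WeakIdomain.dvdpP[[c H] /= c0 cQ] := dvdp_gcdl Q (deriv Q).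
have sH : (size H <= 1)%N by apply: irrQ c0 _ sg; rewrite mulrC.
have H0 : H != 0.
  apply: contraNneq Q0 => h0; move/eqP: cQ.
  by rewrite h0 mul0r scale_poly_eq0 (negPf c0).
have := dvdp_leq (deriv_neq0 sQ) (dvdp_gcdr Q (deriv Q)).
have : size Q = size (gcdp Q (deriv Q)).
  rewrite -(size_scale Q c0) cQ size_mul ?gcdp_eq0 ?negb_and ?Q0 //.
  by rewrite (_ : size H = 1%N) //; apply/eqP; rewrite eqn_leq sH size_poly_gt0.
by move=> <- /(leq_trans (lt_size_deriv Q0)); rewrite ltnn.
Qed.

Lemma interval_ind (P : R -> Prop) : P 0 ->
  (forall s, 0 <= s <= 1 -> exists2 e : R, 0 < e & forall u, 0 <= u <= 1 ->
     `|u - s| < e -> (P u <-> P s)) -> P 1.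
Proof.
move=> P0 loc.
pose A : set R := [set s | 0 <= s <= 1 /\ forall u, 0 <= u <= s -> P u].
have A0 : A 0.
  by split=> [|u /andP[u0 u0']]; rewrite ?lexx ?ler01 // (_ : u = 0) //; lra.
have supA : has_sup A by split; [exists 0|exists 1 => s [/andP[]]].
pose c := sup A.
have c0 : 0 <= c by apply: ub_le_sup supA.2 _ _.
have c1 : c <= 1 by apply: ge_sup; [exists 0|move=> s [/andP[]]].
have c01 : 0 <= c <= 1 by rewrite c0.
have [e e0 He] := loc _ c01.
have [s As sc] : exists2 s, A s & c - e < s by apply: sup_adherent.
have [s01 Ps] := As; have sc' : s <= c by apply: ub_le_sup supA.2 _ _.
have Pc : P c.
  apply/(He s s01); first by rewrite distrC ger0_norm ?subr_ge0 //; lra.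
  by apply: Ps; case/andP: s01 => -> _; rewrite lexx.
have up u : 0 <= u <= 1 -> u < c + e -> P u.
  move=> u01 uc; have [us|us] := lerP u s; first by apply: Ps; case/andP: u01 => ->.
  by apply/(He u u01) => //; rewrite ltr_distlC; apply/andP; split; lra.
have [//|c1'] := ltrP 1 (c + e); first by apply: up; rewrite ?ler01 ?lexx.
have : A (c + e / 2).
  split; first by apply/andP; split; lra.
  by move=> u /andP[u0 uc]; apply: up; [apply/andP; split|]; lra.
by move/(ub_le_sup supA.2); rewrite -/c; lra.
Qed.

Lemma seq_eps (T : eqType) (s : seq T) (P : T -> R -> Prop) :
  (forall x e e', P x e -> e' <= e -> P x e') ->
  (forall x, x \in s -> exists2 e : R, 0 < e & P x e) ->
  exists2 e : R, 0 < e & forall x, x \in s -> P x e.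
Proof.
move=> mono; elim: s => [|x s IH] H; first by exists 1.
have [e e0 He] := H x (mem_head _ _).
have [|e' e'0 He'] := IH; first by move=> y ys; apply: H; rewrite inE ys orbT.
exists (Num.min e e'); first by rewrite lt_min e0.
move=> y; rewrite inE => /orP[/eqP->|ys].
  by apply: mono He _; rewrite ge_min lexx.
by apply: mono (He' y ys) _; rewrite ge_min lexx orbT.
Qed.

Lemma conv_gt0 (a x y : R) : 0 <= a -> a <= 1 -> 0 < x -> 0 < y ->
  0 < (1 - a) * x + a * y.
Proof.
move=> a0 a1 x0 y0; have [->|aN0] := eqVneq a 0; first by lra.
have a_gt0 : 0 < a by rewrite lt_neqAle eq_sym aN0.
by rewrite ltr_wpDl ?mulr_gt0 // mulr_ge0 ?subr_ge0 // ltW.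
Qed.

Lemma ImB_lt z z' (e : R) : nm (z' - z) < e ->
  complex.Im z - e < complex.Im z' < complex.Im z + e.
Proof.
move=> h; have := le_lt_trans (nm_Im _) h.
by rewrite !ReImE ltr_distlC => /andP[? ?]; apply/andP; split; lra.
Qed.

(** Stands for holomorphy in two variables: only restrictions of V to holomorphic arcs in H x H^-
    are ever expanded. *)
Definition hol_on_arcs (V : C -> C -> C) := forall (f g : C -> C) p,
  hol f p -> hol g p -> 0 < complex.Im (f p) -> complex.Im (g p) < 0 ->
  hol (fun t => V (f t) (g t)) p.

(* V cannot vanish along an analytic arc (tau w, w) as w in H^- approaches a
   rational point while tau w stays inside H. *)
Definition cusp_rigid (V : C -> C -> C) := forall (x : rat) (tau : C -> C),
  let x' := (ratr x : R)%:C in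
  hol tau x' -> 0 < complex.Im (tau x') ->
  (exists c r : R, [/\ 0 < c, 0 < r & forall w, nm (w - x') < r ->
     c * nm (w - x') <= nm (tau w - tau x')]) ->
  ~ exists2 r : R, 0 < r & forall w, nm (w - x') < r -> complex.Im w < 0 ->
     V (tau w) w = 0.

Variables (Q : {poly {poly C}}) (beta : {poly C}) (V : C -> C -> C).
Hypothesis lcQ : forall z, beta.[z] != 0 -> (lead_coef Q).[z] != 0.
Hypothesis QwP : forall z w, beta.[z] != 0 -> ev Q z w = 0 -> ev (deriv Q) z w != 0.
Hypothesis QzP : forall z w, beta.[z] != 0 -> ev Q z w = 0 ->
  ev (deriv (swapXY Q)) w z != 0.
Hypothesis holV : hol_on_arcs V.
Hypothesis cuspV : cusp_rigid V.

(** Vanishing is asked on a whole neighbourhood in the curve, not just at the point, so that it is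
    an open condition and can be continued. *)
Definition vanishing z w := [/\ 0 < complex.Im z, complex.Im w < 0,
  ev Q z w = 0 & exists2 e : R, 0 < e & forall z' w', nm (z' - z) < e ->
    nm (w' - w) < e -> ev Q z' w' = 0 -> V z' w' = 0].

(** Near (z, w) the curve is a single branch w = S(z). If V vanishes along it near z', then t |->
    V(t, S t) is flat at z' and zero on the disc of radius r'/2 about z', which contains the disc of
    radius r'/4 about z. *)
Lemma vanishing_closed z w : beta.[z] != 0 -> 0 < complex.Im z ->
  complex.Im w < 0 -> ev Q z w = 0 -> exists2 e : R, 0 < e & forall z' w',
    nm (z' - z) < e -> nm (w' - w) < e -> vanishing z' w' -> vanishing z w.
Proof.
move=> bz z0 w0 Qzw; have w0' : 0 < - complex.Im w by rewrite oppr_gt0.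
have [S [r [e [r0 e0 ew HS]]]] := implicit_function w0' Qzw (QwP bz Qzw).
pose r' := Num.min r (complex.Im z).
have r'0 : 0 < r' by rewrite lt_min r0.
have holF y : nm (y - z) < r' -> hol (fun t => V t (S t)) y.
  rewrite lt_min => /andP[yr yz]; have [Se _ hS _] := HS y yr.
  apply: holV => //; first exact: hol_id.
    by have := ImB_lt yz; lra.
  by have := ImB_lt Se; lra.
exists (Num.min (r' / 4) e); first by rewrite lt_min e0 divr_gt0.
move=> z' w'; rewrite !lt_min => /andP[z'r _] /andP[_ w'e].
move=> [_ _ Qz'w' [d d0 Hd]].
have r'r : r' <= r by rewrite ge_min lexx.
have z'r' : nm (z' - z) < r by lra.
have [_ _ hS' uS'] := HS z' z'r'.
have w'S := uS' _ w'e Qz'w'.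
have [s s0 Hs] := hol_cont hS' d0.
have F0 y : nm (y - z') < Num.min (Num.min s d) (r' / 2) -> V y (S y) = 0.
  rewrite !lt_min => /andP[/andP[ys yd] yr]; apply: Hd => //.
    by rewrite w'S; apply: Hs.
  by have [] := HS y; first (have := nm_tri y z' z; lra).
have fl : flat (fun t => V t (S t)) z'.
  by apply: flat_of_zero F0; rewrite !lt_min s0 d0 divr_gt0.
have Fr y : nm (y - z') < r' / 2 -> V y (S y) = 0.
  move=> yr; apply: (flat_disc (F := fun t => V t (S t)) (r := r' / 2)) fl _ yr.
  by move=> x xr; apply: holF; have := nm_tri x z' z; lra.
split => //; exists (Num.min (r' / 4) e); first by rewrite lt_min e0 divr_gt0.
move=> y x; rewrite !lt_min => /andP[yr _] /andP[_ xe] Qyx.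
have yr' : nm (y - z) < r by lra.
have [_ _ _ uS] := HS y yr'.
by rewrite (uS _ xe Qyx) Fr //; have := nm_tri y z z'; rewrite [nm (z - z')]nmBC; lra.
Qed.

(** Near (z, w) the curve is solved the other way, as z = tau(w), thanks to [QzP]. A nearby
    vanishing point spreads along segments over the lower half of a disc about w; the real diameter
    of that disc contains a rational number, where [cuspV] is contradicted. *)
Lemma vanishing_not_real z w : beta.[z] != 0 -> 0 < complex.Im z ->
  complex.Im w = 0 -> ev Q z w = 0 -> exists2 e : R, 0 < e & forall z' w',
    nm (z' - z) < e -> nm (w' - w) < e -> ~ vanishing z' w'.
Proof.
move=> bz z0 w0 Qzw.
have Qwz : ev (swapXY Q) w z = 0 by rewrite ev_swap.
have [tau [r1 [e [r10 e0 ez Ht]]]] := implicit_function z0 Qwz (QzP bz Qzw).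
have D0 : 0 < nm (ev (deriv Q) z w) by rewrite nm_gt0 QwP.
have [r2 r20 Hr2] := ev_strict Q z w (divr_gt0 D0 (ltr0Sn _ 1)).
have ww : nm (w - w) < r1 by rewrite subrr nm0.
have [_ _ htw utw] := Ht w ww.
have tauw : tau w = z.
  by apply/esym/utw => //; rewrite subrr nm0.
have [r3 r30 Hr3] := hol_cont htw r20.
pose r := Num.min r1 (Num.min r2 r3).
have r0 : 0 < r by rewrite !lt_min r10 r20 r30.
have rr1 : r <= r1 by rewrite ge_min lexx.
exists (Num.min e r); first by rewrite lt_min e0.
move=> z' w'; rewrite !lt_min -/r => /andP[z'e _] /andP[_ w'r].
have {}w'r : nm (w' - w) < r by rewrite !lt_min.
have w'r1 := lt_le_trans w'r rr1.
move=> [_ w'0 Qz'w' [d d0 Hd]].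
have [_ _ ht' ut'] := Ht w' w'r1.
have z'E : z' = tau w' by apply: ut'; rewrite ?ev_swap.
have holF y : nm (y - w) < r -> complex.Im y < 0 -> hol (fun t => V (tau t) t) y.
  move=> yr y0; have [te _ ht _] := Ht y (lt_le_trans yr rr1).
  apply: holV => //; first exact: hol_id.
  by have := ImB_lt te; lra.
have [s s0 Hs] := hol_cont ht' d0.
have fl : flat (fun t => V (tau t) t) w'.
  have m0 : 0 < Num.min (Num.min s d) (r1 - nm (w' - w)).
    by rewrite !lt_min s0 d0 subr_gt0.
  apply: flat_of_zero m0 _ => y; rewrite !lt_min => /andP[/andP[ys yd] yr].
  apply: Hd => //; first by rewrite z'E; apply: Hs.
  by have [] := Ht y; rewrite ?ev_swap //; have := nm_tri y w' w; lra.
have Fr y : nm (y - w) < r -> complex.Im y < 0 -> V (tau y) y = 0.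
  move=> yr y0.
  pose m := Num.min (Num.min (- complex.Im y) (- complex.Im w'))
                    (Num.min (r - nm (y - w)) (r - nm (w' - w))).
  have m0 : 0 < m by rewrite !lt_min !oppr_gt0 y0 w'0 !subr_gt0 yr.
  apply: (flat_segment (F := fun t => V (tau t) t) m0) fl => a x /andP[a0 a1].
  rewrite !lt_min => /andP[/andP[xy xw'] /andP[xry xrw']].
  have := ImB_lt xy; have := ImB_lt xw'; rewrite !ReImE /= mul0r addr0 => /andP[_ i1] /andP[_ i2].
  set ix := complex.Im x in i1 i2.
  have j1 : 0 < complex.Im w' + a * (complex.Im y - complex.Im w') - complex.Im w' - ix.
    by lra.
  have j2 : 0 < complex.Im w' + a * (complex.Im y - complex.Im w') - complex.Im y - ix.
    by lra.
  apply: holF; last by have := conv_gt0 a0 a1 j1 j2; rewrite -/ix; lra.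
  have c0 : nm (w' + a%:C * (y - w') - w) <=
      (1 - a) * nm (w' - w) + a * nm (y - w).
    have -> : w' + a%:C * (y - w') - w = (1 - a)%:C * (w' - w) + a%:C * (y - w).
      by rewrite rmorphB rmorph1; ring.
    apply: le_trans (nmD _ _) _; rewrite !nmM !nm_real ger0_norm ?subr_ge0 //.
    by rewrite ger0_norm.
  have k1 : 0 < r - nm (w' - w) - nm (x - (w' + a%:C * (y - w'))) by lra.
  have k2 : 0 < r - nm (y - w) - nm (x - (w' + a%:C * (y - w'))) by lra.
  have := conv_gt0 a0 a1 k1 k2; have := nm_tri x (w' + a%:C * (y - w')) w.
  lra.
have wlt : complex.Re w - r < complex.Re w + r by lra.
have [x] := rat_in_itvoo wlt; rewrite in_itv /= => /andP[x1 x2].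
have xw : nm ((ratr x)%:C - w) < r.
  apply: le_lt_trans (nm_Cauchy _) _; rewrite !ReImE /= w0 subr0 normr0 addr0.
  by rewrite ltr_distlC; apply/andP; split; lra.
have [te _ htx _] := Ht _ (lt_le_trans xw rr1).
apply: (cuspV htx _ _ _); first by have := ImB_lt te; lra.
(* The nonzero w-derivative of Q gives |y - x'| = O(|Q(tau y, x')|), and since Q(tau x', x') = 0 the
   right side is O(|tau y - tau x'|). *)
- set x' := (ratr x)%:C in xw *.
  have xw1 := lt_le_trans xw rr1.
  have [B B0 HB] := ev_lip Q (nm z + nm w + e + r1).
  exists (nm (ev (deriv Q) z w) / 2 / B), (r - nm (x' - w)).
  split; rewrite ?divr_gt0 ?subr_gt0 // => y yx.
  have yr : nm (y - w) < r by have := nm_tri y x' w; lra.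
  have [tye Qy _ _] := Ht y (lt_le_trans yr rr1); rewrite ev_swap in Qy.
  have [txe Qx _ _] := Ht x' xw1; rewrite ev_swap in Qx.
  move: (yr) (xw); rewrite !lt_min => /and3P[yr1 yr2 yr3] /and3P[xr1 xr2 _].
  have ty : nm (tau y - z) < r2 by rewrite -tauw; apply: Hr3.
  have := Hr2 (tau y) y x' ty yr2 xr2; rewrite Qy sub0r => l2.
  have := nm_dist ((y - x') * ev (deriv Q) z w) (- ev Q (tau y) x').
  rewrite [leRHS]nmBC nmM nmN => l1.
  have bd : nm (ev Q (tau y) x') <= B * nm (tau y - tau x').
    rewrite -[ev Q (tau y) x']subr0 -Qx -[nm (tau y - _)]addr0 -[in leRHS]nm0 -(subrr x').
    have n1 := nm_dist (tau y) z; have n2 := nm_dist (tau x') z.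
    have n3 := nm_dist x' w; have nz := nm_ge0 z; have nw := nm_ge0 w.
    have x'B : nm x' <= nm z + nm w + e + r1 by lra.
    by apply: HB => //; lra.
  rewrite mulrAC ler_pdivrMr // [leRHS]mulrC (le_trans _ bd) //; lra.
exists (r - nm ((ratr x)%:C - w)); first by rewrite subr_gt0.
by move=> y yx y0; apply: Fr => //; have := nm_tri y (ratr x)%:C w; lra.
Qed.

Lemma vanishing_open z w : beta.[z] != 0 -> vanishing z w ->
  exists2 e : R, 0 < e & forall z', nm (z' - z) < e -> exists w', vanishing z' w'.
Proof.
move=> bz [z0 w0 Qzw [d d0 Hd]].
have m0 : 0 < Num.min (- complex.Im w) (d / 2) by rewrite lt_min oppr_gt0 w0 divr_gt0.
have [S [r [e [r0 e0]]]] := implicit_function m0 Qzw (QwP bz Qzw).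
rewrite le_min => /andP[ew ed] HS.
exists (Num.min r (Num.min (complex.Im z) (d / 2))).
  by rewrite !lt_min r0 z0 divr_gt0.
move=> z'; rewrite !lt_min => /and3P[z'r z'z z'd]; exists (S z').
have [Se QS _ _] := HS z' z'r; split => //.
- by have := ImB_lt z'z; lra.
- by have := ImB_lt Se; lra.
exists (d / 2); first by rewrite divr_gt0.
move=> y x yz xS; apply: Hd.
  by have := nm_tri y z' z; lra.
by have := nm_tri x (S z') w; lra.
Qed.

(** If no point above z is vanishing, each of the finitely many roots w of the fibre repels
    vanishing points: those in H^- by [vanishing_closed], real ones by [vanishing_not_real], those
    in H by the sign of Im w. By [roots_cont] a nearby fibre has no other roots. *)
Lemma vanishing_local z : beta.[z] != 0 -> 0 < complex.Im z ->
  exists2 e : R, 0 < e & forall z', nm (z' - z) < e ->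
    ((exists w', vanishing z' w') <-> exists w, vanishing z w).
Proof.
move=> bz z0; have [[w vw]|nv] := pselect (exists w, vanishing z w).
  have [e e0 He] := vanishing_open bz vw; exists e => // z' /He h.
  by split => // _; exists w.
have fz : fiber Q z != 0.
  have : lead_coef (fiber Q z) != 0.
    by rewrite lead_coef_map_eq /horner_eval ?lcQ.
  by rewrite lead_coef_eq0.
have [s Es] := closed_field_poly_normal (fiber Q z).
have rs w : ev Q z w = 0 -> w \in s.
  rewrite -fiberE Es hornerZ => /eqP; rewrite mulf_eq0 lead_coef_eq0 (negPf fz) /=.
  rewrite horner_prod prodf_seq_eq0 => /hasP[y ys].
  by rewrite /= !hornerE subr_eq0 => /eqP->.
have [||e e0 He] := @seq_eps _ s (fun w e => ev Q z w = 0 -> forall z' w',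
  nm (z' - z) < e -> nm (w' - w) < e -> ~ vanishing z' w').
- move=> w e e' H e'e Qw z' w' z'e w'e.
  exact: H Qw _ _ (lt_le_trans z'e e'e) (lt_le_trans w'e e'e).
- move=> w _; have [Qw|/eqP Qw] := eqVneq (ev Q z w) 0; last by exists 1.
  have [w0|w0|w0] := ltrgtP (complex.Im w) 0.
  + have [e e0 He] := vanishing_closed bz z0 w0 Qw; exists e => // _ z' w' h1 h2 h3.
    by apply: nv; exists w; apply: He h1 h2 h3.
  + exists (complex.Im w) => // _ z' w' _ /ImB_lt h [_ w'0 _ _].
    by lra.
  + by have [e e0 He] := vanishing_not_real bz z0 w0 Qw; exists e.
have [r r0 Hr] := roots_cont (lcQ bz) e0.
exists (Num.min r e); first by rewrite lt_min r0.
move=> z'; rewrite lt_min => /andP[z'r z'e]; split => // -[w' vw'].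
have [_ _ Qw' _] := vw'; have [w Qw ww'] := Hr _ _ z'r Qw'.
by case: (He w (rs _ Qw) Qw z' w' z'e ww').
Qed.

Lemma small_avoiding (F : set R) (e : R) : finite_set F -> 0 < e ->
  exists u, [/\ 0 < u, u < e & ~ F u].
Proof.
move=> /finite_seqP[s ->] e0.
have [||d d0 Hd] := @seq_eps _ s (fun x d => x <= 0 \/ d < x).
- by move=> x d d' [?|h] d'd; [left|right; exact: le_lt_trans h].
- move=> x _; have [x0|x0] := lerP x 0; first by exists 1 => //; left.
  by exists (x / 2); [rewrite divr_gt0|right; lra].
exists (Num.min d (e / 2)).
have m0 : 0 < Num.min d (e / 2) by rewrite lt_min d0 divr_gt0.
have me : Num.min d (e / 2) <= e / 2 by rewrite ge_min lexx orbT.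
have md : Num.min d (e / 2) <= d by rewrite ge_min lexx.
by split => //; [lra|move=> /= /Hd[]; lra].
Qed.

(** Off the zeros of beta, the existence of a vanishing point above z is locally constant. It is
    carried along a segment, which stays in H by convexity. *)
Theorem vanishing_everywhere z0 w0 z : beta.[z0] != 0 -> vanishing z0 w0 ->
  beta.[z] != 0 -> 0 < complex.Im z -> exists w, vanishing z w.
Proof.
move=> bz0 v0 bz Imz; have [->|zz0] := eqVneq z z0; first by exists w0.
have b0 : beta != 0 by apply: contraNneq bz => ->; rewrite horner0.
have [e e0 He] := vanishing_open bz0 v0.
have Imz0 : 0 < complex.Im z0 by case: v0.
have d0 : 0 < nm (z0 - z) by rewrite nm_gt0 subr_eq0 eq_sym.
(* the slope u is chosen so that the segment from z0 - iu(z0 - z) to z avoids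
   the zeros of beta *)
pose slope b := - complex.Im ((b - z) / (z0 - z)) / complex.Re ((b - z) / (z0 - z)).
have [u [u_gt0 ue nu]] := small_avoiding
  (finite_image slope (finite_roots b0)) (divr_gt0 e0 d0).
have [u0 u0P] : exists z0', z0' = z0 - (u *i)%C * (z0 - z) by eexists.
have near0 : nm (u0 - z0) < e.
  rewrite u0P addrAC subrr add0r nmN nmM.
  have -> : nm (u *i)%C = u.
    by rewrite /nm /= expr0n add0r sqrtr_sqr ger0_norm // ltW.
  by rewrite -ltr_pdivlMr.
have [w1 v1] := He _ near0.
have Imu0 : 0 < complex.Im u0 by case: v1.
pose g (s : R) := u0 + s%:C * (z - u0).
have gE s : g s = z + (1 - s)%:C * (u0 - z).
  by rewrite /g rmorphB rmorph1; ring.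
have Img s : 0 <= s <= 1 -> 0 < complex.Im (g s).
  move=> /andP[s0 s1]; rewrite /g !ReImE /= mul0r addr0.
  by have := conv_gt0 s0 s1 Imu0 Imz; lra.
have bg s : 0 <= s <= 1 -> beta.[g s] != 0.
  move=> /andP[s0 s1]; have [->|s_neq1] := eqVneq s 1.
    by rewrite /g rmorph1 mul1r subrKC.
  have s1' : 0 < 1 - s by rewrite subr_gt0 lt_neqAle s_neq1.
  apply/eqP => bg; apply: nu; exists (g s) => //; rewrite /slope gE.
  have zz : z0 - z != 0 by rewrite -nm_gt0.
  have -> : (z + (1 - s)%:C * (u0 - z) - z) / (z0 - z) =
            (1 - s)%:C * (1 - (u *i)%C).
    by rewrite u0P; field.
  by rewrite !ReImE /= !mul0r ?subr0 ?addr0 !sub0r mulr1 mulrN opprK mulrAC divff ?mul1r // gt_eqF.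
have : exists w, vanishing (g 1) w; last first.
  by rewrite /g rmorph1 mul1r subrKC.
apply: (@interval_ind (fun s => exists w, vanishing (g s) w)).
  by rewrite /g rmorph0 mul0r addr0; exists w1.
move=> s s01; have [d d_gt0 Hd] := vanishing_local (bg s s01) (Img s s01).
have L0 : 0 < nm (z - u0) + 1 by rewrite ltr_wpDl ?nm_ge0.
exists (d / (nm (z - u0) + 1)); first by rewrite divr_gt0.
move=> t t01; rewrite ltr_pdivlMr // => td; apply: Hd.
have -> : g t - g s = (t - s)%:C * (z - u0) by rewrite /g rmorphB; ring.
rewrite nmM nm_real; apply: le_lt_trans td.
by rewrite ler_wpM2l // lerDl.
Qed.

End Continuation.

(** * Power series and modular functions *)

Section Exponential.
Context {R : realType}.
Local Notation C := R[i].
Implicit Types (z w t : C).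

Definition cexp z : C := ((expR (complex.Re z))%:C *
  (cos (complex.Im z) +i* sin (complex.Im z))%C).

Lemma cexpD z w : cexp (z + w) = cexp z * cexp w.
Proof.
rewrite /cexp !ReImE expRD cosD sinD.
by apply: complex_ext; rewrite !ReImE /=; ring.
Qed.

Lemma nm_cexp z : nm (cexp z) = expR (complex.Re z).
Proof.
rewrite nmM nm_real ger0_norm ?expR_ge0 // -[RHS]mulr1; congr (_ * _).
by rewrite /nm /= cos2Dsin2 sqrtr1.
Qed.

Lemma cexp_neq0 z : cexp z != 0.
Proof. by rewrite -nm_gt0 nm_cexp expR_gt0. Qed.

Lemma cexp0 : cexp 0 = 1.
Proof. by rewrite /cexp expR0 cos0 sin0 mul1r. Qed.

Lemma MVT_bound (f df : R -> R) (M : R) :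
  (forall s : R, is_derive s 1 f (df s)) -> (forall s, 0 <= s <= 1 -> `|df s| <= M) ->
  `|f 1 - f 0| <= M.
Proof.
move=> fdf dfM; have [|c c01 ->] := @MVT_segment R f df 0 1 ler01 (fun x _ => fdf x).
  apply: continuous_subspaceT => x; apply: differentiable_continuous.
  exact/derivable1_diffP/ex_derive.
by rewrite subr0 mulr1 dfM.
Qed.

Definition exp_poly n : {poly C} := \poly_(k < n) (k`!%:R)^-1.

(** With c k the real or imaginary part of t^k, this is the corresponding part of [exp_poly n] along
    the ray s |-> s t. *)
Definition ray_poly (c : nat -> R) n : {poly R} := \poly_(k < n) (c k / k`!%:R).

Lemma ray_poly_deriv c n (s : R) :
  is_derive s 1 (horner (ray_poly c n.+1)) ((ray_poly (c \o succn) n).[s]).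
Proof.
apply: DeriveDef; first exact: derivable_horner.
rewrite -derive1E -derivE; congr (horner _ s); apply/polyP => k.
rewrite coef_deriv !coef_poly ltnS; case: ifP => _ /=; last by rewrite mul0rn.
rewrite factS natrM -mulr_natr; field.
by rewrite !pnatr_eq0 -lt0n fact_gt0 /=.
Qed.

Lemma exp_poly_ray n t (s : R) : (exp_poly n).[s%:C * t] =
  ((ray_poly (fun k => complex.Re (t ^+ k)) n).[s] +i*
   (ray_poly (fun k => complex.Im (t ^+ k)) n).[s])%C.
Proof.
rewrite !horner_poly.
elim: n => [|n IH]; first by rewrite !big_ord0.
rewrite !big_ord_recr /= IH; apply: complex_ext; rewrite !ReImE /=.
  have -> : (n`!%:R : C)^-1 = ((n`!%:R)^-1 : R)%:C by rewrite rmorphV ?rmorph_nat // unitfE pnatr_eq0 -lt0n fact_gt0.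
  by rewrite exprMn -rmorphXn !ReImE /=; ring.
have -> : (n`!%:R : C)^-1 = ((n`!%:R)^-1 : R)%:C by rewrite rmorphV ?rmorph_nat // unitfE pnatr_eq0 -lt0n fact_gt0.
by rewrite exprMn -rmorphXn !ReImE /=; ring.
Qed.

Lemma is_derive_mulr (s c : R) : is_derive s 1 (fun s : R => s * c) c.
Proof.
have -> : (fun s : R => s * c) = c \*: (id : R -> R).
  by apply/funext => x; rewrite /= mulrC.
by apply: is_derive_eq; rewrite /GRing.scale /= mulr1.
Qed.

Lemma is_derive_expcos (a b s : R) :
  is_derive s 1 (fun s : R => expR (s * a) * cos (s * b))
    (a * (expR (s * a) * cos (s * b)) - b * (expR (s * a) * sin (s * b))).
Proof.
have d1 := is_derive_mulr s.
have := @is_deriveM _ _ (fun s : R => expR (s * a)) (fun s : R => cos (s * b)) s 1 _ _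
  (is_derive1_comp (is_derive_expR _) (d1 a))
  (is_derive1_comp (is_derive_cos _) (d1 b)).
by move=> /is_derive_eq; apply; rewrite /GRing.scale /=; ring.
Qed.

Lemma is_derive_expsin (a b s : R) :
  is_derive s 1 (fun s : R => expR (s * a) * sin (s * b))
    (a * (expR (s * a) * sin (s * b)) + b * (expR (s * a) * cos (s * b))).
Proof.
have d1 := is_derive_mulr s.
have := @is_deriveM _ _ (fun s : R => expR (s * a)) (fun s : R => sin (s * b)) s 1 _ _
  (is_derive1_comp (is_derive_expR _) (d1 a))
  (is_derive1_comp (is_derive_sin _) (d1 b)).
by move=> /is_derive_eq; apply; rewrite /GRing.scale /=; ring.
Qed.

Lemma ray_poly0 c n : (ray_poly c n.+1).[0] = c 0%N.
Proof. by rewrite horner_coef0 coef_poly /= fact0 divr1. Qed.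

(** Along the ray s t, the error of order n + 1 has derivative t times the error of order n, so the
    mean value theorem on [0, 1] raises the order. It is applied to real and imaginary parts
    separately, whence 2 K. *)
Lemma cexp_taylor n : exists2 K : R, 0 < K & forall t,
  nm t <= 1 -> nm (cexp t - (exp_poly n).[t]) <= K * nm t ^+ n.
Proof.
elim: n => [|n [K K0 HK]].
  exists (expR 1); first exact: expR_gt0.
  move=> t t1; rewrite /exp_poly poly_def big_ord0 horner0 subr0 nm_cexp mulr1.
  by rewrite ler_expR (le_trans _ t1) // (le_trans _ (nm_Re _)) // ler_norm.
exists (2 * K); first by rewrite mulr_gt0.
move=> t t1; set a := complex.Re t; set b := complex.Im t.
pose E s := cexp (s%:C * t).
have ReE s : complex.Re (E s) = expR (s * a) * cos (s * b).
  by rewrite /E /cexp !ReImE /= !mul0r ?subr0 ?addr0.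
have ImE s : complex.Im (E s) = expR (s * a) * sin (s * b).
  by rewrite /E /cexp !ReImE /= !mul0r ?subr0 ?addr0.
have dbound s : 0 <= s <= 1 ->
    nm (t * (E s - (exp_poly n).[s%:C * t])) <= K * nm t ^+ n.+1.
  move=> /andP[s0 s1]; rewrite nmM exprS mulrCA ler_wpM2l ?nm_ge0 //.
  have st : nm (s%:C * t) <= nm t.
    by rewrite nmM nm_real ger0_norm // ler_piMl ?nm_ge0.
  apply: le_trans (HK _ (le_trans st t1)) _.
  by rewrite ler_wpM2l ?(ltW K0) // lerXn2r ?nnegrE ?nm_ge0.
have hp := exp_poly_ray n.+1 t 1; rewrite rmorph1 mul1r in hp.
have dRe : `|complex.Re (cexp t - (exp_poly n.+1).[t])| <= K * nm t ^+ n.+1.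
  pose P := ray_poly (fun k => complex.Re (t ^+ k)) n.+1.
  have := @MVT_bound (fun s => expR (s * a) * cos (s * b) - P.[s])
    (fun s => complex.Re (t * (E s - (exp_poly n).[s%:C * t]))) (K * nm t ^+ n.+1).
  rewrite !mul1r !mul0r expR0 cos0 mulr1 ray_poly0 expr0 /= subrr subr0.
  rewrite hp !ReImE /= -/P.
  rewrite /cexp /= mul0r subr0; apply => [s|s s01]; last first.
    by rewrite (le_trans (nm_Re _)) // dbound.
  have := is_deriveB (is_derive_expcos a b s)
    (ray_poly_deriv (fun k => complex.Re (t ^+ k)) n s).
  move=> /is_derive_eq; apply; rewrite exp_poly_ray ReM (ReD (E s)) (ImD (E s)).
  rewrite ReE ImE ReN ImN /= -/a -/b.
  have -> : (ray_poly ((fun k => complex.Re (t ^+ k)) \o succn) n).[s] =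
      a * (ray_poly (fun k => complex.Re (t ^+ k)) n).[s] -
      b * (ray_poly (fun k => complex.Im (t ^+ k)) n).[s].
    rewrite !horner_poly !mulr_sumr -sumrB; apply: eq_bigr => k _ /=.
    by rewrite exprS ReM -/a -/b; ring.
  ring.
have dIm : `|complex.Im (cexp t - (exp_poly n.+1).[t])| <= K * nm t ^+ n.+1.
  pose P := ray_poly (fun k => complex.Im (t ^+ k)) n.+1.
  have := @MVT_bound (fun s => expR (s * a) * sin (s * b) - P.[s])
    (fun s => complex.Im (t * (E s - (exp_poly n).[s%:C * t]))) (K * nm t ^+ n.+1).
  rewrite !mul1r !mul0r expR0 sin0 mulr0 ray_poly0 expr0 /= subrr subr0.
  rewrite hp !ReImE /= -/P.
  rewrite /cexp /= mul0r addr0; apply => [s|s s01]; last first.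
    by rewrite (le_trans (nm_Im _)) // dbound.
  have := is_deriveB (is_derive_expsin a b s)
    (ray_poly_deriv (fun k => complex.Im (t ^+ k)) n s).
  move=> /is_derive_eq; apply; rewrite exp_poly_ray ImM (ReD (E s)) (ImD (E s)).
  rewrite ReE ImE ReN ImN /= -/a -/b.
  have -> : (ray_poly ((fun k => complex.Im (t ^+ k)) \o succn) n).[s] =
      a * (ray_poly (fun k => complex.Im (t ^+ k)) n).[s] +
      b * (ray_poly (fun k => complex.Re (t ^+ k)) n).[s].
    rewrite !horner_poly !mulr_sumr -big_split; apply: eq_bigr => k _ /=.
    by rewrite exprS ImM -/a -/b; ring.
  ring.
by have := nm_Cauchy (cexp t - (exp_poly n.+1).[t]); lra.
Qed.

Lemma hol_cexp p : hol cexp p.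
Proof.
have h0 : hol cexp 0.
  move=> n; have [K K0 HK] := cexp_taylor n; exists (exp_poly n), K, 1.
  by split=> // t t1; rewrite add0r HK // ltW.
have h1 : hol (fun z => cexp p * cexp (z - p)) p.
  apply: hol_mul; first exact: hol_cst.
  apply: (hol_comp (F := fun z => z - p)); last by rewrite subrr.
  exact: hol_add (hol_id _) (hol_cst _ _).
by apply: (hol_near ltr01 _ h1) => t _; rewrite -cexpD subrKC.
Qed.

Lemma cexp_surj w : w != 0 -> exists z, cexp z = w.
Proof.
rewrite -nm_gt0 => w0.
have w1 : nm ((nm w)^-1%:C * w) = 1.
  by rewrite nmM nm_real ger0_norm ?invr_ge0 ?nm_ge0 // mulVf // gt_eqF.
set u := (nm w)^-1%:C * w in w1.
have [a ca sa] : exists2 a, cos a = complex.Re u & sin a = complex.Im u.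
  have := nm_sqr u; rewrite w1 expr1n => uu.
  have r1 : -1 <= complex.Re u <= 1.
    by rewrite -ler_norml -w1 nm_Re.
  have ck : cos (acos (complex.Re u)) = complex.Re u by apply: acosK; rewrite in_itv.
  have sk : sin (acos (complex.Re u)) = `|complex.Im u|.
    by rewrite sin_acos // uu addrAC subrr add0r sqrtr_sqr.
  have [i0|i0] := lerP 0 (complex.Im u).
    by exists (acos (complex.Re u)); rewrite // sk ger0_norm.
  exists (- acos (complex.Re u)); first by rewrite cosN.
  by rewrite sinN sk ltr0_norm // opprK.
exists (ln (nm w) +i* a)%C; rewrite /cexp /= lnK ?posrE // ca sa.
have -> : (complex.Re u +i* complex.Im u)%C = u by case: (u).
by rewrite /u mulrA -rmorphM divff ?rmorph1 ?mul1r // gt_eqF.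
Qed.

Lemma qparam_cexp (h : nat) z :
  qparam h z = cexp (((2 * pi / h%:R) *i)%C * z).
Proof.
rewrite /qparam /cexp !ReImE /= !mul0r sub0r add0r.
by congr ((expR _)%:C * (cos _ +i* sin _)%C); ring.
Qed.

End Exponential.

(** * Power series on the unit disc *)

Section PowerSeries.
Context {R : realType}.
Local Notation C := R[i].
Implicit Types (z w t q : C) (a : nat -> C) (u : nat -> C).

Definition tends u (l : C) := forall e : R, 0 < e ->
  exists N, forall n, (N <= n)%N -> nm (u n - l) < e.

Lemma tends_uniq u l l' : tends u l -> tends u l' -> l = l'.
Proof.
move=> ul ul'; apply/eqP; rewrite -subr_eq0 -nm_eq0 eq_le nm_ge0 andbT leNgt.
apply/negP => d; have d2 : 0 < nm (l - l') / 2 by rewrite divr_gt0.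
have [N HN] := ul _ d2; have [M HM] := ul' _ d2.
have := HN _ (leq_maxl N M); have := HM _ (leq_maxr N M).
by have := nm_tri l (u (maxn N M)) l'; rewrite [nm (l - u _)]nmBC; lra.
Qed.

Lemma tends_cvg u l : (u : nat -> R[i]^o) @ \oo --> (l : R[i]^o) -> tends u l.
Proof.
move=> ul e e0; have e0' : 0 < e%:C :> C by rewrite ltcR.
have /cvgrPdist_lt /(_ _ e0')[N _ HN] := ul; exists N => n Nn.
by have := HN n Nn; rewrite /= distrC normc_def ltcR /nm; case: (u n - l).
Qed.

Lemma tends_mull c u l : tends u l -> tends (fun n => c * u n) (c * l).
Proof.
move=> ul e e0; have c0 : 0 < nm c + 1 by rewrite ltr_wpDl ?nm_ge0.
have [N HN] := ul _ (divr_gt0 e0 c0); exists N => n /HN.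
rewrite ltr_pdivlMr // -mulrBr nmM => h; apply: le_lt_trans h.
by rewrite mulrC ler_wpM2l ?nm_ge0 // lerDl.
Qed.

Lemma tends_add u v l m : tends u l -> tends v m ->
  tends (fun n => u n + v n) (l + m).
Proof.
move=> ul vm e e0; have e20 : 0 < e / 2 by rewrite divr_gt0.
have [N HN] := ul _ e20; have [M HM] := vm _ e20.
exists (maxn N M) => n; rewrite geq_max => /andP[/HN h1 /HM h2].
by rewrite opprD addrACA; have := nmD (u n - l) (v n - m); lra.
Qed.

Lemma tends_cst l : tends (fun=> l) l.
Proof. by move=> e e0; exists 0%N => n _; rewrite subrr nm0. Qed.

Definition psum a n q := \sum_(i < n) a i * q ^+ i.

Lemma tends_le u l (M : R) : tends u l -> (forall n, nm (u n) <= M) -> nm l <= M.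
Proof.
move=> ul uM; rewrite leNgt -subr_gt0; apply/negP => lM.
have [N /(_ N (leqnn N))] := ul _ lM; rewrite nmBC.
by have := nm_dist l (u N); have := uM N; lra.
Qed.

Lemma geometric_tail (c : nat -> C) (K th : R) n m : 0 <= K -> 0 <= th -> th < 1 ->
  (forall i, nm (c i) <= K * th ^+ i) ->
  nm (\sum_(n <= i < n + m) c i) <= K * th ^+ n / (1 - th).
Proof.
move=> K0 th0 th1 cK; have t1 : 0 < 1 - th by rewrite subr_gt0.
apply: le_trans (nm_sum _ _) _.
apply: (@le_trans _ _ (K * th ^+ n * (1 - th ^+ m) / (1 - th))); last first.
  rewrite ler_pM2r ?invr_gt0 // ler_piMr ?mulr_ge0 ?exprn_ge0 //.
  by rewrite gerBl exprn_ge0.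
elim: m => [|m IH].
  by rewrite addn0 big_geq // expr0 subrr mulr0 mul0r.
rewrite addnS big_nat_recr ?leq_addr //=.
apply: le_trans (lerD IH (cK _)) _.
rewrite exprD le_eqVlt; apply/orP; left; apply/eqP; rewrite exprS; field.
by rewrite gt_eqF.
Qed.

Lemma geometric_tends (c : nat -> C) (K th : R) : 0 <= K -> 0 <= th -> th < 1 ->
  (forall i, nm (c i) <= K * th ^+ i) ->
  exists l, tends (fun n => \sum_(i < n) c i) l.
Proof.
move=> K0 th0 th1 cK.
have cvgR (d : nat -> R) : (forall i, `|d i| <= K * th ^+ i) -> cvgn (series d).
  move=> dK; apply: normed_cvg; apply: (@series_le_cvg _ _ (geometric K th)) => //.
  - by move=> n /=.
  - by move=> n; rewrite /geometric /= mulr_ge0 ?exprn_ge0.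
  by apply: is_cvg_geometric_series; rewrite ger0_norm.
have [x xP] : exists x : R, series (fun i => complex.Re (c i)) @ \oo --> x.
  by apply/cvg_ex/cvgR => i; exact: le_trans (nm_Re _) (cK i).
have [y yP] : exists y : R, series (fun i => complex.Im (c i)) @ \oo --> y.
  by apply/cvg_ex/cvgR => i; exact: le_trans (nm_Im _) (cK i).
have sumE n : \sum_(i < n) c i =
    (series (fun i => complex.Re (c i)) n +i* series (fun i => complex.Im (c i)) n)%C.
  rewrite /series /= !big_mkord; elim: n => [|n IH]; first by rewrite !big_ord0.
  by rewrite !big_ord_recr /= IH; apply: complex_ext; rewrite !ReImE.
exists (x +i* y)%C => e e0; have e20 : 0 < e / 2 by rewrite divr_gt0.
have /cvgrPdist_lt /(_ _ e20)[N _ HN] := xP.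
have /cvgrPdist_lt /(_ _ e20)[M _ HM] := yP.
exists (maxn N M) => n; rewrite geq_max => /andP[/HN h1 /HM h2].
rewrite sumE; apply: le_lt_trans (nm_Cauchy _) _; rewrite !ReImE /=.
by rewrite /= distrC in h1; rewrite /= distrC in h2; lra.
Qed.

(** The coefficient bounds accompany the sum because they are what division by q - q0 has to
    preserve. *)
Definition power_series a (G : C -> C) :=
  (forall r : R, 0 < r -> r < 1 -> exists2 K : R, 0 < K &
     forall n, nm (a n) * r ^+ n <= K) /\
  (forall q, nm q < 1 -> tends (fun n => psum a n q) (G q)).

Lemma ratio_lt1 q : nm q < 1 -> exists r : R, [/\ 0 < r, r < 1, nm q < r &
  0 <= nm q / r < 1].
Proof.
move=> q1; have q0 := nm_ge0 q; exists ((nm q + 1) / 2).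
have r0 : 0 < (nm q + 1) / 2 by lra.
by split; rewrite ?ltr_pdivrMr ?mul1r ?divr_ge0 //=; lra.
Qed.

Lemma coef_bound a (r K : R) q : 0 < r -> (forall n, nm (a n) * r ^+ n <= K) ->
  forall i, nm (a i * q ^+ i) <= K * (nm q / r) ^+ i.
Proof.
move=> r0 aK i; rewrite nmM nmX expr_div_n mulrA ler_pdivlMr ?exprn_gt0 //.
by rewrite mulrAC ler_wpM2r ?exprn_ge0 ?nm_ge0.
Qed.

Lemma psum_sub a n m q :
  psum a (n + m) q - psum a n q = \sum_(n <= i < n + m) a i * q ^+ i.
Proof.
rewrite /psum -!(big_mkord xpredT (fun i => a i * q ^+ i)).
by rewrite (big_cat_nat (leq0n n) (leq_addr m n)) /= addrAC subrr add0r.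
Qed.

Lemma power_series_tail a G (r K : R) q : power_series a G -> 0 < r -> r < 1 ->
  0 < K -> (forall n, nm (a n) * r ^+ n <= K) -> nm q < r -> forall n,
  nm (G q - psum a n q) <= K * (nm q / r) ^+ n / (1 - nm q / r).
Proof.
move=> [_ aG] r0 r1 K0 aK qr n.
have th0 : 0 <= nm q / r by rewrite divr_ge0 ?nm_ge0 // ltW.
have th1 : nm q / r < 1 by rewrite ltr_pdivrMr // mul1r.
apply: (@tends_le (fun m => psum a (n + m) q - psum a n q)).
  have := aG q (lt_trans qr r1) => h; move=> e e0; have [N HN] := h e e0.
  exists N => m Nm; rewrite opprB addrA subrK.
  by rewrite HN // (leq_trans Nm) // leq_addl.
move=> m; rewrite psum_sub; apply: geometric_tail => //; first exact: ltW.
exact: coef_bound.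
Qed.

Lemma power_series_of_coef a :
  (forall r : R, 0 < r -> r < 1 -> exists2 K : R, 0 < K &
     forall n, nm (a n) * r ^+ n <= K) -> exists G, power_series a G.
Proof.
move=> ab.
have lim q : exists l, nm q < 1 -> tends (fun n => psum a n q) l.
  have [q1|] := boolP (nm q < 1); last by exists 0.
  have [r [r0 r1 qr /andP[th0 th1]]] := ratio_lt1 q1; have [K K0 aK] := ab r r0 r1.
  have [l lP] := geometric_tends (ltW K0) th0 th1 (coef_bound q r0 aK).
  by exists l.
exists (fun q => projT1 (cid (lim q))); split => // q q1.
by case: (cid _) => l /= /(_ q1).
Qed.

(** The quotient of G(q) - G(q0) by q - q0 has as coefficients the tails sum_{i > j} a_i q0^(i - j -
    1), which decay like those of G. *)
Lemma power_series_div a G q0 : power_series a G -> nm q0 < 1 ->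
  exists a' G', power_series a' G' /\
    forall q, nm q < 1 -> G q = G q0 + (q - q0) * G' q.
Proof.
move=> aG q01; have [ab aT] := aG.
(* For nonzero q0 the tail is read off from the sum itself, so that [power_series_tail] bounds
   it. *)
pose a' j := if q0 == 0 then a j.+1 else (G q0 - psum a j.+1 q0) / q0 ^+ j.+1.
have a'b (r : R) : 0 < r -> r < 1 -> exists2 K : R, 0 < K &
    forall n, nm (a' n) * r ^+ n <= K.
  move=> r0 r1; rewrite /a'; have [q00|q0N] := eqVneq q0 0.
    have [K K0 aK] := ab r r0 r1; exists (K / r); first exact: divr_gt0.
    by move=> n; rewrite ler_pdivlMr // -mulrA -exprSr.
  have [s [s0 s1 qs /andP[th0 th1]]] := ratio_lt1 q01.
  pose r' := Num.max r s.
  have r'0 : 0 < r' by rewrite lt_max r0.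
  have r'1 : r' < 1 by rewrite gt_max r1.
  have qr' : nm q0 < r' by rewrite lt_max qs orbT.
  have [K K0 aK] := ab r' r'0 r'1.
  have t1 : 0 < 1 - nm q0 / r' by rewrite subr_gt0 ltr_pdivrMr // mul1r.
  exists (K / (1 - nm q0 / r') / r'); first by rewrite !divr_gt0.
  move=> n; have := power_series_tail aG r'0 r'1 K0 aK qr' n.+1.
  have q0n : 0 < nm q0 ^+ n.+1 by rewrite exprn_gt0 // nm_gt0.
  rewrite nmM nmV nmX => h; apply: (@le_trans _ _ (nm (G q0 - psum a n.+1 q0) / nm q0 ^+ n.+1 * r' ^+ n)).
    rewrite ler_wpM2l ?mulr_ge0 ?nm_ge0 ?invr_ge0 ?(ltW q0n) //.
    by rewrite lerXn2r ?nnegrE ?(ltW r0) ?(ltW r'0) // le_max lexx.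
  have rn0 : 0 < r' ^+ n by rewrite exprn_gt0.
  have q0n0 : 0 < nm q0 by rewrite nm_gt0.
  have q0nn : 0 < nm q0 ^+ n by rewrite exprn_gt0.
  have -> : K / (1 - nm q0 / r') / r' =
      K * (nm q0 / r') ^+ n.+1 / (1 - nm q0 / r') / nm q0 ^+ n.+1 * r' ^+ n.
    rewrite expr_div_n !exprS.
    move: (1 - nm q0 / r') t1 (nm q0 ^+ n) q0nn (r' ^+ n) rn0 => x x0 y y0 v v0.
    by field; rewrite !gt_eqF.
  by rewrite ler_wpM2r ?(ltW rn0) // ler_wpM2r ?invr_ge0 ?(ltW q0n).
have [G' G'P] := power_series_of_coef a'b; exists a', G'; split=> // q q1.
have [->|qq0] := eqVneq q q0; first by rewrite subrr mul0r addr0.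
suff : tends (fun n => G q0 + (q - q0) * psum a' n q) (G q).
  move=> /tends_uniq; apply; apply: tends_add; first exact: tends_cst.
  by apply: tends_mull; case: G'P => _; apply.
have [q00|q0N] := eqVneq q0 0.
  have a0E : G q0 = a 0%N.
    apply: (tends_uniq (aT q0 q01)) => e e0; exists 1%N => -[|n] // _.
    rewrite /psum big_ord_recl q00 expr0 mulr1 big1 ?addr0 ?subrr ?nm0 // => i _.
    by rewrite exprS mul0r mulr0.
  move=> e e0; have [N HN] := aT q q1 e e0; exists N => n Nn.
  suff -> : G q0 + (q - q0) * psum a' n q = psum a n.+1 q by apply/HN/leqW.
  rewrite a0E /psum big_ord_recl expr0 mulr1 q00 subr0 mulr_sumr.
  by congr (_ + _); apply: eq_bigr => i _; rewrite /a' q00 eqxx exprS mulrCA.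
have [r [r0 r1 qr /andP[th0 th1]]] := ratio_lt1 q1.
have [K K0 a'K] := a'b r r0 r1.
have E n : G q0 + (q - q0) * psum a' n.+1 q =
    psum a n.+1 q + q * (a' n * q ^+ n).
  (* Recursion between consecutive tails; it makes the product with q - q0 telescope, up to a last
     term tending to 0. *)
  have aE j : a' j.+1 * q0 = a' j - a j.+1.
    rewrite /a' (negPf q0N) /psum [in LHS]big_ord_recr /= !exprS.
    have : q0 ^+ j != 0 by rewrite expf_neq0.
    move: (q0 ^+ j) (\sum_(i < j.+1) _) => v S v0.
    by field; rewrite v0 q0N.
  elim: n => [|n IH].
    rewrite /psum !big_ord_recr !big_ord0 /= !add0r !expr0 !mulr1 /a' (negPf q0N).
    by rewrite /psum big_ord_recr big_ord0 /= !expr0 !expr1 mulr1 add0r; field.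
  rewrite [in LHS]/psum big_ord_recr -/(psum _ _ _) mulrDr addrA IH.
  rewrite /= [in RHS]/psum big_ord_recr -/(psum _ _ _) /= mulrBl [q0 * _]mulrA.
  by rewrite [q0 * _]mulrC aE exprS; ring.
have rem : tends (fun n => q * (a' n * q ^+ n)) 0.
  rewrite -(mulr0 q); apply: tends_mull => e e0.
  have [N HN] := exprn_small th0 th1 (divr_gt0 e0 K0); exists N => n Nn.
  rewrite subr0; apply: le_lt_trans (coef_bound q r0 a'K n) _.
  rewrite mulrC -ltr_pdivlMr //; apply: le_lt_trans HN.
  by rewrite ler_wiXn2l // ltW.
have aT1 : tends (fun n => psum a n.+1 q) (G q).
  by move=> e e0; have [N HN] := aT q q1 e e0; exists N => n Nn; apply/HN/leqW.
have := tends_add aT1 rem; rewrite addr0 => h e e0.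
have [N HN] := h e e0; exists N.+1 => -[|n] // Nn; rewrite E.
exact: HN.
Qed.

Lemma power_series_bounded a G (r : R) : power_series a G -> 0 < r -> r < 1 ->
  exists2 M : R, 0 < M & forall q, nm q <= r -> nm (G q) <= M.
Proof.
move=> aG r0 r1; have [ab _] := aG; pose s := (r + 1) / 2.
have s0 : 0 < s by rewrite divr_gt0 // addr_gt0.
have s1 : s < 1 by rewrite /s; lra.
have [K K0 aK] := ab s s0 s1; have rs : r < s by rewrite /s; lra.
have t1 : 0 < 1 - r / s by rewrite subr_gt0 ltr_pdivrMr // mul1r.
exists (K / (1 - r / s)); first exact: divr_gt0.
move=> q qr; have := power_series_tail aG s0 s1 K0 aK (le_lt_trans qr rs) 0%N.
rewrite /psum big_ord0 subr0 expr0 mulr1 => /le_trans -> //.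
rewrite ler_pM2l // lef_pV2 ?posrE //.
  by rewrite lerD2l lerN2 ler_pM2r ?invr_gt0.
by rewrite subr_gt0 ltr_pdivrMr // mul1r (le_lt_trans qr).
Qed.

(** Each division writes G(q + t) as G(q) + t G'(q + t) with G' again a power series, which raises
    the order of the jet by one; order 0 is mere boundedness. *)
Lemma hol_power_series a G q : power_series a G -> nm q < 1 -> hol G q.
Proof.
move=> aG q1 n; elim: n a G aG => [|n IH] a G aG.
  pose r := (nm q + 1) / 2.
  have r0 : 0 < r by have := nm_ge0 q; rewrite /r; lra.
  have [|M M0 HM] := power_series_bounded aG r0; first by rewrite /r; lra.
  exists 0, M, (r - nm q); split; first by rewrite /r; lra.
  move=> t tr; rewrite horner0 subr0 expr0 mulr1 HM //.
  by have := nmD q t; lra.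
have [a' [G' [a'G' GE]]] := power_series_div aG q1.
have [T [K [r [r0 H]]]] := IH _ _ a'G'.
exists ((G q)%:P + 'X * T), K, (Num.min r (1 - nm q)).
split; first by rewrite lt_min r0 subr_gt0.
move=> t; rewrite lt_min => /andP[tr t1].
have qt : nm (q + t) < 1 by have := nmD q t; lra.
rewrite (GE _ qt) !hornerE (addrC q t) addrK (addrC t q).
have -> : G q + t * G' (q + t) - (G q + t * T.[t]) = t * (G' (q + t) - T.[t]) by ring.
by rewrite nmM exprS mulrCA ler_wpM2l ?nm_ge0 ?H.
Qed.

(** At a cusp, convergence is known only for q != 0. Convergence at q = r bounds the terms a_n r^n,
    as differences of partial sums, and the series then also defines the value at q = 0. *)
Lemma power_series_of_tends a (G : C -> C) :
  (forall q, 0 < nm q -> nm q < 1 -> tends (fun n => psum a n q) (G q)) ->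
  exists2 G', power_series a G' & forall q, 0 < nm q -> nm q < 1 -> G' q = G q.
Proof.
move=> aG; have [|G' aG'] := @power_series_of_coef a.
  move=> r r0 r1; have nr : nm r%:C = r by rewrite nm_real ger0_norm ?ltW.
  have := aG r%:C; rewrite nr => /(_ r0 r1) aT.
  have [N HN] := aT 1 ltr01.
  have term n : nm (a n) * r ^+ n = nm (psum a n.+1 r%:C - psum a n r%:C).
    by rewrite /psum big_ord_recr /= addrAC subrr add0r nmM nmX nr.
  exists (2 + \sum_(i < N) nm (a i) * r ^+ i).
    rewrite ltr_wpDr // sumr_ge0 // => i _.
    by rewrite mulr_ge0 ?nm_ge0 ?exprn_ge0 ?ltW.
  move=> n; have [Nn|nN] := leqP N n.
    have s0 : 0 <= \sum_(i < N) nm (a i) * r ^+ i.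
      by rewrite sumr_ge0 // => i _; rewrite mulr_ge0 ?nm_ge0 ?exprn_ge0 ?ltW.
    rewrite term; have := HN _ (leqW Nn); have := HN _ Nn.
    by have := nm_tri (psum a n.+1 r%:C) (G r%:C) (psum a n r%:C);
      rewrite [nm (G _ - _)]nmBC; lra.
  rewrite (bigD1 (Ordinal nN)) //= addrCA lerDl.
  by rewrite addr_ge0 // sumr_ge0 // => i _; rewrite mulr_ge0 ?nm_ge0 ?exprn_ge0 ?ltW.
exists G' => // q q0 q1; apply: (tends_uniq (aG'.2 q q1)); exact: aG.
Qed.

End PowerSeries.

(** * Action of SL2(Z) on the half-plane *)

Section ModularAction.
Context {R : realType}.
Local Notation C := R[i].
Implicit Types (z w : C) (g k : 'M[int]_2).

Definition mat2 (T : Type) (a b c d : T) : 'M[T]_2 :=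
  \matrix_(i, j) if i == 0 then (if j == 0 then a else b)
                 else (if j == 0 then c else d).

Lemma mat2E (T : Type) (a b c d : T) :
  ((mat2 a b c d 0 0 = a) * (mat2 a b c d 0 1 = b) *
   (mat2 a b c d 1 0 = c) * (mat2 a b c d 1 1 = d))%type.
Proof. by rewrite !mxE. Qed.

Lemma mx2_ext (T : Type) (A B : 'M[T]_2) : A 0 0 = B 0 0 -> A 0 1 = B 0 1 ->
  A 1 0 = B 1 0 -> A 1 1 = B 1 1 -> A = B.
Proof.
move=> h00 h01 h10 h11; apply/matrixP => i j.
have I2 (k : 'I_2) : k = 0 \/ k = 1.
  by case: k => -[|[|//]] p; [left|right]; apply: val_inj.
by case: (I2 i) => ->; case: (I2 j) => ->.
Qed.

Lemma det2 (A : comNzRingType) (M : 'M[A]_2) :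
  \det M = M 0 0 * M 1 1 - M 0 1 * M 1 0.
Proof.
rewrite (expand_det_row _ 0) !big_ord_recl big_ord0 addr0 /cofactor !det_mx11 !mxE.
have -> : lift 0 0 = 1 :> 'I_2 by apply: val_inj.
have -> : lift 1 0 = 0 :> 'I_2 by apply: val_inj.
by rewrite /= expr0 expr1 mul1r mulN1r mulrN.
Qed.

Lemma mulmx2 (A : pzRingType) (M N : 'M[A]_2) i j :
  (M *m N) i j = M i 0 * N 0 j + M i 1 * N 1 j.
Proof.
rewrite mxE !big_ord_recl big_ord0 addr0.
by have -> : lift 0 0 = 1 :> 'I_2 by apply: val_inj.
Qed.

Lemma ReJ z : complex.Re z^* = complex.Re z.
Proof. by case: z. Qed.

Lemma ImJ z : complex.Im z^* = - complex.Im z.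
Proof. by case: z. Qed.

Lemma SL2Z_det g : SL2Z g -> g 0 0 * g 1 1 - g 0 1 * g 1 0 = 1.
Proof. by rewrite /SL2Z /= det2. Qed.

Lemma SL2Z_mul g k : SL2Z g -> SL2Z k -> SL2Z (g *m k).
Proof. by rewrite /SL2Z /= det_mulmx => -> ->; rewrite mulr1. Qed.

Lemma SL2Z_1 : SL2Z 1%:M.
Proof. by rewrite /SL2Z /= det1. Qed.

Lemma SL2Z_unit g : SL2Z g -> g \in unitmx.
Proof. by rewrite /SL2Z /= unitmxE => ->; rewrite unitr1. Qed.

Lemma SL2Z_inv g : SL2Z g -> SL2Z (invmx g).
Proof. by rewrite /SL2Z /= det_inv => ->; rewrite invr1. Qed.

Lemma SL2Z_mat2 (a b c d : int) : a * d - b * c = 1 -> SL2Z (mat2 a b c d).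
Proof. by move=> h; rewrite /SL2Z /= det2 !mat2E. Qed.

Definition cden g z : C := (g 1 0)%:~R * z + (g 1 1)%:~R.

Lemma actE g z :
  act g z = ((g 0 0)%:~R * z + (g 0 1)%:~R) / cden g z :> C.
Proof. by rewrite /act /moebius /cden !mxE. Qed.

Lemma intC (n : int) : (n%:~R : C) = (n%:~R : R)%:C.
Proof. by rewrite rmorph_int. Qed.

Lemma cden_neq0 g z : SL2Z g -> complex.Im z != 0 -> cden g z != 0.
Proof.
move=> /SL2Z_det dg z0; apply/eqP => c0.
have := congr1 (@complex.Im R) c0; have := congr1 (@complex.Re R) c0.
rewrite /cden !intC !ReImE /= !mul0r !addr0 subr0 => re /eqP.
rewrite mulf_eq0 (negPf z0) orbF intr_eq0 => /eqP g10.
move: re; rewrite g10 mul0r add0r => /eqP; rewrite intr_eq0 => /eqP g11.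
by move: dg; rewrite g10 g11 !mulr0 subrr => /eqP.
Qed.

Lemma act_Im g z : SL2Z g -> complex.Im z != 0 ->
  complex.Im (act g z) = complex.Im z / nm (cden g z) ^+ 2.
Proof.
move=> Sg z0; have dg := SL2Z_det Sg.
have c0 := cden_neq0 Sg z0; have nc0 : nm (cden g z) ^+ 2 != 0.
  by rewrite expf_neq0 // nm_eq0.
have dR : (g 0 0)%:~R * (g 1 1)%:~R - (g 0 1)%:~R * (g 1 0)%:~R = 1 :> R.
  by rewrite -!intrM -intrB dg.
have E : act g z * cden g z = (g 0 0)%:~R * z + (g 0 1)%:~R.
  by rewrite actE divfK.
have Ec : act g z * (nm (cden g z) ^+ 2)%:C =
    ((g 0 0)%:~R * z + (g 0 1)%:~R) * (cden g z)^*.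
  rewrite -E -[RHS]mulrA nm_sqr; congr (act g z * _).
  by case: (cden g z) => x y; apply: complex_ext; rewrite !ReImE /=; ring.
have := congr1 (@complex.Im R) Ec; rewrite ImM /= mulr0 add0r => Ei.
apply: (mulIf nc0); rewrite divfK // Ei /cden !intC.
rewrite !ReImE ReJ ImJ !ReImE /= -[RHS]mulr1 -[X in _ = _ * X]dR; ring.
Qed.

Lemma act_H g z : SL2Z g -> 0 < complex.Im z -> 0 < complex.Im (act g z).
Proof.
move=> Sg z0; have zN : complex.Im z != 0 by rewrite gt_eqF.
by rewrite act_Im // divr_gt0 // exprn_gt0 // nm_gt0 cden_neq0.
Qed.

Lemma act1 z : act 1%:M z = z.
Proof. by rewrite actE /cden !mxE /= !mul0r mul1r !add0r addr0 divr1. Qed.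

Lemma actM g k z : SL2Z g -> SL2Z k -> complex.Im z != 0 ->
  act (g *m k) z = act g (act k z).
Proof.
move=> Sg Sk z0; have ck := cden_neq0 Sk z0.
have cgk := cden_neq0 (SL2Z_mul Sg Sk) z0.
have E : cden (g *m k) z = cden g (act k z) * cden k z.
  rewrite {1 2}/cden actE mulrDl [_ * (_ / _)]mulrA divfK // /cden.
  by rewrite !mulmx2 !rmorphD !rmorphM /=; ring.
have ca : cden g (act k z) != 0.
  by apply: contraNneq cgk => c0; rewrite E c0 mul0r.
rewrite actE E [in RHS]actE.
have -> : (g *m k) 0 0 = g 0 0 * k 0 0 + g 0 1 * k 1 0 by rewrite mulmx2.
have -> : (g *m k) 0 1 = g 0 0 * k 0 1 + g 0 1 * k 1 1 by rewrite mulmx2.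
have -> : (g 0 0)%:~R * act k z + (g 0 1)%:~R =
   (((g 0 0 * k 0 0 + g 0 1 * k 1 0)%:~R * z +
     (g 0 0 * k 0 1 + g 0 1 * k 1 1)%:~R) / cden k z).
  rewrite actE; apply: (mulIf ck); rewrite divfK // mulrDl mulrA divfK // /cden.
  by rewrite !rmorphD !rmorphM /=; ring.
by rewrite -mulrA -invfM [cden k z * _]mulrC.
Qed.

Lemma actK g z : SL2Z g -> 0 < complex.Im z -> act (invmx g) (act g z) = z.
Proof.
move=> Sg z0; have zN : complex.Im z != 0 by rewrite gt_eqF.
by rewrite -actM ?mulVmx ?act1 ?SL2Z_unit //; apply: SL2Z_inv.
Qed.

Lemma actKV g z : SL2Z g -> 0 < complex.Im z -> act g (act (invmx g) z) = z.
Proof.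
move=> Sg z0; have zN : complex.Im z != 0 by rewrite gt_eqF.
by rewrite -actM ?mulmxV ?act1 ?SL2Z_unit //; apply: SL2Z_inv.
Qed.

Lemma hol_act g z : SL2Z g -> complex.Im z != 0 -> hol (act g : C -> C) z.
Proof.
move=> Sg z0.
have aff (a b : C) p : hol (fun t => a * t + b) p.
  exact: hol_add (hol_mul (hol_cst _ _) (hol_id _)) (hol_cst _ _).
have h := hol_div (aff (g 0 0)%:~R (g 0 1)%:~R z)
  (aff (g 1 0)%:~R (g 1 1)%:~R z) (cden_neq0 Sg z0).
by apply: (hol_near ltr01 _ h) => t _; rewrite actE.
Qed.

Definition translation (n : int) : 'M[int]_2 := mat2 1 n 0 1.

Lemma SL2Z_translation n : SL2Z (translation n).
Proof. by apply: SL2Z_mat2; rewrite mulr0 subr0 mulr1. Qed.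

Lemma act_translation n z : act (translation n) z = z + n%:~R.
Proof. by rewrite actE /cden !mat2E mul1r mul0r add0r divr1. Qed.

(** Either c = 0 and d is a nonzero integer, or the imaginary part of c z + d is at least Im z in
    absolute value. This bounds the heights along an orbit. *)
Lemma cden_lower g z y : SL2Z g -> 0 <= y -> y <= complex.Im z ->
  y <= 1 -> complex.Im z != 0 -> y <= nm (cden g z).
Proof.
move=> Sg y0 yz y1 z0; have dg := SL2Z_det Sg.
have [c0|c0] := eqVneq (g 1 0) 0.
  rewrite /cden c0 mul0r add0r intC nm_real (le_trans y1) //.
  rewrite -intr_norm ler1z -gtz0_ge1 normr_gt0.
  by apply/eqP => d0; move: dg; rewrite c0 d0 !mulr0 subrr => /eqP.
apply: le_trans (nm_Im _); rewrite /cden !intC !ReImE /= mul0r !addr0 normrM.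
have c1 : 1 <= `|(g 1 0)%:~R : R| by rewrite -intr_norm ler1z -gtz0_ge1 normr_gt0.
have z1 : 0 <= complex.Im z by apply: le_trans yz.
by rewrite (ger0_norm z1) (le_trans yz) // ler_peMl.
Qed.

End ModularAction.

(** * Modular functions of level N *)

Section ModularFunctions.
Context {R : realType}.
Local Notation C := R[i].
Implicit Types (z w q : C) (g : 'M[int]_2) (f F G : C -> C).

Definition hol_disc G := forall q, nm q < 1 -> hol G q.

Lemma nm_qparam h z :
  nm (qparam h z) = expR (- (2 * pi / h%:R * complex.Im z)).
Proof. by rewrite qparam_cexp nm_cexp !ReImE /= mul0r sub0r. Qed.

Lemma frequency_gt0 h : (0 < h)%N -> 0 < 2 * pi / h%:R :> R.
Proof. by move=> h0; rewrite divr_gt0 ?ltr0n // mulr_gt0 // pi_gt0. Qed.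

Lemma nm_qparam_lt1 h z : (0 < h)%N -> 0 < complex.Im z -> nm (qparam h z) < 1.
Proof.
move=> h0 z0; rewrite nm_qparam -[ltRHS]expR0 ltr_expR oppr_lt0.
by rewrite mulr_gt0 ?frequency_gt0.
Qed.

Lemma qparam_neq0 h z : qparam h z != 0.
Proof. by rewrite qparam_cexp cexp_neq0. Qed.

Lemma hol_qparam h z : hol (qparam h : C -> C) z.
Proof.
apply: (hol_near ltr01 (F := fun z => cexp (((2 * pi / h%:R) *i)%C * z))).
  by move=> t _; rewrite qparam_cexp.
apply: (hol_comp (F := fun z => ((2 * pi / h%:R) *i)%C * z)); last exact: hol_cexp.
exact: hol_mul (hol_cst _ _) (hol_id _).
Qed.

Lemma cexpX z n : cexp z ^+ n = cexp (n%:R * z).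
Proof.
elim: n => [|n IH]; first by rewrite mul0r cexp0.
by rewrite exprS IH -cexpD -[n.+1%:R]natr1 mulrDl mul1r addrC.
Qed.

Lemma qparam_mul h k z : (0 < h)%N -> (0 < k)%N ->
  qparam (h * k) z ^+ k = qparam h z.
Proof.
move=> h0 k0; rewrite !qparam_cexp cexpX; congr cexp.
rewrite mulrA; congr (_ * _).
have -> : (k%:R : C) = (k%:R : R)%:C by rewrite rmorph_nat.
apply: complex_ext; rewrite !ReImE /= ?mulr0 ?mul0r ?subr0 ?addr0 //.
by rewrite natrM; field; rewrite !pnatr_eq0 -!lt0n h0 k0.
Qed.

Lemma qparam_surj h q : (0 < h)%N -> q != 0 -> nm q < 1 ->
  exists2 z, 0 < complex.Im z & qparam h z = q.
Proof.
move=> h0 q0 q1; have [w wq] := cexp_surj q0.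
have c0 : 0 < 2 * pi / h%:R :> R := frequency_gt0 h0.
set c := 2 * pi / h%:R in c0.
have ic0 : (c *i)%C != 0 :> C by rewrite eq_complex /= eqxx gt_eqF.
have E : (c *i)%C * (w / (c *i)%C) = w by rewrite mulrC divfK.
exists (w / (c *i)%C); last by rewrite qparam_cexp E.
have : nm q < 1 by []; rewrite -wq nm_cexp -[ltRHS]expR0 ltr_expR => w0.
have := congr1 (@complex.Re R) E; rewrite ReM /= mul0r sub0r => Ei.
by rewrite -(pmulr_rgt0 _ c0); lra.
Qed.

(* q^m f(g z) extends holomorphically to the disc |q| < 1, q = e^(2 pi i z / h). *)
Definition cusp_expansion f g h m G := [/\ (0 < h)%N, hol_disc G &
  forall z, 0 < complex.Im z -> qparam h z ^+ m * f (act g z) = G (qparam h z)].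

(** Weight zero and level N, meromorphic at the cusps. Holomorphy on H follows from the expansion at
    the identity matrix, as q is a nonvanishing holomorphic function of z. *)
Definition modular N f :=
  (forall g z, principal_congruence N g -> 0 < complex.Im z -> f (act g z) = f z) /\
  (forall g, SL2Z g -> exists h m G, cusp_expansion f g h m G).

(** The parameter of width h is the k-th power of that of width h k, so width and pole order can be
    raised; finitely many functions thus get common ones. *)
Lemma cusp_widen f g h m G k l : (0 < k)%N -> cusp_expansion f g h m G ->
  exists G', cusp_expansion f g (h * k) (m * k + l) G'.
Proof.
move=> k0 [h0 hG GE]; exists (fun q => q ^+ l * G (q ^+ k)).
split; first by rewrite muln_gt0 h0.
  move=> q q1; apply: hol_mul; first exact/hol_exp/hol_id.
  apply: (hol_comp (F := fun q => q ^+ k)); first exact/hol_exp/hol_id.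
  by apply: hG; rewrite nmX exprn_ilt1 ?nm_ge0 // -lt0n.
move=> z z0.
have qhk : qparam (h * k) z ^+ (m * k) = qparam h z ^+ m :> C.
  by rewrite [(m * k)%N]mulnC exprM qparam_mul.
by rewrite qparam_mul // -GE // exprD qhk [_ * qparam _ _ ^+ l]mulrC mulrA.
Qed.

Lemma modular_cst N c : modular N (fun=> c).
Proof.
split=> // g _; exists 1%N, 0%N, (fun=> c); split=> //.
  by move=> q _; apply: hol_cst.
by move=> z _; rewrite expr0 mul1r.
Qed.

Lemma modular_add N f F : modular N f -> modular N F ->
  modular N (fun z => f z + F z).
Proof.
move=> [fi fc] [Fi Fc]; split=> [g z Ng z0|g Sg]; first by rewrite fi ?Fi.
have [h [m [G GP]]] := fc g Sg; have [k [l [G' G'P]]] := Fc g Sg.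
have [h0 _ _] := GP; have [k0 _ _] := G'P.
have [G1 [h1 hG1 E1]] := cusp_widen (l * h) k0 GP.
have [G2 [_ hG2 E2]] := cusp_widen (m * k) h0 G'P.
exists (h * k)%N, (m * k + l * h)%N, (fun q => G1 q + G2 q); split=> //.
  by move=> q q1; apply: hol_add; [apply: hG1|apply: hG2].
by move=> z z0; rewrite mulrDr E1 // addnC mulnC E2 // mulnC.
Qed.

Lemma modular_mul N f F : modular N f -> modular N F ->
  modular N (fun z => f z * F z).
Proof.
move=> [fi fc] [Fi Fc]; split=> [g z Ng z0|g Sg]; first by rewrite fi ?Fi.
have [h [m [G GP]]] := fc g Sg; have [k [l [G' G'P]]] := Fc g Sg.
have [h0 _ _] := GP; have [k0 _ _] := G'P.
have [G1 [h1 hG1 E1]] := cusp_widen 0 k0 GP.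
have [G2 [_ hG2 E2]] := cusp_widen 0 h0 G'P.
exists (h * k)%N, (m * k + l * h)%N, (fun q => G1 q * G2 q); split=> //.
  by move=> q q1; apply: hol_mul; [apply: hG1|apply: hG2].
move=> z z0; rewrite -E1 // mulnC -E2 // mulnC !addn0 exprD; ring.
Qed.

Lemma modular_sum N (I : Type) (r : seq I) (f : I -> C -> C) :
  (forall i, modular N (f i)) -> modular N (fun z => \sum_(i <- r) f i z).
Proof.
move=> hf; elim: r => [|i r IH].
  have -> : (fun z => \sum_(i <- [::]) f i z) = fun=> 0.
    by apply/funext => z; rewrite big_nil.
  exact: modular_cst.
have -> : (fun z => \sum_(j <- i :: r) f j z) =
    fun z => f i z + \sum_(j <- r) f j z.
  by apply/funext => z; rewrite big_cons.
exact: modular_add.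
Qed.

Lemma modular_hol N f z : modular N f -> 0 < complex.Im z -> hol f z.
Proof.
move=> [_ fc] z0; have [h [m [G [h0 hG GE]]]] := fc _ SL2Z_1.
apply: (hol_near z0 (F := fun z => G (qparam h z) / qparam h z ^+ m)).
  move=> t tz; have tz0 : 0 < complex.Im (z + t).
    by have := @ImB_lt R z (z + t) (complex.Im z); rewrite addrAC subrr add0r => /(_ tz); lra.
  by rewrite -GE // act1 mulrC mulKf // expf_neq0 // qparam_neq0.
apply: hol_div; last by rewrite expf_neq0 // qparam_neq0.
  by apply: (hol_comp (hol_qparam h z)); apply: hG; exact: nm_qparam_lt1.
exact/hol_exp/hol_qparam.
Qed.

(** Normality: k = 1 + N B has the conjugate 1 + N g B g^-1. *)
Lemma principal_congruence_conj N g k : SL2Z g -> principal_congruence N k ->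
  principal_congruence N (g *m k *m invmx g).
Proof.
move=> Sg [Sk kN]; split.
  by apply: SL2Z_mul; [apply: SL2Z_mul|apply: SL2Z_inv].
have [B kB] : exists B : 'M[int]_2, k = 1%:M + N%:Z *: B.
  exists (\matrix_(i, j) ((k i j - (1%:M : 'M[int]_2) i j) %/ N%:Z)%Z).
  apply/matrixP => i j; rewrite !mxE mulrC divzK; first by rewrite addrC subrK.
  by have := kN i j; rewrite mxE => /eqP; rewrite eqz_mod_dvd.
have -> : g *m k *m invmx g = 1%:M + N%:Z *: (g *m B *m invmx g).
  rewrite kB mulmxDr mulmxDl mulmx1 mulmxV ?SL2Z_unit //.
  by rewrite -scalemxAr -scalemxAl.
move=> i j; rewrite mxE [X in (_ + X)%R]mxE; apply/eqP; rewrite eqz_mod_dvd.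
by rewrite addrAC subrr add0r dvdz_mulr.
Qed.

Lemma modular_act N f g : SL2Z g -> modular N f -> modular N (fun z => f (act g z)).
Proof.
move=> Sg [fi fc]; split=> [k z Nk z0|k Sk]; last first.
  have [h [m [G [h0 hG GE]]]] := fc _ (SL2Z_mul Sg Sk); exists h, m, G; split=> // z z0.
  by rewrite -actM ?gt_eqF // GE.
have [Sk _] := Nk.
have -> : act g (act k z) = act (g *m k *m invmx g) (act g z).
  have zN : complex.Im z != 0 by rewrite gt_eqF.
  rewrite -!actM //; last by do 2?apply: SL2Z_mul => //; apply: SL2Z_inv.
  by rewrite mulmxKV // SL2Z_unit.
by rewrite fi ?act_H //; apply: principal_congruence_conj.
Qed.

Lemma curve_function_modular (Gam : set 'M[int]_2) N f :
  principal_congruence N `<=` Gam -> curve_function Gam f -> modular N f.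
Proof.
move=> NG [_ fi fc]; split=> [g z /NG Gg z0|g Sg]; first exact: fi.
have [h [m [a [h0 aT]]]] := fc g Sg.
(* The series depends on z only through q, so any preimage z of q may be chosen; uniqueness of
   limits removes the choice at the end. *)
pose F q := if pselect (exists2 z, 0 < complex.Im z & qparam h z = q) is left e
  then q ^+ m * f (act g (projT1 (cid2 e))) else 0.
have FT q : 0 < nm q -> nm q < 1 -> tends (fun n => psum a n q) (F q).
  rewrite nm_gt0 => q0 q1; rewrite /F.
  case: pselect => [e|[]]; last by have [z z0 zq] := qparam_surj h0 q0 q1; exists z.
  case: cid2 => z /= z0 zq.
  by have /tends_cvg := aT z z0; rewrite zq /psum /series /=; under eq_fun do rewrite big_mkord.
have [G aG GF] := power_series_of_tends FT.
exists h, m, G; split=> // [q q1|z z0]; first exact: hol_power_series aG q1.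
have q0 : 0 < nm (qparam h z) by rewrite nm_gt0 qparam_neq0.
have q1 := nm_qparam_lt1 h0 z0.
rewrite GF //; apply: (tends_uniq _ (FT _ q0 q1)).
by have /tends_cvg := aT z z0; rewrite /psum /series /=; under eq_fun do rewrite big_mkord.
Qed.

End ModularFunctions.

(** * Polarization and behaviour at the cusps *)

Section Polarization.
Context {R : realType}.
Local Notation C := R[i].
Implicit Types (z w q t : C) (g : 'M[int]_2).

Lemma hol_star (F : C -> C) p : hol F (conjc p) -> hol (fun w => (conjc (F (conjc w)))) p.
Proof.
move=> hF n; have [T [K [r [r0 H]]]] := hF n.
exists (map_poly conjc T), K, r; split => // t tr.
have := H (conjc t); rewrite nmJ => /(_ tr); rewrite -nmJ rmorphB rmorphD /=.
by rewrite -(horner_map conjc) /= conjcK.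
Qed.

Lemma ImJ_lt0 w : (0 < complex.Im (conjc w)) = (complex.Im w < 0).
Proof. by rewrite ImJ oppr_gt0. Qed.

Variables (N : nat) (I : finType) (a b : I -> C -> C).
Hypothesis ma : forall i, modular N (a i).
Hypothesis mb : forall i, modular N (b i).

(* z |-> sum_i a_i(z) conj(b_i(z)), extended to a function on H x H^- that is
   holomorphic in both variables. *)
Definition polarized z w := \sum_i a i z * (conjc (b i (conjc w))).

Lemma polarized_hol_on_arcs : hol_on_arcs polarized.
Proof.
move=> f g p hf hg f0 g0; apply: hol_sum => i; apply: hol_mul.
  by apply: (hol_comp hf); apply: modular_hol f0.
apply: (hol_comp (G := fun w => (conjc (b i (conjc w)))) hg); apply: hol_star.
by apply: (modular_hol (mb i)); rewrite ImJ_lt0.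
Qed.

Lemma common_expansion g : SL2Z g -> exists h m (G : I -> C -> C),
  forall i, cusp_expansion (b i) g h m (G i).
Proof.
move=> Sg.
have ch i : {hm : nat * nat | exists G, cusp_expansion (b i) g hm.1 hm.2 G}.
  by apply: cid; have [h [m [G GP]]] := (mb i).2 g Sg; exists (h, m), G.
pose h i := (projT1 (ch i)).1; pose m i := (projT1 (ch i)).2.
have hm i : exists G, cusp_expansion (b i) g (h i) (m i) G by apply: (projT2 (ch i)).
have h0 i : (0 < h i)%N by case: (hm i) => G [].
pose H := (\prod_i h i)%N.
pose k i := (\prod_(j | j != i) h j)%N.
have k0 i : (0 < k i)%N by rewrite prodn_gt0.
have HE i : H = (h i * k i)%N by rewrite /H (bigD1 i).
pose M := (\sum_i m i * k i)%N.
pose l i := (\sum_(j | j != i) m j * k j)%N.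
have ME i : M = (m i * k i + l i)%N by rewrite /M (bigD1 i).
have HM i : exists G, cusp_expansion (b i) g H M G.
  rewrite (HE i) (ME i); have [G GP] := hm i; exact: cusp_widen GP.
by exists H, M, (fun i => projT1 (cid (HM i))) => i; case: (cid _).
Qed.

Lemma hol_flat_disc (G : C -> C) : hol_disc G -> flat G 0 ->
  forall q, nm q < 1 -> G q = 0.
Proof.
move=> hG fG q q1; pose r := (nm q + 1) / 2.
apply: (flat_disc (p := 0) (r := r)) => //; last by rewrite subr0 /r; lra.
by move=> z; rewrite subr0 => zr; apply: hG; rewrite /r in zr; lra.
Qed.

Lemma hol_H_flat (F : C -> C) p z : (forall w, 0 < complex.Im w -> hol F w) ->
  0 < complex.Im p -> 0 < complex.Im z -> flat F p -> F z = 0.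
Proof.
move=> hF p0 z0; pose r := Num.min (complex.Im p) (complex.Im z).
have r0 : 0 < r by rewrite lt_min p0.
apply: (flat_segment r0) => s w /andP[s0 s1] wr; apply: hF.
have rp : r <= complex.Im p by rewrite ge_min lexx.
have rz : r <= complex.Im z by rewrite ge_min lexx orbT.
have := ImB_lt wr; rewrite !ReImE /= mul0r addr0.
have : 0 <= (1 - s) * (complex.Im p - r) by rewrite mulr_ge0 // subr_ge0.
have : 0 <= s * (complex.Im z - r) by rewrite mulr_ge0 // subr_ge0.
by move=> ? ? /andP[? _]; lra.
Qed.

(** From e^x > x^(d + 1) / (d + 1)! for x = al y > 0. *)
Lemma exp_beats_poly (K al c : R) d : 0 < c -> 0 < al ->
  exists Y : R, forall y, Y <= y -> 0 < y /\ K * expR (- (al * y)) < c * (y ^- d).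
Proof.
move=> c0 al0.
have f0 : 0 < d.+1`!%:R :> R by rewrite ltr0n fact_gt0.
pose D := `|K| * d.+1`!%:R / (al ^+ d.+1 * c).
have D0 : 0 <= D.
  by rewrite !(divr_ge0, mulr_ge0, exprn_ge0, ler0n, normr_ge0, ltW al0, ltW c0).
exists (D + 1) => y Dy1; have y0 : 0 < y by lra.
split=> //.
have yn : 0 < y ^+ d by rewrite exprn_gt0.
rewrite expRN; apply: (@le_lt_trans _ _ (`|K| / expR (al * y))).
  by rewrite ler_pM2r ?invr_gt0 ?expR_gt0 // ler_norm.
rewrite ltr_pdivrMr ?expR_gt0 // mulrAC ltr_pdivlMr //.
have e1 : (al * y) ^+ d.+1 / d.+1`!%:R < expR (al * y).
  apply: lt_le_trans (@expR_ge1Dxn R _ d (mulr_ge0 (ltW al0) (ltW y0))).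
  by rewrite ltrDr ltr01.
apply: (@le_lt_trans _ _ (c * ((al * y) ^+ d.+1 / d.+1`!%:R))); last first.
  by rewrite ltr_pM2l.
have Dy : D <= y by lra.
move: Dy; rewrite ler_pdivrMr ?mulr_gt0 ?exprn_gt0 // => Dy.
rewrite mulrA ler_pdivlMr // mulrAC exprMn [y ^+ d.+1]exprS.
have := ler_wpM2r (ltW yn) Dy; lra.
Qed.

Lemma horner_lowest_term (T : {poly C}) n q : (forall k, (k < n)%N -> T`_k = 0) ->
  T.[q] - T`_n * q ^+ n = (drop_poly n.+1 T).[q] * q ^+ n.+1.
Proof.
move=> T0; rewrite -{1}(poly_take_drop n.+1 T) hornerD hornerM hornerXn addrAC.
rewrite (@horner_coef_wide _ n.+1) ?size_take_poly // big_ord_recr /=.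
rewrite big1 ?add0r ?coef_take_poly ?ltnSn ?subrr ?add0r // => i _.
by rewrite coef_take_poly leqW // T0 ?mul0r.
Qed.

(** A matrix carrying the cusp oo to x. *)
Lemma SL2Z_of_rat (x : rat) : exists2 g, SL2Z g &
  [/\ g 0 0 = numq x, g 1 0 = denq x & 0 < g 1 0].
Proof.
have := Bezoutz (numq x) (denq x).
have -> : gcdz (numq x) (denq x) = 1.
  by rewrite /gcdz; have := coprime_num_den x; rewrite /coprime => /eqP->.
move=> [u [v uv]]; exists (mat2 (numq x) (- v) (denq x) u).
  by apply: SL2Z_mat2; rewrite -uv; ring.
by rewrite !mat2E denq_gt0.
Qed.

(** Let g carry oo to x and put w = conj(g(i y)), which tends to x like 1/y. Up to conjugation and a
    power of q, V(z, w) is the function Phi z of q, with |q| = e^(- al y), and its first coefficient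
    gives a holomorphic B(z), not identically 0. Vanishing of V at (tau w, w) forces |B(tau w)| =
    O(e^(- al y)). But B has finite order at tau x' and tau moves at least linearly, so |B(tau w)|
    is at least a constant times y^(-d). *)
Theorem polarized_cusp_rigid z1 w1 : 0 < complex.Im z1 -> complex.Im w1 < 0 ->
  polarized z1 w1 != 0 -> cusp_rigid polarized.
Proof.
move=> z10 w10 V1 x tau x' htau tx0 [c [r [c0 r0 lower]]] [s s0 V0].
have [g Sg [g00 g10 g10_gt0]] := SL2Z_of_rat x.
have [h [m [G GP]]] := common_expansion Sg.
pose Phi z q := \sum_i (conjc (a i z)) * G i q.
have hPhi z : hol_disc (Phi z).
  move=> q q1; apply: hol_sum => i; apply: hol_mul; first exact: hol_cst.
  by have [_ hG _] := GP i; apply: hG.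
have PhiE z v : 0 < complex.Im v ->
    qparam h v ^+ m * (conjc (polarized z (conjc (act g v)))) = Phi z (qparam h v).
  move=> v0; rewrite /polarized rmorph_sum mulr_sumr; apply: eq_bigr => i _.
  rewrite rmorphM /= !conjcK mulrCA; congr (_ * _).
  by have [_ _ ->] := GP i.
have h0 : (0 < h)%N.
  have [i _] : exists i : I, true.
    apply: contrapT => noI; move/eqP: V1; apply; rewrite /polarized big1 // => i _.
    by case: noI; exists i.
  by case: (GP i).
have jets K i : exists T : {poly C}, exists2 e : R, 0 < e & exists2 L : R, 0 < L &
    forall q, nm q < e -> nm (G i q - T.[q]) <= L * nm q ^+ K.
  have [_ hG _] := GP i.
  have [|T [L [e [[L0 e0 _] H]]]] := jetP (hG 0 _ K); first by rewrite nm0.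
  by exists T, e => //; exists L => // q qe; have := H q qe; rewrite add0r.
pose T K i := projT1 (cid (jets K i)).
have TP K i : exists2 e : R, 0 < e & exists2 L : R, 0 < L &
    forall q, nm q < e -> nm (G i q - (T K i).[q]) <= L * nm q ^+ K.
  by rewrite /T; case: (cid (jets K i)).
(* One number e serves as radius and, inverted, as constant, so that a minimum over the finite index
   set is enough. *)
have TP' K : exists2 e : R, 0 < e & forall i q, nm q < e ->
    nm (G i q - (T K i).[q]) <= e^-1 * nm q ^+ K.
  have [||e e0 He] := @seq_eps R _ (enum I) (fun i e => 0 < e ->
    forall q, nm q < e -> nm (G i q - (T K i).[q]) <= e^-1 * nm q ^+ K).
  - move=> i e e' H e'e e'0 q qe; have e0 := lt_le_trans e'0 e'e.
    apply: le_trans (H e0 q (lt_le_trans qe e'e)) _.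
    by rewrite ler_wpM2r ?exprn_ge0 ?nm_ge0 // lef_pV2.
  - move=> i _; have [e e0 [L L0 H]] := TP K i.
    exists (Num.min e L^-1); first by rewrite lt_min e0 invr_gt0.
    move=> m0 q; rewrite lt_min => /andP[qe _]; apply: le_trans (H q qe) _.
    rewrite ler_wpM2r ?exprn_ge0 ?nm_ge0 // -[leLHS]invrK lef_pV2 ?posrE ?invr_gt0 //.
    by rewrite ge_min lexx orbT.
  by exists e => // i; apply: He => //; rewrite mem_enum.
pose P K z : {poly C} := \sum_i (conjc (a i z)) *: T K i.
have PhiP K z q e : (forall i, nm q < e ->
    nm (G i q - (T K i).[q]) <= e^-1 * nm q ^+ K) -> nm q < e ->
    nm (Phi z q - (P K z).[q]) <= (\sum_i nm (a i z)) * e^-1 * nm q ^+ K.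
  move=> H qe; rewrite /P horner_sum -sumrB (le_trans (nm_sum _ _)) //.
  rewrite !mulr_suml; apply: ler_sum => i _; rewrite hornerZ -mulrBr nmM nmJ.
  by rewrite -mulrA ler_wpM2l ?nm_ge0 ?H.
(* the leading coefficient of the expansion at the cusp *)
have exn : exists n, `[< exists K z, [/\ (n < K)%N, 0 < complex.Im z & (P K z)`_n != 0] >].
  apply: contrapT => /forallNP nolead; move/eqP: V1; apply.
  (* Were all coefficients zero, Phi z1 would be flat at q = 0, hence zero on the disc, against
     V(z1, w1) != 0. *)
  have z1flat : flat (Phi z1) 0.
    move=> K; have [e e0 He] := TP' K.
    have [B B0 HB] := horner_bounded (drop_poly K (P K z1)) 1.
    exists ((\sum_i nm (a i z1)) * e^-1 + B), (Num.min e 1).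
    split; first by rewrite lt_min e0 ltr01.
    move=> q; rewrite lt_min add0r => /andP[qe q1].
    rewrite -[Phi z1 q](subrK (P K z1).[q]) (le_trans (nmD _ _)) // mulrDl lerD //.
      by apply: PhiP => // i; apply: He.
    rewrite -{1}(poly_take_drop K (P K z1)) (_ : take_poly K _ = 0).
      rewrite add0r hornerM hornerXn nmM nmX ler_wpM2r ?exprn_ge0 ?nm_ge0 //.
      by rewrite HB // ltW.
    apply/polyP => n; rewrite coef_take_poly coef0; case: ifP => // nK.
    apply/eqP/negPn/negP => Pn; apply: (nolead n); apply/asboolP.
    by exists K, z1.
  have w1' : 0 < complex.Im (conjc w1) by rewrite ImJ_lt0.
  pose v := act (invmx g) (conjc w1) : C.
  have v0 : 0 < complex.Im v by apply: act_H => //; apply: SL2Z_inv.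
  have := PhiE z1 v v0; rewrite actKV // conjcK.
  rewrite (hol_flat_disc (hPhi z1) z1flat) ?nm_qparam_lt1 // => /eqP.
  rewrite mulf_eq0 expf_eq0 (negPf (qparam_neq0 _ _)) andbF /= conjc_eq0.
  by move/eqP.
case: (ex_minnP exn) => n /asboolP[K [z2 [nK z20 Pz2]]] nmin.
have Plow z k : 0 < complex.Im z -> (k < n)%N -> (P K z)`_k = 0.
  move=> z0 kn; apply/eqP/negPn/negP => Pk.
  have : (n <= k)%N; last by rewrite leqNgt kn.
  by apply: nmin; apply/asboolP; exists K, z; split=> //; apply: ltn_trans nK.
(* The coefficient of q^n is antiholomorphic in z; its conjugate is holomorphic. *)
pose B z := \sum_i a i z * conjc (T K i)`_n.
have BE z : conjc (B z) = (P K z)`_n.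
  rewrite /B rmorph_sum /P coef_sum; apply: eq_bigr => i _.
  by rewrite rmorphM /= conjcK coefZ.
have hB z : 0 < complex.Im z -> hol B z.
  move=> z0; apply: hol_sum => i; apply: hol_mul; last exact: hol_cst.
  exact: modular_hol z0.
pose zs := tau x'.
have [fB|[d [cc [rr [cc0 rr0 Blow]]]]] := flat_or_order (hB zs tx0).
  move/eqP: Pz2; apply; rewrite -BE (_ : B z2 = 0) ?conjc0 //.
  exact: hol_H_flat hB tx0 z20 fB.
have [e e0 He] := TP' K.
have [d1 d10 Hd1] : exists2 d1 : R, 0 < d1 & forall i z, nm (z - zs) < d1 ->
    nm (a i z) <= nm (a i zs) + 1.
  have [||d1 d10 H] := @seq_eps R _ (enum I) (fun i d1 => forall z,
    nm (z - zs) < d1 -> nm (a i z) <= nm (a i zs) + 1).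
  - by move=> i d1 d2 H d12 z zd; apply: H; exact: lt_le_trans d12.
  - move=> i _; have [d1 d10 H] := hol_cont (modular_hol (ma i) tx0) ltr01.
    exists d1 => // z /H; have := nm_dist (a i z) (a i zs); lra.
  by exists d1 => // i; apply: H; rewrite mem_enum.
pose A := \sum_i (nm (a i zs) + 1).
have bT i : exists D : R, 0 < D /\ forall q, nm q <= 1 ->
    nm (drop_poly n.+1 (T K i)).[q] <= D.
  by have [D D0 HD] := horner_bounded (drop_poly n.+1 (T K i)) 1; exists D.
pose D := \sum_i projT1 (cid (bT i)).
have DP i q : nm q <= 1 -> nm (drop_poly n.+1 (T K i)).[q] <= D.
  move=> q1; rewrite /D (bigD1 i) //=.
  have [_ H] := projT2 (cid (bT i)); apply: le_trans (H q q1) _.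
  by rewrite lerDl sumr_ge0 // => j _; have [/ltW] := projT2 (cid (bT j)).
have D0 : 0 <= D by apply: sumr_ge0 => j _; have [/ltW] := projT2 (cid (bT j)).
have leadP z q : 0 < complex.Im z -> nm (z - zs) < d1 -> q != 0 -> nm q < e ->
    nm q < 1 -> Phi z q = 0 -> nm (B z) <= A * (e^-1 + D) * nm q.
  move=> z0 zd q0 qe q1 Phi0; rewrite -nmJ BE.
  have sA : \sum_i nm (a i z) <= A by apply: ler_sum => i _; apply: Hd1.
  have sA0 : 0 <= \sum_i nm (a i z) by apply: sumr_ge0 => i _; apply: nm_ge0.
  have := PhiP K z q e (fun i => He i q) qe; rewrite Phi0 sub0r nmN => h1.
  have h2 : nm ((P K z).[q] - (P K z)`_n * q ^+ n) <= A * D * nm q ^+ n.+1.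
    rewrite horner_lowest_term; last by move=> k; apply: Plow.
    rewrite nmM nmX ler_wpM2r ?exprn_ge0 ?nm_ge0 //.
    rewrite /P drop_poly_sum horner_sum (le_trans (nm_sum _ _)) //.
    apply: le_trans (ler_wpM2r D0 sA); rewrite mulr_suml; apply: ler_sum => i _.
    by rewrite drop_polyZ hornerZ nmM nmJ ler_wpM2l ?nm_ge0 // DP // ltW.
  have qn0 : 0 < nm q ^+ n by rewrite exprn_gt0 // nm_gt0.
  rewrite -(ler_pM2r qn0) -[leRHS]mulrA -exprS.
  have -> : nm (P K z)`_n * nm q ^+ n = nm ((P K z)`_n * q ^+ n).
    by rewrite nmM nmX.
  have h3 : nm q ^+ K <= nm q ^+ n.+1 by rewrite ler_wiXn2l ?nm_ge0 // ltW.
  have ei0 : 0 <= e^-1 by rewrite invr_ge0 ltW.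
  have h4 : nm ((P K z).[q]) <= A * e^-1 * nm q ^+ n.+1.
    apply: le_trans h1 _; apply: ler_pM; rewrite ?mulr_ge0 ?exprn_ge0 ?nm_ge0 //.
    by rewrite ler_wpM2r.
  have := nm_tri ((P K z)`_n * q ^+ n) (P K z).[q] 0; rewrite !subr0 [nm (_ - (P K z).[q])]nmBC.
  by lra.
pose al : R := 2 * pi / h%:R.
have al0 : 0 < al := frequency_gt0 h0.
pose cg : R := (g 1 0)%:~R; pose dg : R := (g 1 1)%:~R.
have cg1 : 1 <= cg by rewrite /cg ler1z -gtz0_ge1.
have cg0 : 0 < cg by lra.
have L0 : 0 < cg * (cg + `|dg|) by rewrite mulr_gt0 // ltr_wpDr.
have m10 : 0 < Num.min d1 rr by rewrite lt_min d10.
have [d2 d20 Hd2] := hol_cont htau m10.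
have [d3 d30 Hd3] := hol_cont htau tx0.
pose m0 := Num.min (Num.min (Num.min r s) (Num.min d2 d3)) (Num.min 1 (al * e)).
have m0_gt0 : 0 < m0 by rewrite !lt_min r0 s0 d20 d30 ltr01 mulr_gt0.
pose kap := c / (cg * (cg + `|dg|)).
have kap0 : 0 < kap by rewrite divr_gt0.
have [Y0 HY0] := exp_beats_poly (A * (e^-1 + D)) d
  (mulr_gt0 cc0 (exprn_gt0 d kap0)) al0.
(* Beyond Y0 the exponential is smaller than the power, and 1/y < m0 puts w and q within all the
   radii collected so far. *)
pose y := Num.max Y0 (m0^-1 + 1).
have [|_ contra] := HY0 y; first by rewrite le_max lexx.
have yY : m0^-1 + 1 <= y by rewrite le_max lexx orbT.
have m00 : 0 < m0^-1 by rewrite invr_gt0.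
have y1 : 1 <= y by lra.
have y0 : 0 < y by lra.
have ym : y^-1 < m0.
  by rewrite -[ltRHS]invrK ltf_pV2 ?posrE //; lra.
move: contra; apply/negP; rewrite -leNgt.
pose v : C := (y *i)%C.
have v0 : 0 < complex.Im v by [].
have cv : cden g v = (dg +i* (cg * y))%C.
  by rewrite /cden !intC; apply: complex_ext; rewrite !ReImE /=; ring.
have cgy0 : 0 <= cg * y by rewrite mulr_ge0 ?(ltW cg0) ?(ltW y0).
have cv0 : cden g v != 0 by apply: cden_neq0; rewrite // gt_eqF.
pose w := conjc (act g v).
(* The distance from g v to g(oo) = a/c is 1 / (c |c v + d|); for v = i y it lies between constant
   multiples of 1/y. *)
have nw : nm (w - x') = (cg * nm (cden g v))^-1.
  have xE : x' = (g 0 0)%:~R / (g 1 0)%:~R.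
    rewrite /x' g00 g10 !intC; have /(congr1 (@ratr R)) := divq_num_den x.
    by rewrite fmorph_div /= !ratr_int => <-; rewrite fmorph_div.
  have cgC : (g 1 0)%:~R != 0 :> C by rewrite intr_eq0 gt_eqF.
  have -> : w - x' = conjc (act g v - x').
    by rewrite /w rmorphB /x' /= oppr0.
  rewrite nmJ xE actE.
  have -> : ((g 0 0)%:~R * v + (g 0 1)%:~R) / cden g v - (g 0 0)%:~R / (g 1 0)%:~R =
      - ((g 0 0)%:~R * (g 1 1)%:~R - (g 0 1)%:~R * (g 1 0)%:~R) /
      ((g 1 0)%:~R * cden g v) :> C.
    by rewrite /cden in cv0 *; field; rewrite cgC cv0.
  rewrite -!intrM -intrB SL2Z_det // nmM nmN nm1 mul1r nmV nmM intC nm_real.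
  by rewrite ger0_norm // ltW.
have wl : nm (w - x') <= y^-1.
  rewrite nw lef_pV2 ?posrE ?mulr_gt0 ?nm_gt0 //.
  have := nm_Im (cden g v); rewrite {1}cv [complex.Im _]/= ger0_norm // => h1.
  have h2 : y <= cg * y by rewrite ler_peMl // ltW.
  apply: (le_trans h2); apply: (le_trans h1).
  by rewrite ler_peMl ?nm_ge0.
have wlow : (cg * (cg + `|dg|))^-1 * y^-1 <= nm (w - x').
  rewrite nw -invfM lef_pV2 ?posrE ?mulr_gt0 ?nm_gt0 //.
    rewrite -mulrA ler_pM2l // mulrDl.
    apply: le_trans (nm_Cauchy _) _; rewrite cv /= addrC lerD //.
      by rewrite ger0_norm.
    by rewrite ler_peMr.
  by rewrite ltr_wpDr.
have := le_lt_trans wl ym; rewrite !lt_min.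
move=> /andP[/andP[/andP[wr ws] /andP[wd2 wd3]] _].
move: ym; rewrite !lt_min => /andP[_ /andP[_ yale]].
have w0 : complex.Im w < 0.
  by rewrite /w ImJ oppr_lt0; apply: act_H.
have tw0 : 0 < complex.Im (tau w).
  by have := ImB_lt (Hd3 w wd3); lra.
have := Hd2 w wd2; rewrite lt_min -/zs => /andP[td1 trr].
have q1 := @nm_qparam_lt1 R h v h0 v0.
have qE : nm (qparam h v) = expR (- (al * y)) by rewrite nm_qparam.
have qe : nm (qparam h v) < e.
  rewrite qE expRN invf_plt ?posrE ?expR_gt0 //.
  apply: lt_le_trans (expR_ge1Dx _).
  have : e^-1 < al * y.
    move: yale; rewrite -[y^-1]mul1r -[e^-1]mul1r !ltr_pdivrMr //; lra.
  lra.
have Phi0 : Phi (tau w) (qparam h v) = 0.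
  rewrite -PhiE //; have := V0 w ws w0; rewrite /w => ->.
  by rewrite conjc0 mulr0.
have := leadP (tau w) _ tw0 td1 (qparam_neq0 h v) qe q1 Phi0; rewrite qE.
apply: le_trans.
have := Blow (tau w - zs) trr; rewrite subrKC; apply: le_trans.
rewrite -mulrA ler_pM2l // -exprVn -exprMn.
apply: lerXn2r; rewrite ?nnegrE ?nm_ge0 //.
  by rewrite mulr_ge0 ?(ltW kap0) // invr_ge0 ltW.
apply: le_trans (lower w wr); rewrite /kap -mulrA.
by rewrite ler_pM2l.
Qed.

End Polarization.

(** * Translates of the curve *)

Section Reduction.
Context {R : realType}.
Local Notation C := R[i].
Implicit Types (z w q t : C) (g k : 'M[int]_2).

Lemma act_conj g z : act g (conjc z) = conjc (act g z) :> C.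
Proof.
by rewrite !actE /cden fmorph_div !rmorphD !rmorphM /= !rmorph_int.
Qed.

Lemma uncountable_fiber (T : countType) (A : set R) (f : R -> T) :
  ~ countable A -> exists u, infinite_set (A `&` f @^-1` [set u]).
Proof.
move=> ncA; apply: contrapT => /forallNP fin; apply: ncA.
have -> : A = \bigcup_(u in [set: T]) (A `&` f @^-1` [set u]).
  by apply/seteqP; split=> [x Ax|x [u _ []//]]; exists (f x).
apply: bigcup_countable => // u _; apply: finite_set_countable.
by apply: contrapT; apply: (fin u).
Qed.

Lemma uncountable_itv (e : R) : 0 < e -> ~ countable [set s : R | 0 < s < e].
Proof.
move=> e0 /countable_lebesgue_measure0.
have -> : [set s : R | 0 < s < e] = `]0, e[%classic.
  by apply/seteqP; split=> s /=; rewrite in_itv.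
by rewrite lebesgue_measure_itv /= lte_fin e0 sube0 => /eqP; rewrite eqe gt_eqF.
Qed.

Lemma nat_pigeonhole (T : Type) (Z : set T) (v : nat -> T) : finite_set Z ->
  (forall n, Z (v n)) -> exists m n : nat, (m < n)%N /\ v m = v n.
Proof.
move=> fZ vZ; apply: contrapT => /forallNP noc; apply: infinite_nat.
have -> : [set: nat] = v @^-1` Z by apply/seteqP; split=> // n _; apply: vZ.
apply: finite_preimage fZ => m n _ _ vmn.
have [mn|nm|//] := ltngtP m n; first by case: (noc m); exists n.
by case: (noc n); exists m.
Qed.

Lemma translate_to_strip z : exists n : int,
  - (1 / 2) <= complex.Re (z + n%:~R) <= 1 / 2.
Proof.
pose x := complex.Re z + 1 / 2; exists (- Num.floor x).
have := ge_floor x; have := floorD1_gt x.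
rewrite !intC !ReImE /= rmorphN /= /x rmorphD rmorph1 => h1 h2.
by apply/andP; split; lra.
Qed.

(* If |Re w| <= 1/2 and Im w < 1/2, then -1/w has more than twice the imaginary
   part of w, while imaginary parts are bounded along an SL2(Z)-orbit. *)
Lemma fundamental_domain z : 0 < complex.Im z -> exists2 g, SL2Z g &
  - (1 / 2) <= complex.Re (act g z) <= 1 / 2 /\ 1 / 2 <= complex.Im (act g z).
Proof.
move=> z0; apply: contrapT => /forall2NP nofd.
have grow n : exists2 g, SL2Z g & n.+1%:R * complex.Im z <= complex.Im (act g z).
  elim: n => [|n [g Sg IH]].
    by exists 1%:M; [exact: SL2Z_1|rewrite mul1r act1].
  have [j jP] := translate_to_strip (act g z).
  have Hg0 := act_H Sg z0.
  have zN : complex.Im z != 0 by rewrite gt_eqF.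
  pose k := translation j *m g; have Sk : SL2Z k by apply: SL2Z_mul => //; exact: SL2Z_translation.
  have kz : act k z = act g z + j%:~R.
    by rewrite actM //; [rewrite act_translation|exact: SL2Z_translation].
  have Imk : complex.Im (act k z) = complex.Im (act g z).
    by rewrite kz intC !ReImE addr0.
  have [//|/not_andP[|/negP]] := nofd k; first by rewrite kz jP.
  rewrite -ltNge => small.
  have Ss : SL2Z (mat2 0 (-1) 1 0) by apply: SL2Z_mat2.
  have k0 := act_H Sk z0.
  exists (mat2 0 (-1) 1 0 *m k); first exact: SL2Z_mul.
  rewrite actM // act_Im // ?gt_eqF //.
  have -> : nm (cden (mat2 0 (-1) 1 0) (act k z)) = nm (act k z).
    by rewrite /cden !mat2E mul1r addr0.
  have n2 : nm (act k z) ^+ 2 <= 1 / 2.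
    rewrite nm_sqr kz in k0 small *; move: jP => /andP[? ?]; nra.
  have n20 : 0 < nm (act k z) ^+ 2.
    by rewrite exprn_gt0 // nm_gt0; apply: contraTneq k0 => ->; rewrite ltxx.
  rewrite ler_pdivlMr // Imk; apply: le_trans (_ : n.+2%:R * complex.Im z * (1 / 2) <= _).
    by rewrite ler_wpM2l // mulr_ge0 ?ler0n // ltW.
  have : n.+2%:R = n.+1%:R + 1 :> R by rewrite natr1.
  have n1 : 1 <= n.+1%:R :> R by rewrite ler1n.
  have : complex.Im z <= n.+1%:R * complex.Im z by rewrite ler_peMl // ltW.
  by move=> h ->; lra.
pose y := Num.min 1 (complex.Im z).
have y0 : 0 < y by rewrite lt_min ltr01.
have zN : complex.Im z != 0 by rewrite gt_eqF.
pose n := Num.bound (y ^- 2).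
have [g Sg] := grow n; rewrite act_Im //.
have cy : y <= nm (cden g z).
  by apply: cden_lower; rewrite // ?(ltW y0) // ge_min lexx ?orbT.
have c0 : 0 < nm (cden g z) ^+ 2 by rewrite exprn_gt0 // (lt_le_trans y0).
apply/negP; rewrite -ltNge mulrC ltr_pM2r //.
apply: (@le_lt_trans _ _ (y ^- 2)).
  rewrite lef_pV2 ?posrE ?(exprn_gt0 2 y0) //.
  by rewrite lerXn2r ?nnegrE ?nm_ge0 ?(ltW y0).
have y20 : 0 <= y ^- 2 by rewrite invr_ge0 exprn_ge0 // ltW.
apply: lt_trans (archi_boundP y20) _.
by rewrite ltr_nat.
Qed.

(** There are finitely many reductions modulo N, and g = k + N B gives g k^-1 = 1 + N B k^-1. *)
Lemma coset_representatives N : (0 < N)%N -> exists s : seq 'M[int]_2,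
  (forall k, k \in s -> SL2Z k) /\
  forall g, SL2Z g -> exists2 k, k \in s & principal_congruence N (g *m invmx k).
Proof.
case: N => // n _; pose N := n.+1.
pose red g : 'M['I_N]_2 := \matrix_(i, j) inord (absz (g i j %% N%:Z)%Z).
pose rep (A : 'M['I_N]_2) : seq 'M[int]_2 :=
  if pselect (exists2 g, SL2Z g & red g = A) is left e then [:: projT1 (cid2 e)] else [::].
exists (flatten [seq rep A | A <- enum {: 'M['I_N]_2}]); split.
  move=> k /flattenP[s /mapP[A _ ->]]; rewrite /rep.
  by case: pselect => // e; case: cid2 => g /= Sg _; rewrite inE => /eqP->.
move=> g Sg.
have [k [ks Sk rk]] : exists k, [/\ k \in rep (red g), SL2Z k & red k = red g].
  rewrite /rep; case: pselect => [e|[]]; last by exists g.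
  by case: cid2 => k /= Sk rk; exists k; rewrite inE eqxx.
exists k.
  by apply/flattenP; exists (rep (red g)) => //; apply/map_f; rewrite mem_enum.
have [B gB] : exists B : 'M[int]_2, g = k + N%:Z *: B.
  exists (\matrix_(i, j) ((g i j - k i j) %/ N%:Z)%Z).
  apply/matrixP => i j; rewrite !mxE mulrC divzK; first by rewrite addrC subrK.
  rewrite -eqz_mod_dvd.
  have Nn x : (0 <= (x %% N%:Z)%Z) && ((x %% N%:Z)%Z < N%:Z).
    by rewrite modz_ge0 ?ltz_pmod.
  have := congr1 (fun A : 'M['I_N]_2 => val (A i j)) rk; rewrite !mxE /=.
  have abs x : (absz (x %% N%:Z)%Z)%:Z = (x %% N%:Z)%Z.
    by rewrite abszE ger0_norm //; case/andP: (Nn x).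
  have lt x : (absz (x %% N%:Z)%Z < N)%N.
    by rewrite -ltz_nat abs; case/andP: (Nn x).
  by rewrite !inordK // => /(congr1 Posz); rewrite !abs => ->.
split; first by apply: SL2Z_mul => //; apply: SL2Z_inv.
move=> i j; rewrite gB mulmxDl mulmxV ?SL2Z_unit // mxE -scalemxAl.
apply/eqP; rewrite eqz_mod_dvd addrAC subrr add0r mxE.
exact: dvdz_mulr.
Qed.

End Reduction.

(** * Finiteness of zeros and the pigeonhole argument *)

Section Pigeonhole.
Context {R : realType}.
Local Notation C := R[i].
Implicit Types (z w q : C) (g k : 'M[int]_2) (phi : C -> C).

(** Infinitely many zeros would accumulate inside H, since c > 0; phi would be flat there and vanish
    on all of H. *)
Lemma finite_zeros phi (a b c d : R) p : (forall w, 0 < complex.Im w -> hol phi w) ->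
  0 < complex.Im p -> phi p != 0 -> 0 < c ->
  finite_set [set z | [/\ a <= complex.Re z <= b, c <= complex.Im z <= d & phi z = 0]].
Proof.
move=> hphi p0 phip c0; apply: contrapT => inf.
have [|x [_ /andP[cx _] acc]] := @accumulation R _ a b c d inf; first by move=> z [].
have x0 : 0 < complex.Im x by lra.
have [fx|[n [e [r [e0 r0 low]]]]] := flat_or_order (hphi x x0).
  by move/eqP: phip; apply; apply: hol_H_flat hphi x0 p0 fx.
have [z [[_ _ z0] zx zr]] := acc r r0.
have := low _ zr; rewrite subrKC z0 nm0 leNgt mulr_gt0 ?exprn_gt0 // nm_gt0.
by rewrite subr_eq0.
Qed.

(** The q-expansion at the cusp has finite order at q = 0, hence no zeros for 0 < |q| < r; the bound
    on Im v comes from e^x >= 1 + x. *)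
Lemma no_zeros_at_cusp N phi g p : modular N phi -> SL2Z g -> 0 < complex.Im p ->
  phi p != 0 -> exists Y : R, forall v, Y < complex.Im v -> 0 < complex.Im v ->
    phi (act g v) != 0.
Proof.
move=> [_ mphi] Sg p0 phip; have [h [m [G [h0 hG GE]]]] := mphi g Sg.
have [|fG|[n [c [r [c0 r0 low]]]]] := @flat_or_order R G 0; first by apply: hG; rewrite nm0.
  pose v : C := act (invmx g) p.
  have v0 : 0 < complex.Im v by apply: act_H => //; apply: SL2Z_inv.
  have := GE v v0; rewrite actKV // (hol_flat_disc hG fG) ?nm_qparam_lt1 //.
  by move/eqP; rewrite mulf_eq0 (negPf phip) orbF expf_eq0 (negPf (qparam_neq0 _ _)) andbF.
pose al : R := 2 * pi / h%:R; have al0 : 0 < al := frequency_gt0 h0.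
exists ((al * r)^-1) => v Yv v0; apply/eqP => phi0.
have q0 : 0 < nm (qparam h v) by rewrite nm_gt0 qparam_neq0.
have qr : nm (qparam h v) < r.
  rewrite nm_qparam expRN invf_plt ?posrE ?expR_gt0 //.
  apply: lt_le_trans (expR_ge1Dx _); rewrite -/al.
  have : r^-1 < al * complex.Im v.
    have alr := mulr_gt0 al0 r0.
    by move: Yv; rewrite -[(al * r)^-1]mul1r -[r^-1]mul1r !ltr_pdivrMr //; lra.
  lra.
have := low _ qr; rewrite add0r -GE // phi0 mulr0 nm0 leNgt.
by rewrite mulr_gt0 ?exprn_gt0.
Qed.

Variables (Q : {poly {poly C}}) (beta : {poly C}) (N : nat) (I : finType).
Variables (a b : I -> C -> C).
Hypothesis N0 : (0 < N)%N.
Hypothesis ma : forall i, modular N (a i).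
Hypothesis mb : forall i, modular N (b i).
Local Notation V := (polarized a b).
Hypothesis solvable_fibers : forall z, 0 < complex.Im z -> beta.[z] != 0 ->
  exists w, [/\ complex.Im w < 0, ev Q z w = 0 & V z w = 0].

Lemma principal_translation (m : nat) : principal_congruence N (translation (N * m)%:Z).
Proof.
split; first exact: SL2Z_translation.
have I2 (k : 'I_2) : k = 0 \/ k = 1.
  by case: k => -[|[|//]] ?; [left|right]; apply: val_inj.
move=> i j; apply/eqP; rewrite eqz_mod_dvd.
case: (I2 i) => ->; case: (I2 j) => ->; rewrite !mat2E !mxE /= ?subrr ?dvdz0 //.
by rewrite subr0 PoszM dvdz_mulr.
Qed.

(** As V is N-periodic in z, all fibres z + N m lead to zeros of one modular function phi. Moved
    into the fundamental domain, these zeros form a finite set: of bounded height because phi has no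
    zeros near the cusps, and isolated elsewhere. So two of the points w_m have the same
    representative, and (g n)^-1 (g m) carries one to the other. *)
Lemma common_orbit_point z w1 : 0 < complex.Im z -> complex.Im w1 < 0 ->
  V z w1 != 0 -> (forall m : nat, beta.[z + (N * m)%:R] != 0) ->
  exists m n g, [/\ (m < n)%N, SL2Z g & exists w, [/\ complex.Im w < 0,
    ev Q (z + (N * m)%:R) w = 0 & ev Q (z + (N * n)%:R) (act g w) = 0]].
Proof.
move=> z0 w10 V1 bz.
(* V(z, .) transported from H^- to H by conjugation: a modular function of level N. *)
pose phi w := \sum_i conjc (a i z) * b i w.
have mphi : modular N phi.
  by apply: modular_sum => i; apply: modular_mul => //; apply: modular_cst.
have phiE w : phi (conjc w) = conjc (V z w).
  rewrite /phi /polarized rmorph_sum; apply: eq_bigr => i _.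
  by rewrite rmorphM /= conjcK.
have Imzm (m : nat) : complex.Im (z + (N * m)%:R) = complex.Im z.
  have -> : ((N * m)%:R : C) = ((N * m)%:R : R)%:C by rewrite rmorph_nat.
  by rewrite ImD /= addr0.
have w1' : 0 < complex.Im (conjc w1) by rewrite ImJ_lt0.
have phi1 : phi (conjc w1) != 0 by rewrite phiE conjc_eq0.
have hphi w : 0 < complex.Im w -> hol phi w by move=> w0; exact: modular_hol mphi w0.
have ex (m : nat) : exists wg : C * 'M[int]_2, [/\ complex.Im wg.1 < 0,
    ev Q (z + (N * m)%:R) wg.1 = 0, phi (conjc wg.1) = 0, SL2Z wg.2 &
    - (1 / 2) <= complex.Re (act wg.2 (conjc wg.1)) <= 1 / 2 /\
    1 / 2 <= complex.Im (act wg.2 (conjc wg.1))].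
  have [|w [w0 Qw Vw]] := solvable_fibers _ (bz m); first by rewrite Imzm.
  have w0' : 0 < complex.Im (conjc w) by rewrite ImJ_lt0.
  have [g Sg gw] := fundamental_domain w0'; exists (w, g); split=> //=.
  rewrite phiE -[RHS]conjc0 -Vw; congr conjc; rewrite /polarized.
  apply: eq_bigr => i _; congr (_ * _).
  have <- : act (translation (N * m)%:Z) z = z + (N * m)%:R by rewrite act_translation.
  by rewrite (ma i).1 //; apply: principal_translation.
pose w m := (projT1 (cid (ex m))).1; pose g m := (projT1 (cid (ex m))).2.
pose v m : C := act (g m) (conjc (w m)).
have wgP m : [/\ complex.Im (w m) < 0, ev Q (z + (N * m)%:R) (w m) = 0,
    phi (conjc (w m)) = 0, SL2Z (g m) &
    - (1 / 2) <= complex.Re (v m) <= 1 / 2 /\ 1 / 2 <= complex.Im (v m)].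
  by rewrite /v /w /g; case: (cid (ex m)).
(* phi is invariant only under level N, while g m ranges over SL2(Z): v m is a zero of phi o k for
   one of finitely many representatives k. *)
have [s [sS sP]] := coset_representatives N0.
have [Y YP] : exists Y : R, forall k, k \in s -> forall v, Y < complex.Im v ->
    0 < complex.Im v -> phi (act k v) != 0.
  have [||Y Y0 HY] := @seq_eps R _ s (fun k e => 0 < e -> forall v,
      e^-1 < complex.Im v -> 0 < complex.Im v -> phi (act k v) != 0).
  - move=> k e e' H e'e e'0 x xe x0; have e0 := lt_le_trans e'0 e'e.
    by apply: H => //; apply: le_lt_trans xe; rewrite lef_pV2.
  - move=> k ks; have [Y HY] := no_zeros_at_cusp mphi (sS k ks) w1' phi1.
    exists (Num.max 1 Y)^-1; first by rewrite invr_gt0 lt_max ltr01.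
    move=> _ x; rewrite invrK gt_max => /andP[_ xY]; exact: HY.
  by exists Y^-1 => k ks; apply: HY.
pose Z k := [set x : C | [/\ - (1 / 2) <= complex.Re x <= 1 / 2,
  1 / 2 <= complex.Im x <= Y & phi (act k x) = 0]].
have fZ : finite_set (\bigcup_(k in [set` s]) Z k).
  apply: bigcup_finite; first exact: finite_seq.
  move=> k /= ks; have Sk := sS k ks.
  apply: (@finite_zeros (fun x => phi (act k x)) _ _ _ _ (act (invmx k) (conjc w1))).
  - move=> x x0; apply: (hol_comp (F := act k)).
      by apply: hol_act; rewrite ?gt_eqF.
    by apply: hphi; apply: act_H.
  - by apply: act_H => //; apply: SL2Z_inv.
  - by rewrite actKV.
  - by rewrite divr_gt0.
have vZ m : (\bigcup_(k in [set` s]) Z k) (v m).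
  have [w0 _ phi0 Sg [vr vi]] := wgP m.
  have w0' : 0 < complex.Im (conjc (w m)) by rewrite ImJ_lt0.
  have v0 : 0 < complex.Im (v m) by exact: act_H.
  have [k ks kP] := sP _ (SL2Z_inv Sg); exists k => //.
  have Sk := sS k ks; have kv0 := act_H Sk v0.
  have phik : phi (act k (v m)) = 0.
    rewrite -(mphi.1 _ _ kP kv0) -actM ?gt_eqF //; last first.
      by apply: SL2Z_mul; apply: SL2Z_inv.
    by rewrite mulmxKV ?SL2Z_unit // actK.
  split => //; rewrite vi /= leNgt; apply/negP => vY.
  by have := YP k ks _ vY v0; rewrite phik eqxx.
have [m [n [mn vmn]]] := nat_pigeonhole fZ vZ.
have [wm0 Qm _ Sm _] := wgP m; have [wn0 Qn _ Sn _] := wgP n.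
have wm0' : 0 < complex.Im (conjc (w m)) by rewrite ImJ_lt0.
have wn0' : 0 < complex.Im (conjc (w n)) by rewrite ImJ_lt0.
have Sgg : SL2Z (invmx (g n) *m g m) by apply: SL2Z_mul => //; apply: SL2Z_inv.
exists m, n, (invmx (g n) *m g m); split=> //; exists (w m); split=> //.
suff -> : act (invmx (g n) *m g m) (w m) = w n by [].
rewrite -[w m]conjcK act_conj actM ?gt_eqF //; last exact: SL2Z_inv.
by rewrite -/(v m) vmn actK // conjcK.
Qed.

(** The triples (m, n, g) of [common_orbit_point] form a countable set, while z runs over a
    horizontal segment; one triple therefore occurs for infinitely many z, and l = N (n - m). *)
Theorem infinitely_many_translates z1 w1 : beta != 0 -> 0 < complex.Im z1 ->
  complex.Im w1 < 0 -> V z1 w1 != 0 ->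
  exists l g, [/\ (0 < l)%N, SL2Z g & infinite_set [set z : C |
    exists w, [/\ complex.Im w < 0, ev Q z w = 0 & ev Q (z + l%:R) (act g w) = 0]]].
Proof.
move=> b0 z10 w10 V1.
have hV : hol (fun z => V z w1) z1.
  apply: polarized_hol_on_arcs => //; [exact: hol_id|exact: hol_cst].
have nV : 0 < nm (V z1 w1) by rewrite nm_gt0.
have [d d0 Hd] := hol_cont hV nV.
have Vne z : nm (z - z1) < d -> V z w1 != 0.
  move=> zd; apply: contraTneq (Hd z zd) => ->.
  by rewrite sub0r nmN ltxx.
pose e := Num.min (d / 2) (complex.Im z1).
have e0 : 0 < e by rewrite lt_min divr_gt0.
(* The height u keeps a whole horizontal line, hence every real translate of its points, off the
   zeros of beta. *)
have [u [u0 ue uF]] := small_avoiding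
  (finite_image (fun x => complex.Im x - complex.Im z1) (finite_roots b0)) e0.
pose zs (s : R) := z1 + (s +i* u)%C.
have Imzs s : complex.Im (zs s) = complex.Im z1 + u by rewrite /zs ImD.
have bzs s (x : R) : beta.[zs s + x%:C] != 0.
  apply/eqP => bx; apply: uF; exists (zs s + x%:C) => //.
  by rewrite ImD Imzs /= addr0 addrAC subrr add0r.
have ed : e <= d / 2 by rewrite ge_min lexx.
have fiberP s : exists mng : nat * nat * 'M[int]_2, 0 < s < e ->
    [/\ (mng.1.1 < mng.1.2)%N, SL2Z mng.2 & exists w, [/\ complex.Im w < 0,
    ev Q (zs s + (N * mng.1.1)%:R) w = 0 &
    ev Q (zs s + (N * mng.1.2)%:R) (act mng.2 w) = 0]].
  have [/andP[s0 se]|] := boolP (0 < s < e); last by exists (0%N, 0%N, 0).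
  have [|||m [n [g H]]] := @common_orbit_point (zs s) w1 _ w10.
  - by rewrite Imzs addr_gt0.
  - apply: Vne; rewrite /zs addrAC subrr add0r.
    by apply: le_lt_trans (nm_Cauchy _) _; rewrite /= !gtr0_norm //; lra.
  - move=> m; have -> : ((N * m)%:R : C) = ((N * m)%:R : R)%:C by rewrite rmorph_nat.
    exact: bzs.
  by exists (m, n, g).
pose F s := projT1 (cid (fiberP s)).
have FP s : 0 < s < e -> [/\ ((F s).1.1 < (F s).1.2)%N, SL2Z (F s).2 &
    exists w, [/\ complex.Im w < 0, ev Q (zs s + (N * (F s).1.1)%:R) w = 0 &
    ev Q (zs s + (N * (F s).1.2)%:R) (act (F s).2 w) = 0]].
  by rewrite /F; case: (cid (fiberP s)).
have [[[m n] g] infF] := uncountable_fiber F (uncountable_itv e0).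
have [s [/= s0e Fs]] := infinite_setN0 infF.
have := FP s s0e; rewrite Fs /= => -[mn Sg _].
exists (N * (n - m))%N, g; split=> //; first by rewrite muln_gt0 N0 subn_gt0.
move=> fin; apply: infF.
pose G (s : R) := zs s + (N * m)%:R.
have Ginj : injective G.
  move=> x y /(congr1 (@complex.Re R)).
  by rewrite /G /zs !ReD /= => /addIr/addrI.
apply: sub_finite_set (finite_preimage (f := G) (in2W Ginj) fin).
move=> x /= [x0e Fx]; have [_ _ [w [w0 Qw Qgw]]] := FP x x0e.
exists w; rewrite Fx /= in Qw Qgw; split=> //.
by rewrite /G -addrA -natrD -mulnDr subnKC // ltnW.
Qed.

End Pigeonhole.

(** * Growth estimates and fractional linear relations *)

Section Translates.
Context {R : realType}.
Local Notation C := R[i].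
Implicit Types (z w : C) (p f : {poly C}) (Q : {poly {poly C}}).

Lemma horner_growth p : exists D, exists2 K : R, 0 < K &
  forall z, nm p.[z] <= K * (1 + nm z) ^+ D.
Proof.
elim/poly_ind: p => [|p c [D [K K0 H]]].
  by exists 0%N, 1 => // z; rewrite horner0 nm0 expr0 mulr1.
exists D.+1, (K + nm c); first by rewrite ltr_wpDr ?nm_ge0.
move=> z; rewrite hornerMXaddC (le_trans (nmD _ _)) // mulrDl nmM.
have z1 : 1 <= 1 + nm z by rewrite lerDl nm_ge0.
rewrite lerD //; last by rewrite ler_peMr ?nm_ge0 // exprn_ege1.
by rewrite exprSr mulrA ler_pM ?nm_ge0 // lerDr ler01.
Qed.

Lemma horner_lower p : p != 0 -> exists2 c : R, 0 < c & exists M : R,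
  forall z, M <= nm z -> c <= nm p.[z].
Proof.
elim/poly_ind: p => [|p a IH]; first by rewrite eqxx.
have [->|p0] := eqVneq p 0.
  rewrite mul0r add0r polyC_eq0 => a0; exists (nm a); first by rewrite nm_gt0.
  by exists 0 => z _; rewrite hornerC.
have [c c0 [M HM]] := IH p0 => _; exists 1 => //.
exists (Num.max M ((1 + nm a) / c)) => z; rewrite ge_max => /andP[/HM h1 h2].
rewrite ler_pdivrMr // in h2; rewrite hornerMXaddC.
have := nm_dist (p.[z] * z) (- a); rewrite opprK nmN nmM => h3.
have : nm z * c <= nm p.[z] * nm z by rewrite mulrC ler_wpM2r ?nm_ge0.
by lra.
Qed.

Lemma ev_growth Q (r : R) : 0 <= r -> exists D, exists2 K : R, 0 < K &
  forall z w, nm w <= r -> nm (ev Q z w) <= K * (1 + nm z) ^+ D.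
Proof.
move=> r0; elim/poly_ind: Q => [|Q c [D [K K0 H]]].
  by exists 0%N, 1 => // z w _; rewrite ev0 nm0 expr0 mulr1.
have [E [L L0 HL]] := horner_growth c.
exists (D + E)%N, (K * r + L); first by rewrite ltr_wpDl // mulr_ge0 // ltW.
move=> z w wr; rewrite evMXaddC (le_trans (nmD _ _)) // mulrDl nmM.
have z1 : 1 <= 1 + nm z by rewrite lerDl nm_ge0.
have z0 : 0 <= 1 + nm z by lra.
rewrite lerD //.
  rewrite mulrAC ler_pM ?nm_ge0 // (le_trans (H _ _ wr)) // ler_wpM2l ?(ltW K0) //.
  by rewrite ler_weXn2l // leq_addr.
by rewrite (le_trans (HL z)) // ler_wpM2l ?(ltW L0) // ler_weXn2l // leq_addl.
Qed.

Lemma ev_growth_lip Q (r : R) : 0 <= r -> exists D, exists2 K : R, 0 < K &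
  forall z w w', nm w <= r -> nm w' <= r ->
  nm (ev Q z w - ev Q z w') <= K * (1 + nm z) ^+ D * nm (w - w').
Proof.
move=> r0; elim/poly_ind: Q => [|Q c [D [K K0 H]]].
  exists 0%N, 1 => // z w w' _ _.
  by rewrite !ev0 subrr nm0 expr0 mulr1 mul1r nm_ge0.
have [E [L L0 HL]] := ev_growth Q r0.
exists (D + E)%N, (K * r + L); first by rewrite ltr_wpDl // mulr_ge0 // ltW.
move=> z w w' wr w'r; rewrite !evMXaddC.
have z1 : 1 <= 1 + nm z by rewrite lerDl nm_ge0.
have z0 : 0 <= 1 + nm z by lra.
have -> : ev Q z w * w + c.[z] - (ev Q z w' * w' + c.[z]) =
  (ev Q z w - ev Q z w') * w + ev Q z w' * (w - w') by ring.
rewrite (le_trans (nmD _ _)) // [(_ + L) * _]mulrDl [leRHS]mulrDl !nmM lerD //.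
  have -> : K * r * (1 + nm z) ^+ (D + E) * nm (w - w') =
      K * (1 + nm z) ^+ (D + E) * nm (w - w') * r by ring.
  rewrite ler_pM ?nm_ge0 // (le_trans (H _ _ _ wr w'r)) // ler_wpM2r ?nm_ge0 //.
  by rewrite ler_wpM2l ?(ltW K0) // ler_weXn2l // leq_addr.
rewrite ler_wpM2r ?nm_ge0 // (le_trans (HL z _ w'r)) // ler_wpM2l ?(ltW L0) //.
by rewrite ler_weXn2l // leq_addl.
Qed.

Lemma geometric_beats_poly (th L K c : R) D : 0 < th -> th < 1 -> 0 < c ->
  0 <= L -> exists j : nat, K * (L + j%:R) ^+ D * th ^+ j < c.
Proof.
move=> th0 th1 c0 L0; pose al := - ln th.
have al0 : 0 < al by rewrite oppr_gt0 ln_lt0 // th0.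
have thE j : th ^+ j = expR (- (al * j%:R)).
  by rewrite /al mulNr opprK mulr_natr -lnXn // lnK // posrE exprn_gt0.
have [Y HY] := exp_beats_poly (K * expR (al * L)) D c0 al0.
pose j := Num.bound (Num.max Y 0); exists j.
have jY : Y <= L + j%:R.
  have : Num.max Y 0 < j%:R by apply: archi_boundP; rewrite le_max lexx orbT.
  by rewrite gt_max => /andP[? _]; lra.
have [y0] := HY _ jY; rewrite ltr_pdivlMr ?exprn_gt0 //.
rewrite thE; have -> : K * expR (al * L) * expR (- (al * (L + j%:R))) =
    K * expR (- (al * j%:R)).
  by rewrite -mulrA -expRD; congr (K * expR _); ring.
by rewrite mulrAC.
Qed.

(** The quadratic equation says that g fixes phi; with det g = 1 it gives (c phi + d)(a - c phi) =
    1, whence both conclusions. *)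
Lemma act_fixed_point (g : 'M[int]_2) w (phi : C) : SL2Z g -> cden g w != 0 ->
  (g 1 0)%:~R * phi ^+ 2 + ((g 1 1)%:~R - (g 0 0)%:~R) * phi - (g 0 1)%:~R = 0 ->
  cden g phi != 0 /\ act g w - phi = (w - phi) / (cden g w * cden g phi).
Proof.
move=> Sg cw fix_phi.
have dg : (g 0 0)%:~R * (g 1 1)%:~R - (g 0 1)%:~R * (g 1 0)%:~R = 1 :> C.
  by rewrite -!intrM -intrB SL2Z_det.
have inv : cden g phi * ((g 0 0)%:~R - (g 1 0)%:~R * phi) = 1.
  have -> : cden g phi * ((g 0 0)%:~R - (g 1 0)%:~R * phi) =
      ((g 0 0)%:~R * (g 1 1)%:~R - (g 0 1)%:~R * (g 1 0)%:~R) - (g 1 0)%:~R *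
      ((g 1 0)%:~R * phi ^+ 2 + ((g 1 1)%:~R - (g 0 0)%:~R) * phi - (g 0 1)%:~R).
    by rewrite /cden; ring.
  by rewrite fix_phi dg mulr0 subr0.
have cphi : cden g phi != 0.
  by apply/eqP => c0; move/eqP: inv; rewrite c0 mul0r eq_sym oner_eq0.
have key : ((g 0 0)%:~R * w + (g 0 1)%:~R - phi * cden g w) * cden g phi = w - phi.
  have -> : (g 0 0)%:~R * w + (g 0 1)%:~R - phi * cden g w =
      ((g 0 0)%:~R - (g 1 0)%:~R * phi) * (w - phi) - ((g 1 0)%:~R * phi ^+ 2 +
      ((g 1 1)%:~R - (g 0 0)%:~R) * phi - (g 0 1)%:~R) by rewrite /cden; ring.
  by rewrite fix_phi subr0 mulrAC [_ * cden g phi]mulrC inv mul1r.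
split=> //; rewrite actE -key.
move: (cden g w) (cden g phi) cw cphi => x y x0 y0; field.
by rewrite x0 y0.
Qed.

Lemma act_low g w : SL2Z g -> complex.Im w < 0 -> complex.Im (act g w) < 0.
Proof.
move=> Sg w0; rewrite -ImJ_lt0 -act_conj; apply: act_H => //.
by rewrite ImJ_lt0.
Qed.

(* The condition on m and n says that al / ga, the value of w at z = oo, is
   rational or infinite. *)
Definition rational_relation (Q : {poly {poly C}}) :=
  exists (al be ga ka : C) (e : {poly C}), [/\ e != 0,
    [|| al != 0, be != 0, ga != 0 | ka != 0],
    exists m n : int, ((m != 0) || (n != 0)) /\ al * n%:~R = ga * m%:~R &
    forall z w, e.[z] != 0 -> ev Q z w = 0 -> (ga * z + ka) * w = al * z + be].

Definition fraction_poly (al be ga ka : C) : {poly {poly C}} :=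
  (ga *: 'X + ka%:P) *: 'X - (al *: 'X + be%:P)%:P.

Lemma fraction_polyE al be ga ka z w :
  ev (fraction_poly al be ga ka) z w = (ga * z + ka) * w - (al * z + be).
Proof. by rewrite /fraction_poly evD evN evZ evX evC !hornerE. Qed.

(** The z_j are distinct, so irreducibility of Q extends the relation from this progression to the
    whole curve, up to the zeros of e. *)
Lemma relation_of_points Q al be ga ka z0 (l : nat) (zs ws : nat -> C) :
  irr Q -> (0 < l)%N ->
  [|| al != 0, be != 0, ga != 0 | ka != 0] ->
  (exists m n : int, ((m != 0) || (n != 0)) /\ al * n%:~R = ga * m%:~R) ->
  (forall j, zs j = z0 + (j * l)%:R) ->
  (forall j, ev Q (zs j) (ws j) = 0) ->
  (forall j, (ga * zs j + ka) * ws j = al * zs j + be) -> rational_relation Q.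
Proof.
move=> irrQ l0 nz mn zsE Qj Ej.
have [|e e0 He] := irr_common (G := fraction_poly al be ga ka) irrQ.
  move=> fin; apply: infinite_nat.
  have -> : [set: nat] = zs @^-1`
      [set z | exists w, ev Q z w = 0 /\ ev (fraction_poly al be ga ka) z w = 0].
    apply/seteqP; split=> // j _; exists (ws j); split; first exact: Qj.
    by rewrite fraction_polyE Ej subrr.
  apply: finite_preimage fin => i j _ _; rewrite !zsE => /addrI/eqP.
  by rewrite eqr_nat eqn_pmul2r // => /eqP.
exists al, be, ga, ka, e; split=> // z w ez Qz.
by apply/eqP; rewrite -subr_eq0 -fraction_polyE He.
Qed.


End Translates.

(** * Translation, elliptic and parabolic orbits *)

Section Orbits.
Context {R : realType}.
Local Notation C := R[i].
Implicit Types (z w : C) (p f : {poly C}) (Q : {poly {poly C}}).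

Lemma orbit_of_translates Q beta (l : nat) (g : 'M[int]_2) : irr Q ->
  (0 < l)%N -> SL2Z g -> beta != 0 ->
  (forall z, 0 < complex.Im z -> beta.[z] != 0 ->
     exists2 w, complex.Im w < 0 & ev Q z w = 0) ->
  infinite_set [set z : C | exists w, [/\ complex.Im w < 0, ev Q z w = 0 &
     ev Q (z + l%:R) (act g w) = 0]] ->
  exists z0 w0, forall j, complex.Im (iter j (act g) w0) < 0 /\
    ev Q (z0 + (j * l)%:R) (iter j (act g) w0) = 0.
Proof.
move=> irrQ l0 Sg b0 fibers inf.
(* numerator of Q(z + l, g w) *)
pose num (P : {poly {poly C}}) n : {poly {poly C}} := \sum_(i < n.+1)
  (P`_i \Po ('X + (l%:R)%:P)) *: ((((g 0 0)%:~R)%:P%:P * 'X + ((g 0 1)%:~R)%:P%:P) ^+ i *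
  (((g 1 0)%:~R)%:P%:P * 'X + ((g 1 1)%:~R)%:P%:P) ^+ (n - i)).
have evX_ (G : {poly {poly C}}) z w n : ev (G ^+ n) z w = ev G z w ^+ n.
  by elim: n => [|n IH]; rewrite ?expr0 ?exprS ?evM ?IH // /ev -polyC1 !hornerC.
have clear_den (A B : C) i n : B != 0 -> (i <= n)%N ->
    A ^+ i * B ^+ (n - i) = B ^+ n * (A / B) ^+ i.
  move=> B0 le; rewrite -[in RHS](subnK le) exprD expr_div_n.
  have := expf_neq0 i B0; move: (B ^+ i) (A ^+ i) (B ^+ (n - i)) => x y t x0.
  by field.
have numE n z w : size Q = n.+1 -> cden g w != 0 ->
    ev (num Q n) z w = cden g w ^+ n * ev Q (z + l%:R) (act g w).
  move=> sQ cw; rewrite -[in RHS]fiberE (@horner_coef_wide _ n.+1); last first.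
    by rewrite /fiber -sQ size_poly.
  rewrite mulr_sumr /num /ev !horner_sum; apply: eq_bigr => i _.
  rewrite -/(ev _ z w) evZ evM !evX_ !evD !evM !evX !evC !hornerC.
  rewrite horner_comp /fiber coef_map /= /horner_eval [RHS]mulrCA.
  congr (_ * _); first by rewrite !hornerE.
  by rewrite actE -clear_den // -ltnS ltn_ord.
have [n sQ] : exists n, size Q = n.+1.
  by exists (size Q).-1; rewrite prednK // (ltn_trans _ irrQ.1).
have cw w : complex.Im w < 0 -> cden g w != 0.
  by move=> w0; apply: cden_neq0; rewrite // lt_eqF.
have [|e e0 He] := irr_common (G := num Q n) irrQ.
  move=> fin; apply: inf; apply: sub_finite_set fin => z [w [w0 Qw Qgw]].
  by exists w; rewrite numE ?Qgw ?mulr0 ?cw.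
have step z w : e.[z] != 0 -> complex.Im w < 0 -> ev Q z w = 0 ->
    ev Q (z + l%:R) (act g w) = 0.
  move=> ez w0 Qw; have := He z w ez Qw; rewrite numE ?cw // => /eqP.
  by rewrite mulf_eq0 expf_eq0 (negPf (cw _ w0)) andbF => /eqP.
(* a starting point none of whose translates is exceptional *)
have [u [u0 _ uF]] := small_avoiding
  (finite_image (@complex.Im R) (finite_roots (mulf_neq0 b0 e0))) ltr01.
have good (x : R) : beta.[(x +i* u)%C] != 0 /\ e.[(x +i* u)%C] != 0.
  split; apply/eqP => h; apply: uF; exists (x +i* u)%C => //=;
  by rewrite hornerM h ?mulr0 ?mul0r.
pose z0 : C := (u *i)%C.
have zsE j : z0 + (j * l)%:R = ((j * l)%:R +i* u)%C :> C.
  have -> : ((j * l)%:R : C) = ((j * l)%:R : R)%:C by rewrite rmorph_nat.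
  by rewrite /z0; apply: complex_ext; rewrite /= ?add0r ?addr0.
have [w0 w00 Qw0] : exists2 w, complex.Im w < 0 & ev Q z0 w = 0.
  by apply: fibers => //; case: (good 0).
exists z0, w0; elim=> [|j [wj Qj]]; first by rewrite mul0n addr0.
split; first exact: act_low.
have -> : z0 + (j.+1 * l)%:R = z0 + (j * l)%:R + l%:R.
  by rewrite mulSn addnC natrD addrA.
by apply: step => //; rewrite zsE; case: (good (j * l)%:R).
Qed.

(** Here a d = 1 in the integers, so a = d and g is w |-> w + t: the points (z0 + j l, w0 + j t) lie
    on a line. With ga = 0, the pair m = 1, n = 0 meets the rationality condition. *)
Lemma relation_of_orbit_translation Q (l : nat) (g : 'M[int]_2) z0 w0 : irr Q ->
  (0 < l)%N -> SL2Z g -> g 1 0 = 0 ->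
  (forall j, ev Q (z0 + (j * l)%:R) (iter j (act g) w0) = 0) ->
  rational_relation Q.
Proof.
move=> irrQ l0 Sg c0 Qws; have dg := SL2Z_det Sg.
have d1 : (g 0 0)%:~R * (g 1 1)%:~R = 1 :> C.
  by rewrite -intrM; move: dg; rewrite c0 mulr0 subr0 => ->.
have dN : (g 1 1)%:~R != 0 :> C.
  by apply/eqP => d0; move/eqP: d1; rewrite d0 mulr0 eq_sym oner_eq0.
have a2 : (g 0 0)%:~R / (g 1 1)%:~R = 1 :> C.
  have dg2 : g 0 0 = g 1 1.
    move: dg; rewrite c0 mulr0 subr0 => h.
    have : g 0 0 \is a GRing.unit by apply/unitrP; exists (g 1 1); rewrite mulrC h.
    rewrite unfold_in => /orP[]/eqP e; move: h; rewrite e ?mul1r ?mulN1r => <- //.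
    by rewrite opprK.
  by rewrite dg2 divff.
pose t : C := (g 0 1)%:~R / (g 1 1)%:~R.
have wsE j : iter j (act g) w0 = w0 + j%:R * t.
  elim: j => [|j IH]; first by rewrite mul0r addr0.
  rewrite iterS actE /cden c0 mul0r add0r mulrDl mulrAC a2 mul1r IH.
  by rewrite -natr1 mulrDl mul1r addrA.
have lN : (l%:R : C) != 0 by rewrite pnatr_eq0 -lt0n.
apply: (@relation_of_points R Q (t / l%:R) (w0 - t / l%:R * z0) 0 1 z0 l
  (fun j => z0 + (j * l)%:R) (fun j => iter j (act g) w0)) => //.
- by rewrite oner_eq0 !orbT.
- by exists 1, 0; split=> //; rewrite mulr0 mul0r.
by move=> j; rewrite mul0r add0r mul1r wsE natrM; field.
Qed.

Lemma relation_of_orbit_periodic Q (l k : nat) (g : 'M[int]_2) z0 w0 : irr Q ->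
  (0 < l)%N -> (0 < k)%N -> iter k (act g) w0 = w0 ->
  (forall j, ev Q (z0 + (j * l)%:R) (iter j (act g) w0) = 0) ->
  rational_relation Q.
Proof.
move=> irrQ l0 k0 per Qws.
have perE j : iter (j * k) (act g) w0 = w0.
  by elim: j => // j IH; rewrite mulSn iterD IH.
apply: (@relation_of_points R Q 0 w0 0 1 z0 (k * l)
  (fun j => z0 + (j * (k * l))%:R) (fun j => w0)) => //.
- by rewrite muln_gt0 k0.
- by rewrite oner_eq0 !orbT.
- by exists 1, 0; split=> //; rewrite !mul0r.
- by move=> j; have := Qws (j * k)%N; rewrite perE mulnA.
by move=> j; rewrite !mul0r !add0r mul1r.
Qed.

(** By Cayley-Hamilton, g^2 = t g - 1 with t in {-1, 0, 1}, so g^2 = -1 or g^3 = 1 or g^3 = -1, and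
    both 1 and -1 act trivially. *)
Lemma act_periodic (g : 'M[int]_2) w : SL2Z g -> complex.Im w < 0 ->
  `|g 0 0 + g 1 1| <= 1 -> exists2 k, (0 < k)%N & iter k (act g) w = w.
Proof.
move=> Sg w0 tr; have dg := SL2Z_det Sg.
have actN1 : act (- 1%:M) w = w.
  rewrite actE /cden !mxE /= mulr0n mul0r oppr0 add0r addr0 !mulN1r.
  by rewrite invrN invr1 mulrN mulr1 opprK.
have wN0 : complex.Im w != 0 by rewrite lt_eqF.
have tr3 : [|| g 0 0 + g 1 1 == 0, g 0 0 + g 1 1 == 1 | g 0 0 + g 1 1 == -1].
  by move: tr; move: (_ + _) => x; lia.
have CH : g *m g = (g 0 0 + g 1 1) *: g - 1%:M.
  apply: mx2_ext; rewrite mulmx2 !mxE /= ?mulr1n ?mulr0n;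
  rewrite -?dg; ring.
case/or3P: tr3 => /eqP t.
- exists 2%N => //=; rewrite -actM // CH t scale0r add0r; exact: actN1.
- exists 3%N => //=; rewrite -(actM Sg Sg wN0) -(actM Sg (SL2Z_mul Sg Sg) wN0).
  by rewrite CH t scale1r mulmxBr mulmx1 CH t scale1r addrAC subrr add0r actN1.
exists 3%N => //=; rewrite -(actM Sg Sg wN0) -(actM Sg (SL2Z_mul Sg Sg) wN0).
rewrite CH t scaleN1r mulmxBr mulmxN mulmx1 CH t scaleN1r opprB opprK addrK.
by rewrite act1.
Qed.

(** With phi = (a - d) / (2 c) the double fixed point, each step adds t to 1 / (w - phi), which is
    therefore affine in z along the orbit. The value of w at z = oo is phi, a rational number. *)
Lemma relation_of_orbit_parabolic Q (l : nat) (g : 'M[int]_2) z0 w0 : irr Q ->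
  (0 < l)%N -> SL2Z g -> g 1 0 != 0 -> (g 0 0 + g 1 1) ^+ 2 = 4 ->
  (forall j, complex.Im (iter j (act g) w0) < 0 /\
    ev Q (z0 + (j * l)%:R) (iter j (act g) w0) = 0) ->
  rational_relation Q.
Proof.
move=> irrQ l0 Sg c0 par Pw; have dg := SL2Z_det Sg.
pose c : C := (g 1 0)%:~R; pose d : C := (g 1 1)%:~R; pose a : C := (g 0 0)%:~R.
pose b : C := (g 0 1)%:~R.
have cN : c != 0 by rewrite /c intr_eq0.
have dgC : a * d - b * c = 1 by rewrite -!intrM -intrB dg.
have parC : (a + d) ^+ 2 = 4.
  by rewrite -intrD -rmorphXn /= par; ring.
pose phi : C := (a - d) / (2 * c).
have fixphi : c * phi ^+ 2 + (d - a) * phi - b = 0.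
  have -> : c * phi ^+ 2 + (d - a) * phi - b =
      - ((a + d) ^+ 2 - 4 * (a * d - b * c)) / (4 * c) by rewrite /phi; field.
  by rewrite parC dgC mulr1 subrr oppr0 mul0r.
have cphi2 : (c * phi + d) ^+ 2 = 1.
  have -> : c * phi + d = (a + d) / 2 by rewrite /phi; field.
  by rewrite expr_div_n parC; field.
have cphi : c * phi + d != 0.
  by apply/eqP => h; move/eqP: cphi2; rewrite h expr0n /= eq_sym oner_eq0.
pose t := c / (c * phi + d).
have realphi : complex.Im phi = 0.
  have h : phi * (2 * c) = a - d by rewrite /phi mulfVK // mulf_neq0.
  have := congr1 (@complex.Im R) h.
  rewrite (_ : 2 * c = (2 * (g 1 0)%:~R : R)%:C); last first.
    by rewrite rmorphM rmorph_nat /c /= -intC.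
  rewrite (_ : a - d = ((g 0 0)%:~R - (g 1 1)%:~R : R)%:C); last first.
    by rewrite rmorphB /= -!intC.
  rewrite ImM /= mulr0 add0r => /eqP; rewrite mulf_eq0 => /orP[/eqP//|].
  by rewrite mulf_eq0 intr_eq0 (negPf c0) pnatr_eq0.
have wphi w : complex.Im w < 0 -> w - phi != 0.
  move=> w0'; apply/eqP => /(congr1 (@complex.Im R)); rewrite ImD ImN realphi /=.
  by move=> h; move: w0'; rewrite -[complex.Im w]subr0 h ltxx.
have step w : complex.Im w < 0 -> (act g w - phi)^-1 = (w - phi)^-1 + t.
  move=> w00; have cw : cden g w != 0 by apply: cden_neq0; rewrite // lt_eqF.
  have [_ ->] := act_fixed_point Sg cw fixphi.
  rewrite -/c -/d /cden -/c -/d -/phi /t.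
  have e1 : (c * w + d) * (c * phi + d) = (w - phi) * c * (c * phi + d) + 1.
    by rewrite -cphi2; ring.
  rewrite e1 invf_div mulrDl -mulrA mul1r addrC; congr (_ + _).
  have := wphi w w00; move: (w - phi) (c * phi + d) cphi cphi2 => x y y0 y2 x0.
  have -> : y^-1 = y by apply: (mulfI y0); rewrite divff // -expr2.
  by field.
have wsE j : (iter j (act g) w0 - phi)^-1 = (w0 - phi)^-1 + j%:R * t.
  elim: j => [|j IH]; first by rewrite mul0r addr0.
  by rewrite iterS step ?IH -?natr1 ?mulrDl ?mul1r ?addrA //; case: (Pw j).
have lN : (l%:R : C) != 0 by rewrite pnatr_eq0 -lt0n.
have tN : t != 0 by rewrite /t mulf_neq0 ?invr_neq0.
pose la := t / l%:R; pose ka := (w0 - phi)^-1 - la * z0.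
have laN : la != 0 by rewrite mulf_neq0 ?invr_neq0.
apply: (@relation_of_points R Q (phi * la) (1 + ka * phi) la ka z0 l
  (fun j => z0 + (j * l)%:R) (fun j => iter j (act g) w0)) => //.
- by rewrite laN !orbT.
- exists (g 0 0 - g 1 1), (2 * g 1 0); split; first by rewrite mulf_neq0 ?orbT.
  by rewrite intrM intrB -/a -/d -/c /phi; field.
- by move=> j; case: (Pw j).
have w0N := wphi _ (Pw 0%N).1.
move=> j; have [wj _] := Pw j; have := wsE j; have := wphi _ wj.
move: (iter j _ _) => w x0 h.
have -> : la * (z0 + (j * l)%:R) + ka = (w - phi)^-1.
  by rewrite h /ka /la natrM; field; rewrite ?w0N ?lN.
have e2 : phi * la * (z0 + (j * l)%:R) + (1 + ka * phi) = 1 + phi * (w - phi)^-1.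
  by rewrite h /ka /la natrM; field; rewrite ?w0N ?lN.
rewrite e2; field; exact: x0.
Qed.
End Orbits.

(** * Hyperbolic orbits *)

Section Hyperbolic.
Context {R : realType}.
Local Notation C := R[i].
Implicit Types (z w : C) (p f : {poly C}) (Q : {poly {poly C}}).

Lemma nat_beyond (M : R) : exists j : nat, M <= j%:R.
Proof.
exists (Num.bound (Num.max M 0)).
have : Num.max M 0 < (Num.bound (Num.max M 0))%:R :> R.
  by apply: archi_boundP; rewrite le_max lexx orbT.
by rewrite gt_max => /andP[/ltW].
Qed.

(** Along the orbit |Q(z_j, phi)| is at most a polynomial in j times th^j, so it tends to 0 while
    z_j tends to infinity. A nonzero polynomial in z cannot do that, so Q(z, phi) = 0 identically
    and the relation is w = phi. *)
Lemma relation_of_orbit_limit Q (l : nat) z0 (phi : C) (ws : nat -> C) (B th : R) :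
  irr Q -> (0 < l)%N -> 0 < th -> th < 1 -> 0 <= B ->
  (forall j, ev Q (z0 + (j * l)%:R) (ws j) = 0) ->
  (forall j, nm (ws j - phi) <= B * th ^+ j) -> rational_relation Q.
Proof.
move=> irrQ l0 th0 th1 B0 Qws lim.
have [q0|q0] := eqVneq Q.[phi%:P] 0.
  apply: (@relation_of_points R Q 0 phi 0 1 z0 l
    (fun j => z0 + (j * l)%:R) (fun=> phi)) => //.
  - by rewrite oner_eq0 !orbT.
  - by exists 1, 0; split=> //; rewrite !mul0r.
  - by move=> j; rewrite /ev q0 horner0.
  by move=> j; rewrite !mul0r !add0r mul1r.
have [c c0 [M HM]] := horner_lower q0.
have [|D [K K0 HK]] := ev_growth_lip Q (r := nm phi + B); first by rewrite addr_ge0 ?nm_ge0.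
(* From index J on, z_j is past the threshold M of [horner_lower]. *)
have [J HJ] := nat_beyond (M + nm z0).
have l1 : 1 <= l%:R :> R by rewrite ler1n.
pose L := 1 + nm z0 + J%:R.
have L1 : 1 <= L by rewrite /L -addrA lerDl addr_ge0 ?nm_ge0.
have [j Hj] := geometric_beats_poly (K * l%:R ^+ D * B * th ^+ J) D th0 th1 c0
  (le_trans ler01 L1).
pose z := z0 + ((J + j) * l)%:R.
have nmnat n : nm (n%:R : C) = n%:R.
  have -> : (n%:R : C) = (n%:R : R)%:C by rewrite rmorph_nat.
  by rewrite nm_real ger0_norm.
have jl : (J + j)%:R <= ((J + j) * l)%:R :> R by rewrite ler_nat leq_pmulr.
have zM : M <= nm z.
  have := nm_dist (((J + j) * l)%:R) (- z0); rewrite opprK [_ + z0]addrC -/z nmN nmnat.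
  have : (J%:R : R) <= (J + j)%:R by rewrite ler_nat leq_addr.
  by lra.
have zL : 1 + nm z <= l%:R * (L + j%:R).
  have h1 : nm z <= nm z0 + l%:R * (J%:R + j%:R).
    by rewrite (le_trans (nmD _ _)) // lerD2l nmnat mulnC natrM natrD.
  have h2 : 1 + nm z0 <= l%:R * (1 + nm z0).
    by rewrite ler_peMl // addr_ge0 ?nm_ge0.
  by rewrite /L -!addrA [leRHS]mulrDr; move: h1 h2; rewrite !mulrDr; lra.
have phiB : nm phi <= nm phi + B by rewrite lerDl.
have wB : nm (ws (J + j)%N) <= nm phi + B.
  rewrite -(subrK phi (ws _)) addrC (le_trans (nmD _ _)) // lerD2l.
  by rewrite (le_trans (lim _)) // ler_piMr // exprn_ile1 // ltW.
have := HK z _ _ phiB wB; rewrite Qws subr0 => bound.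
have := HM z zM; rewrite -/(ev Q z phi) => low.
have := lt_le_trans Hj (le_trans low bound); rewrite ltNge => /negP[].
have -> : K * l%:R ^+ D * B * th ^+ J * (L + j%:R) ^+ D * th ^+ j =
    K * (l%:R * (L + j%:R)) ^+ D * (B * th ^+ (J + j)).
  by rewrite exprMn exprD; ring.
rewrite ler_pM ?nm_ge0 //; last by rewrite nmBC.
  by rewrite mulr_ge0 ?(ltW K0) // exprn_ge0 // addr_ge0 ?nm_ge0.
rewrite ler_wpM2l ?(ltW K0) // lerXn2r // nnegrE ?addr_ge0 ?nm_ge0 //.
by rewrite mulr_ge0 // addr_ge0 // (le_trans ler01).
Qed.

(** The sign of s is such that (a + d - s) / 2 is the eigenvalue of modulus below 1. Its square th
    multiplies (w - p1) / (w - p2) at each step, p1 and p2 being the real fixed points, so the orbit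
    tends to p1 geometrically. *)
Lemma relation_of_orbit_hyperbolic Q (l : nat) (g : 'M[int]_2) z0 w0 (s : R) : irr Q ->
  (0 < l)%N -> SL2Z g -> g 1 0 != 0 ->
  s ^+ 2 = (g 0 0 + g 1 1)%:~R ^+ 2 - 4 -> s != 0 ->
  ((g 0 0 + g 1 1)%:~R - s) ^+ 2 < 4 ->
  (forall j, complex.Im (iter j (act g) w0) < 0 /\
    ev Q (z0 + (j * l)%:R) (iter j (act g) w0) = 0) ->
  rational_relation Q.
Proof.
move=> irrQ l0 Sg c0 sE s0 mu_small Pw; have dg := SL2Z_det Sg.
pose c : R := (g 1 0)%:~R; pose d : R := (g 1 1)%:~R; pose a : R := (g 0 0)%:~R.
pose b : R := (g 0 1)%:~R.
have cN : c != 0 by rewrite /c intr_eq0.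
have dgR : a * d - b * c = 1 by rewrite -!intrM -intrB dg.
rewrite intrD -/a -/d in sE mu_small.
have fix_phi (r : R) : r ^+ 2 = (a + d) ^+ 2 - 4 ->
    let phi := ((a - d + r) / (2 * c))%:C in
    (g 1 0)%:~R * phi ^+ 2 + ((g 1 1)%:~R - (g 0 0)%:~R) * phi - (g 0 1)%:~R = 0.
  move=> rE; rewrite !intC -/a -/b -/c -/d /=; clearbody a b c d; rewrite -!(rmorphXn, rmorphB, rmorphM, rmorphD) /=.
  have -> : c * ((a - d + r) / (2 * c)) ^+ 2 + (d - a) * ((a - d + r) / (2 * c)) - b =
      (r ^+ 2 - (a + d) ^+ 2 + 4 * (a * d - b * c)) / (4 * c) by field.
  by rewrite rE dgR mulr1 addrAC addrNK subrr mul0r.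
have cphi (r : R) : cden g ((a - d + r) / (2 * c))%:C = ((a + d + r) / 2)%:C.
  rewrite /cden !intC -/c -/d -rmorphM -rmorphD; congr (_%:C); field; exact: cN.
pose p1 := ((a - d + s) / (2 * c)); pose p2 := ((a - d - s) / (2 * c)).
have p12 : p1 - p2 = s / c by rewrite /p1 /p2; field.
have sE' : (- s) ^+ 2 = (a + d) ^+ 2 - 4 by rewrite sqrrN.
have wreal w (r : R) : complex.Im w < 0 -> w - r%:C != 0.
  move=> wneg; apply/eqP => /(congr1 (@complex.Im R)); rewrite ImD ImN /=.
  by rewrite oppr0 addr0 => h; move: wneg; rewrite h ltxx.
pose th := ((a + d - s) / 2) ^+ 2.
have prod4 : (a + d - s) * (a + d + s) = 4 by rewrite -subr_sqr sE opprB addrC subrK.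
have mN : a + d - s != 0.
  by apply: contraTneq isT => h; move/eqP: prod4; rewrite h mul0r eq_sym pnatr_eq0.
have pN : a + d + s != 0.
  by apply: contraTneq isT => h; move/eqP: prod4; rewrite h mulr0 eq_sym pnatr_eq0.
have th0 : 0 < th by rewrite exprn_even_gt0 //= mulf_neq0 // invr_neq0.
have th1 : th < 1 by rewrite /th expr_div_n ltr_pdivrMr ?exprn_gt0 //; lra.
pose ratio w := (w - p1%:C) / (w - p2%:C).
have step w : complex.Im w < 0 -> ratio (act g w) = ratio w * th%:C.
  move=> wneg; have cw : cden g w != 0 by apply: cden_neq0; rewrite // lt_eqF.
  rewrite /ratio (act_fixed_point Sg cw (fix_phi _ sE)).2.
  rewrite (act_fixed_point Sg cw (fix_phi _ sE')).2 -/p1 -/p2 !cphi.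
  have -> : th%:C = ((a + d - s) / 2)%:C / ((a + d + s) / 2)%:C.
    rewrite -fmorph_div; congr (_%:C); rewrite /th.
    have -> : (a + d + s) = 4 / (a + d - s) by rewrite -prod4 mulrAC divff ?mul1r.
    by field.
  have : ((a + d - s) / 2)%:C != 0 by rewrite fmorph_eq0 mulf_neq0 // invr_neq0.
  have : ((a + d + s) / 2)%:C != 0 by rewrite fmorph_eq0 mulf_neq0 // invr_neq0.
  move: (wreal w p1 wneg) (wreal w p2 wneg) cw.
  move: (cden g w) (w - _) (w - _) => x y1 y2 y10 y20 x0.
  by move: (_%:C) (_%:C) => x1 x2 x10 x20; field; rewrite x0 x10 x20 y20.
have ratioE j : ratio (iter j (act g) w0) = ratio w0 * (th ^+ j)%:C.
  elim: j => [|j IH]; first by rewrite expr0 mulr1.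
  by rewrite iterS step ?IH -?mulrA -?rmorphM ?exprSr //; case: (Pw j).
have w0neg : complex.Im w0 < 0 by case: (Pw 0%N).
pose r0 := ratio w0.
(* w |-> (w - p1) / (w - p2) is a real Moebius map with p1 != p2, so a real ratio would make w0
   real. *)
have Imr0 : complex.Im r0 != 0.
  apply/eqP => h; have : r0 = (complex.Re r0)%:C by apply: complex_ext.
  move: (complex.Re r0) => x r0E.
  have : w0 - p1%:C = x%:C * (w0 - p2%:C) by rewrite -r0E divfK // wreal.
  move=> e; have := congr1 (@complex.Im R) e; have := congr1 (@complex.Re R) e.
  rewrite !(ReM, ImM, ReD, ImD, ReN, ImN) /= !oppr0 !addr0 !mul0r addr0 subr0.
  move=> re /esym/eqP; rewrite -subr_eq0 -{2}[complex.Im w0]mul1r -mulrBl mulf_eq0.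
  rewrite (lt_eqF w0neg) orbF subr_eq0 => /eqP x1; move: re; rewrite x1 mul1r.
  move=> /addrI/oppr_inj/eqP; rewrite -subr_eq0 p12 mulf_eq0 invr_eq0.
  by rewrite (negPf s0) (negPf cN).
have r0N : 0 < nm r0 by rewrite nm_gt0; apply: contraNneq Imr0 => ->.
pose B := nm r0 ^+ 2 * `|s / c| / `|complex.Im r0|.
have B0 : 0 <= B by rewrite divr_ge0 ?normr_ge0 // mulr_ge0 ?normr_ge0 ?sqr_ge0.
apply: (relation_of_orbit_limit (z0 := z0) (phi := p1%:C)
  (ws := fun j => iter j (act g) w0) irrQ l0 th0 th1 B0) => j.
  by case: (Pw j).
have [wj _] := Pw j; move: (ratioE j); rewrite -/r0.
move: (iter j _ _) wj => w wneg rE; move: (th ^+ j) (exprn_gt0 j th0) rE => x x0 rE.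
(* (w - p1) (1 - r0 x) = r0 x (p1 - p2), and 1 - r0 x stays away from 0 *)
have e : (w - p1%:C) * (1 - r0 * x%:C) = r0 * x%:C * (s / c)%:C.
  have <- : (p1 - p2)%:C = (s / c)%:C by rewrite p12.
  have : w - p1%:C = r0 * x%:C * (w - p2%:C) by rewrite -rE divfK // wreal.
  rewrite rmorphB /=; move: (p1%:C) (p2%:C) (r0 * _) => u v y h.
  by rewrite mulrBr mulr1 {1}h; ring.
(* Multiplying 1 - r0 x by conj(r0) leaves - Im r0 as imaginary part, whatever the real number x. *)
have low : `|complex.Im r0| <= nm (1 - r0 * x%:C) * nm r0.
  have -> : nm r0 = nm (conjc r0) by rewrite nmJ.
  clear; move: (r0) => r; rewrite -nmM (le_trans _ (nm_Im _)) //.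
  rewrite (_ : complex.Im (_ * _) = - complex.Im r) ?normrN //.
  by rewrite ImM !(ReD, ImD) !(ReN, ImN) !(ReM, ImM) ReJ ImJ /=; ring.
rewrite /B; clearbody r0; have := congr1 nm e; rewrite !nmM !nm_real (gtr0_norm x0) => e'.
rewrite -(ler_pM2r (_ : 0 < `|complex.Im r0|)) ?normr_gt0 //.
have -> : nm r0 ^+ 2 * `|s / c| / `|complex.Im r0| * x * `|complex.Im r0| =
   (nm r0 * x * `|s / c|) * nm r0.
  by field; rewrite normr_eq0.
by rewrite -e' -[leRHS]mulrA ler_wpM2l ?nm_ge0.
Qed.
Theorem relation_of_translates Q beta (l : nat) (g : 'M[int]_2) : irr Q ->
  (0 < l)%N -> SL2Z g -> beta != 0 ->
  (forall z, 0 < complex.Im z -> beta.[z] != 0 ->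
     exists2 w, complex.Im w < 0 & ev Q z w = 0) ->
  infinite_set [set z : C | exists w, [/\ complex.Im w < 0, ev Q z w = 0 &
     ev Q (z + l%:R) (act g w) = 0]] -> rational_relation Q.
Proof.
move=> irrQ l0 Sg b0 fibers inf.
have [z0 [w0 Pw]] := orbit_of_translates irrQ l0 Sg b0 fibers inf.
have Qws j : ev Q (z0 + (j * l)%:R) (iter j (act g) w0) = 0 by case: (Pw j).
have [c0|c0] := eqVneq (g 1 0) 0; first exact: relation_of_orbit_translation Qws.
have [small|big] := leP `|g 0 0 + g 1 1| 1.
  have [k k0 per] := act_periodic Sg (Pw 0%N).1 small.
  exact: relation_of_orbit_periodic k0 per Qws.
have [par|par] := eqVneq `|g 0 0 + g 1 1| 2.
  apply: relation_of_orbit_parabolic Sg c0 _ Pw => //.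
  by rewrite -real_normK ?num_real // par.
have {par} : 3 <= `|g 0 0 + g 1 1| by move: big par; move: `|_ + _| => n; lia.
set t := (_ + _) => t3; pose T : R := t%:~R; pose s0 := Num.sqrt (T ^+ 2 - 4).
have T3 : 3 <= `|T| by rewrite -intr_norm -[3]/(3%:~R) ler_int.
have D0 : 0 < T ^+ 2 - 4.
  by rewrite -real_normK ?num_real // subr_gt0; nra.
have s00 : 0 < s0 by rewrite sqrtr_gt0.
have s0E : s0 ^+ 2 = T ^+ 2 - 4 by rewrite sqr_sqrtr // ltW.
have [T0|T0] := leP 0 T.
  apply: (relation_of_orbit_hyperbolic (s := s0) irrQ l0 Sg c0) Pw => //.
    by rewrite gt_eqF.
  move: T3; rewrite ger0_norm // -/t -/T => T3; nra.
apply: (relation_of_orbit_hyperbolic (s := - s0) irrQ l0 Sg c0) Pw => //.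
- by rewrite sqrrN.
- by rewrite oppr_eq0 gt_eqF.
by move: T3; rewrite ltr0_norm // -/t -/T => T3; nra.
Qed.
End Hyperbolic.

(** * Curves through the graph of conjugation *)

Section ConjugateCurve.
Context {R : realType}.
Local Notation C := R[i].
Implicit Types (z w : C) (p f : {poly C}) (Q : {poly {poly C}}) (Y : set C).

(** A substitute for dimension one: such a set is infinite, stays dense in itself after removal of
    the zeros of a polynomial, and makes a holomorphic function vanishing on it flat at its
    points. *)
Definition dense_in_itself Y := Y !=set0 /\ forall z, Y z -> forall e : R, 0 < e ->
  exists2 z', Y z' & z' != z /\ nm (z' - z) < e.

Lemma dense_in_itself_open Y (U : set C) z0 : dense_in_itself Y ->
  (forall z, Y z -> U z -> exists2 e : R, 0 < e & forall z', nm (z' - z) < e -> U z') ->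
  Y z0 -> U z0 -> dense_in_itself (Y `&` U).
Proof.
move=> [_ dY] oU Yz0 Uz0; split; first by exists z0.
move=> z [Yz Uz] e e0; have [d d0 Hd] := oU z Yz Uz.
have [|z' Yz' [z'z]] := dY z Yz (Num.min d e); first by rewrite lt_min d0.
by rewrite lt_min => /andP[h1 h2]; exists z' => //; split=> //; apply: Hd.
Qed.

Lemma dense_in_itself_infinite Y : dense_in_itself Y -> infinite_set Y.
Proof.
move=> [[z0 Yz0] dY] /finite_seqP[s Ys].
have : forall r : R, 0 < r -> exists2 z', z' \in s & z' != z0 /\ nm (z' - z0) < r.
  move=> r /(dY _ Yz0)[z' Yz' h]; exists z' => //.
  by have : [set` s] z' by rewrite -Ys.
elim: (s) => [|y t IH] h; first by have [? ] := h 1 ltr01.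
apply: IH => r r0; have [yz|yz] := eqVneq y z0.
  have [z' z't h'] := h r r0; exists z' => //; move: z't; rewrite inE => /orP[/eqP e|//].
  by move: h'; rewrite e yz eqxx => -[].
have [|z' z't [h1 h2]] := h (Num.min r (nm (y - z0))); first by rewrite lt_min r0 nm_gt0 subr_eq0.
move: h2; rewrite lt_min => /andP[h2 h3]; exists z' => //.
by move: z't; rewrite inE => /orP[/eqP e|//]; move: h3; rewrite e ltxx.
Qed.

Lemma dense_in_itself_neq0 Y p : dense_in_itself Y -> p != 0 ->
  dense_in_itself (Y `&` [set z | p.[z] != 0]).
Proof.
move=> dY p0; have [z0 [Yz0 pz0]] : exists z, Y z /\ p.[z] != 0.
  apply: contra_notP (dense_in_itself_infinite dY) => h.
  apply: sub_finite_set (finite_roots p0) => z Yz /=.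
  by apply: contra_notP h => /eqP pz; exists z.
apply: dense_in_itself_open dY _ Yz0 pz0 => z _ /= pz.
have /ev_cont_neq0[e e0 He] : ev p%:P z 0 != 0 by rewrite evC.
exists e => // z' z'e; have := He z' 0 z'e; rewrite subrr nm0 => /(_ e0).
by rewrite evC.
Qed.

Lemma dense_in_itself_ev_neq0 Y Q z0 : dense_in_itself Y -> Y z0 ->
  ev Q z0 (conjc z0) != 0 -> dense_in_itself (Y `&` [set z | ev Q z (conjc z) != 0]).
Proof.
move=> dY Yz0 Qz0; apply: dense_in_itself_open dY _ Yz0 Qz0 => z _ Qz.
have [e e0 He] := ev_cont_neq0 Qz; exists e => // z' z'e; apply: He => //.
by rewrite -rmorphB nmJ.
Qed.

(** The equation is asked only on a part Y' of Y, so that the property passes to one of the factors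
    of Q. *)
Definition conj_curve Y Q := Q != 0 /\ exists2 Y', Y' `<=` Y &
  dense_in_itself Y' /\ forall z, Y' z -> ev Q z (conjc z) = 0.

Lemma conj_curve_mul Y G H : G * H != 0 -> conj_curve Y (G * H) ->
  conj_curve Y G \/ conj_curve Y H.
Proof.
rewrite mulf_eq0 negb_or => /andP[G0 H0] [_ [Y' Y'Y [dY' GH]]].
have [[z [Yz Gz]]|h] := pselect (exists z, Y' z /\ ev G z (conjc z) != 0).
  right; split=> //; exists (Y' `&` [set z | ev G z (conjc z) != 0]).
    by move=> x [/Y'Y].
  split; first exact: dense_in_itself_ev_neq0 Gz.
  by move=> x [/GH + Gx]; rewrite evM => /eqP; rewrite mulf_eq0 (negPf Gx) => /eqP.
left; split=> //; exists Y' => //; split=> // z Yz.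
by apply: contra_notP h => /eqP Gz; exists z.
Qed.

Lemma conj_curve_size Y Q : conj_curve Y Q -> (1 < size Q)%N.
Proof.
move=> [Q0 [Y' _ [dY' Q'z]]]; rewrite ltnNge; apply/negP => /size1_polyC QE.
have q0 : Q`_0 != 0 by apply: contraNneq Q0 => q0; rewrite QE q0.
apply: (dense_in_itself_infinite dY'); apply: sub_finite_set (finite_roots q0) => z.
by move=> /Q'z; rewrite {1}QE evC.
Qed.

Lemma conj_curve_swap_size Y Q : conj_curve Y Q -> (1 < size (swapXY Q))%N.
Proof.
move=> [Q0 [Y' _ [dY' Q'z]]]; rewrite ltnNge; apply/negP => /size1_polyC QE.
have q0 : (swapXY Q)`_0 != 0.
  apply: contraNneq Q0 => q0; by rewrite -swapXY_eq0 QE q0.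
apply: (dense_in_itself_infinite dY').
have := finite_image conjc (finite_roots q0); apply: sub_finite_set => z Yz.
exists (conjc z); last by rewrite conjcK.
by have := Q'z z Yz; rewrite -ev_swap {1}QE evC.
Qed.

(** Q has least degree in w, then least degree in z. The first choice gives irreducibility. By the
    second, the z-derivative of Q cannot vanish along the curve, since it would be an equation of
    smaller degree in z and no larger degree in w. *)
Lemma minimal_conj_curve Y Q0 : conj_curve Y Q0 -> exists Q, [/\ conj_curve Y Q,
   irr Q & exists2 p, p != 0 & forall z w, p.[z] != 0 -> ev Q z w = 0 ->
     ev (deriv (swapXY Q)) w z != 0].
Proof.
move=> cQ0; pose P1 n := `[< exists2 Q, conj_curve Y Q & size Q = n >].
have [|n1 /asboolP[Q1 cQ1 sQ1] min1] := @ex_minnP P1.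
  by exists (size Q0); apply/asboolP; exists Q0.
have {}min1 Q : conj_curve Y Q -> (n1 <= size Q)%N.
  by move=> cQ; apply: min1; apply/asboolP; exists Q.
pose P2 n := `[< exists Q, [/\ conj_curve Y Q, size Q = n1 & size (swapXY Q) = n] >].
have [|n2 /asboolP[Q [cQ sQ ssQ]] min2] := @ex_minnP P2.
  by exists (size (swapXY Q1)); apply/asboolP; exists Q1.
have Qn0 : Q != 0 by case: cQ.
have irrQ : irr Q.
  split; first exact: conj_curve_size cQ.
  move=> p G H p0 E sG; rewrite leqNgt; apply/negP => sH.
  have GH0 : G * H != 0 by rewrite -E scale_poly_eq0 negb_or p0.
  have [G0 H0] : G != 0 /\ H != 0 by apply/andP; rewrite -negb_or -mulf_eq0.
  have sGH : (size G + size H = n1.+1)%N.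
    have := size_mul G0 H0; rewrite -E size_scale // sQ => ->.
    by rewrite prednK // addn_gt0 (ltn_trans _ sG).
  have cGH : conj_curve Y (G * H).
    split=> //; case: cQ => _ [Y' Y'Y [dY' Qz]]; exists Y' => //; split=> // z Yz.
    by rewrite -E evZ Qz // mulr0.
  have [cG|cH] := conj_curve_mul GH0 cGH.
    by move: sGH sH (min1 _ cG); lia.
  by move: sGH sG (min1 _ cH); lia.
exists Q; split=> //; pose G := swapXY (deriv (swapXY Q)).
have GE z w : ev G z w = ev (deriv (swapXY Q)) w z by rewrite ev_swap.
pose E := [set z | exists w, ev Q z w = 0 /\ ev G z w = 0].
have [/finite_seqP[s Es]|infE] := pselect (finite_set E).
  exists (\prod_(x <- s) ('X - x%:P)).
    by rewrite monic_neq0 // monic_prod_XsubC.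
  move=> z w pz Qz; apply: contraNneq pz => Gz.
  rewrite -[_ == 0]/(root _ z) root_prod_XsubC.
  have : E z by exists w; rewrite GE.
  by rewrite Es.
have [p p0 Hp] := irr_common irrQ infE.
have ss1 := conj_curve_swap_size cQ.
have G'0 : deriv (swapXY Q) != 0 by apply: deriv_neq0.
have sGG : swapXY G = deriv (swapXY Q) by rewrite /G swapXYK.
have G0 : G != 0 by apply: contraNneq G'0 => G0; rewrite -sGG G0 rmorph0.
have cG : conj_curve Y G.
  split=> //; case: cQ => _ [Y' Y'Y [dY' Qz]].
  exists (Y' `&` [set z | p.[z] != 0]); first by move=> x [/Y'Y].
  split; first exact: dense_in_itself_neq0.
  by move=> z [Yz pz]; apply: Hp => //; apply: Qz.
have sizeG : (size G <= n1)%N.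
  apply/leq_sizeP => i ni; apply/polyP => j.
  rewrite /G coef_swapXY coef_deriv coefMn coef_swapXY [Q`_i]nth_default ?sQ //.
  by rewrite !coef0 mul0rn.
have sGn : size G = n1 by apply/eqP; rewrite eqn_leq sizeG min1.
have := min2 (size (swapXY G)); rewrite sGG => h.
have : (n2 <= size (deriv (swapXY Q)))%N.
  by apply: h; apply/asboolP; exists G; rewrite sGG.
rewrite leqNgt -ssQ lt_size_deriv // -size_poly_gt0 (ltn_trans _ ss1) //.
Qed.

(** Points z of Y near z0 satisfy conj z = S z by uniqueness of the branch, so t |-> V(t, S t) has
    zeros accumulating at z0; it is flat there and vanishes on a disc. *)
Lemma conj_vanishing Q beta V Y z0 : hol_on_arcs V ->
  (forall z w, beta.[z] != 0 -> ev Q z w = 0 -> ev (deriv Q) z w != 0) ->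
  dense_in_itself Y -> Y `<=` @upper_half_plane R ->
  (forall z, Y z -> ev Q z (conjc z) = 0) -> (forall z, Y z -> V z (conjc z) = 0) ->
  Y z0 -> beta.[z0] != 0 -> vanishing Q V z0 (conjc z0).
Proof.
move=> holV QwP [_ dY] YH Qz Vz Yz0 bz0.
have Imz0 : 0 < complex.Im z0 by apply: YH.
have Imw0 : complex.Im (conjc z0) < 0 by rewrite ImJ oppr_lt0.
have [S [r [e [r0 e0 ez HS]]]] := implicit_function Imz0 (Qz _ Yz0) (QwP _ _ bz0 (Qz _ Yz0)).
pose s := Num.min r e / 2; have s0 : 0 < s by rewrite divr_gt0 // lt_min r0.
have [sr se] : s < r /\ s < e.
  have h1 : Num.min r e <= r by rewrite ge_min lexx.
  have h2 : Num.min r e <= e by rewrite ge_min lexx orbT.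
  have : 0 < Num.min r e by rewrite lt_min r0.
  by rewrite /s; split; lra.
have holF z : nm (z - z0) <= s -> hol (fun t => V t (S t)) z.
  move=> zs; have [|Sz _ hS _] := HS z; first exact: le_lt_trans sr.
  apply: holV => //; first exact: hol_id.
    by have := ImB_lt (le_lt_trans zs (lt_le_trans se ez)); lra.
  by have := ImB_lt (lt_le_trans Sz ez); rewrite ImJ; lra.
have z0s : nm (z0 - z0) <= s by rewrite subrr nm0 ltW.
have fF : flat (fun t => V t (S t)) z0.
  have [//|[d [c [u [c0 u0 Hu]]]]] := flat_or_order (holF z0 z0s).
  have [|z Yz [zz0]] := dY z0 Yz0 (Num.min u s); first by rewrite lt_min u0.
  rewrite lt_min => /andP[zu zs].
  have [|_ _ _ uniq] := HS z; first exact: lt_trans sr.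
  have Sz : conjc z = S z.
    by apply: uniq; [rewrite -rmorphB nmJ (lt_trans zs)|exact: Qz].
  have := Hu (z - z0) zu; rewrite /= [z0 + _]addrC subrK -Sz Vz // nm0 leNgt.
  by rewrite mulr_gt0 // exprn_gt0 // nm_gt0 subr_eq0.
split=> //; first exact: Qz.
exists s => // z w zs ws Qzw.
have [|_ _ _ uniq] := HS z; first exact: lt_trans sr.
rewrite (uniq w _ Qzw); last exact: lt_trans se.
exact: (flat_disc holF fF).
Qed.

Theorem cusp_relation N (I : finType) (a b : I -> C -> C) Y Q0 z1 : (0 < N)%N ->
  (forall i, modular N (a i)) -> (forall i, modular N (b i)) ->
  Y `<=` @upper_half_plane R -> conj_curve Y Q0 ->
  (forall z, Y z -> polarized a b z (conjc z) = 0) ->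
  0 < complex.Im z1 -> polarized a b z1 (conjc z1) != 0 ->
  exists2 Y', Y' `<=` Y & dense_in_itself Y' /\
  exists (al be ga ka : C), [/\
    [|| al != 0, be != 0, ga != 0 | ka != 0],
    exists m n : int, ((m != 0) || (n != 0)) /\ al * n%:~R = ga * m%:~R &
    forall z, Y' z -> (ga * z + ka) * conjc z = al * z + be].
Proof.
move=> N0 ma mb YH cQ0 Vz z10 V1.
have w10 : complex.Im (conjc z1) < 0 by rewrite ImJ oppr_lt0.
have [Q [cQ irrQ [p2 p20 Hp2]]] := minimal_conj_curve cQ0.
have [p1 p10 Hp1] := irr_separable irrQ.
have [Qn0 [Y1 Y1Y [dY1 Qz]]] := cQ.
(* The zeros of beta include every z where the degree in w drops, or where Q = 0 has a point at
   which a partial derivative vanishes. *)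
pose beta := lead_coef Q * p1 * p2.
have b0 : beta != 0 by rewrite !mulf_neq0 // lead_coef_eq0.
have bE z : beta.[z] != 0 -> [/\ (lead_coef Q).[z] != 0, p1.[z] != 0 & p2.[z] != 0].
  by rewrite !hornerM !mulf_eq0 !negb_or => /andP[/andP[]].
have lcQ z : beta.[z] != 0 -> (lead_coef Q).[z] != 0 by case/bE.
have QwP z w : beta.[z] != 0 -> ev Q z w = 0 -> ev (deriv Q) z w != 0.
  by case/bE => _ h _; apply: Hp1.
have QzP z w : beta.[z] != 0 -> ev Q z w = 0 -> ev (deriv (swapXY Q)) w z != 0.
  by case/bE => _ _; apply: Hp2.
have holV := polarized_hol_on_arcs ma mb.
have [[z0 [Y1z0 bz0]] _] := dense_in_itself_neq0 dY1 b0.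
have van0 : vanishing Q (polarized a b) z0 (conjc z0).
  apply: (conj_vanishing holV QwP dY1) => // z /Y1Y; [exact: YH|exact: Vz].
have cuspV := polarized_cusp_rigid ma mb z10 w10 V1.
have fibers z : 0 < complex.Im z -> beta.[z] != 0 ->
    exists w, [/\ complex.Im w < 0, ev Q z w = 0 & polarized a b z w = 0].
  move=> Imz bz.
  have [w [_ w0 Qw [e e0 He]]] := vanishing_everywhere lcQ QwP QzP holV cuspV bz0 van0 bz Imz.
  by exists w; split=> //; apply: He; rewrite ?subrr ?nm0.
have [l [g [l0 Sg inf]]] := infinitely_many_translates N0 ma mb fibers b0 z10 w10 V1.
have [|al [be [ga [ka [e [e0 nz mn rel]]]]]] := relation_of_translates irrQ l0 Sg b0 _ inf.
  by move=> z Imz bz; have [w [w0 Qw _]] := fibers z Imz bz; exists w.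
exists (Y1 `&` [set z | e.[z] != 0]); first by move=> z [/Y1Y].
split; first exact: dense_in_itself_neq0.
by exists al, be, ga, ka; split=> // z [Yz ez]; apply: rel => //; apply: Qz.
Qed.

End ConjugateCurve.

(** * Rationality of the circle *)

Section RationalCircle.
Context {R : realType}.
Local Notation C := R[i].
Implicit Types (z w ka : C) (p : {poly C}) (Q : {poly {poly C}}) (Y : set C) (A D : R).

(** Circles and lines as zeros of Hermitian forms; for nonzero A the centre is - ka / A. *)
Definition circ A ka D z : C :=
  A%:C * (z * conjc z) + ka * conjc z + conjc ka * z + D%:C.

Lemma conj_linear_relation Y (k l m : C) : infinite_set Y ->
  (forall z, Y z -> k * conjc z = l * z + m) -> k = 0 -> l = 0 /\ m = 0.
Proof.
move=> infY H k0; have : l *: 'X + m%:P = 0 :> {poly C}.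
  apply: contra_notP infY => /eqP/finite_roots fin; apply: sub_finite_set fin => z Yz /=.
  by rewrite !hornerE -H // k0 mul0r.
move=> /polyP E; split; first by have := E 1%N; rewrite !coefE /= mulr1 addr0.
by have := E 0%N; rewrite !coefE /= mulr0 add0r.
Qed.

(** Eliminating conj z leaves a polynomial in z with infinitely many zeros and leading coefficient A
    l. So l = 0, and a nonzero k would then make conj z constant on Y. *)
Lemma circ_line Y A ka D (k l m : C) : infinite_set Y -> A != 0 ->
  (forall z, Y z -> circ A ka D z = 0) ->
  (forall z, Y z -> k * conjc z = l * z + m) -> [/\ k = 0, l = 0 & m = 0].
Proof.
move=> infY A0 Hc Hl; have [k0|k0] := eqVneq k 0.
  by have [? ?] := conj_linear_relation infY Hl k0.
have AC0 : A%:C != 0 :> C by rewrite fmorph_eq0.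
have : (A%:C * l) *: 'X^2 + (A%:C * m + ka * l + k * conjc ka) *: 'X +
    (ka * m + k * D%:C)%:P = 0 :> {poly C}.
  apply: contra_notP infY => /eqP/finite_roots fin; apply: sub_finite_set fin => z Yz /=.
  rewrite !hornerE /=.
  transitivity (A%:C * (l * z + m) * z + ka * (l * z + m) +
      k * (conjc ka * z + D%:C)); first by ring.
  rewrite -Hl //; have := Hc z Yz; rewrite /circ => h.
  by rewrite -[RHS](mulr0 k) -h; ring.
move=> /polyP E; have := E 2%N; rewrite !coefE /= !(mulr0, addr0, mulr1) => /eqP.
rewrite mulf_eq0 (negPf AC0) /= => /eqP l0; exfalso; apply: infY.
apply: (sub_finite_set (B := [set conjc (m / k)])); last exact: finite_set1.
move=> z /Hl; rewrite l0 mul0r add0r => e /=.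
by rewrite -e mulrAC divff // mul1r conjcK.
Qed.

(** The relation from [cusp_relation] must be proportional to the circle equation solved for conj z,
    by [circ_line]. So al / ga = - conj(ka) / A, the conjugate of the centre, is rational. *)
Lemma cusp_circ N (I : finType) (a b : I -> C -> C) Y A ka D z1 : (0 < N)%N ->
  (forall i, modular N (a i)) -> (forall i, modular N (b i)) ->
  Y `<=` @upper_half_plane R -> dense_in_itself Y ->
  (forall z, Y z -> polarized a b z (conjc z) = 0) ->
  0 < complex.Im z1 -> polarized a b z1 (conjc z1) != 0 ->
  (forall z, Y z -> circ A ka D z = 0) ->
  A = 0 \/ complex.Im ka = 0 /\ exists r : rat, complex.Re ka = ratr r * A.
Proof.
move=> N0 ma mb YH dY Vz z10 V1 Hc; have [->|A0] := eqVneq A 0; [by left|right].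
have AC0 : A%:C != 0 :> C by rewrite fmorph_eq0.
have cY : conj_curve Y (fraction_poly (- conjc ka) (- D%:C) A%:C ka).
  split; last first.
    exists Y => //; split=> // z Yz; rewrite fraction_polyE -(Hc z Yz) /circ.
    by rewrite mulrDl mulNr opprB opprK; ring.
  apply/eqP => h; have := fraction_polyE (- conjc ka) (- D%:C) A%:C ka.
  rewrite h => e; have := e 0 1; have := e 0 0; have := e 1 0; have := e 1 1.
  rewrite !ev0 !(mulr0, mulr1, add0r, sub0r) => e11 e10 e00 e01.
  have D0 : D%:C = 0 :> C by rewrite -[D%:C]opprK -e00.
  have ka0 : ka = 0 by move: e01; rewrite D0 !oppr0 addr0.
  by move/eqP: AC0; apply; move: e11; rewrite ka0 D0 rmorph0 !oppr0 !addr0 oppr0 addr0.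
have [Y' Y'Y [dY' [al [be [ga [k [nz [m [n [mn E]]] rel]]]]]]] :=
  cusp_relation N0 ma mb YH cY Vz z10 V1.
have infY' := dense_in_itself_infinite dY'.
have [||k0 l0 m0] := @circ_line Y' A ka D (A%:C * k - ga * ka)
    (A%:C * al + ga * conjc ka) (A%:C * be + ga * D%:C) infY' A0.
- by move=> z /Y'Y; apply: Hc.
- move=> z Y'z; have := rel z Y'z; have := Hc z (Y'Y z Y'z); rewrite /circ => h1 h2.
  have : A%:C * ((ga * z + k) * conjc z) = A%:C * (al * z + be) + ga *
     (A%:C * (z * conjc z) + ka * conjc z + conjc ka * z + D%:C).
    by rewrite h1 h2 mulr0 addr0.
  by move=> /eqP; rewrite -subr_eq0 => /eqP h; apply/eqP; rewrite -subr_eq0 -h; apply/eqP; ring.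
have A_eq0 (x : C) : A%:C * x = 0 -> x = 0.
  by move=> /eqP; rewrite mulf_eq0 (negPf AC0) => /eqP.
have ga0 : ga != 0.
  apply: contraTneq nz => ga0; move: k0 l0 m0; rewrite ga0 !mul0r subr0 !addr0.
  move=> /A_eq0 -> /A_eq0 -> /A_eq0 ->.
  by rewrite !eqxx.
have E' : conjc ka * n%:~R = - A%:C * m%:~R.
  apply: (mulfI ga0); have -> : ga * (conjc ka * n%:~R) = - A%:C * (al * n%:~R).
    have : ga * conjc ka = - A%:C * al by apply/eqP; rewrite mulNr -addr_eq0 addrC l0.
    by rewrite !mulrA => ->.
  by rewrite E; ring.
have n0 : n != 0.
  apply: contraTneq mn => n0; move: E'; rewrite n0 mulr0 mulNr => /esym/eqP.
  by rewrite oppr_eq0 mulf_eq0 (negPf AC0) intr_eq0 /= => /eqP ->; rewrite eqxx.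
have nR : (n%:~R : R) != 0 by rewrite intr_eq0.
have := congr1 (@complex.Re R) E'; have := congr1 (@complex.Im R) E'.
rewrite !intC -rmorphN -rmorphM !ImM !ReM /= !mulr0 subr0 add0r.
have -> : complex.Im (conjc ka) = - complex.Im ka by case: (ka).
have -> : complex.Re (conjc ka) = complex.Re ka by case: (ka).
move=> /eqP; rewrite mulf_eq0 oppr_eq0 (negPf nR) orbF => /eqP -> Re_ka.
split=> //; exists (- m%:~R / n%:~R).
rewrite fmorph_div /= rmorphN /= !ratr_int; apply: (mulIf nR).
by rewrite Re_ka; field.
Qed.

Lemma dense_in_itself_act Y (g : 'M[int]_2) : SL2Z g -> dense_in_itself Y ->
  Y `<=` @upper_half_plane R ->
  dense_in_itself [set z | 0 < complex.Im z /\ Y (act g z)].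
Proof.
move=> Sg [[z0 Yz0] dY] YH; have Sg' := SL2Z_inv Sg; split.
  have z0H := YH _ Yz0.
  by exists (act (invmx g) z0); split; rewrite ?actKV //; apply: act_H.
move=> z [Imz Ygz] e e0.
have Imgz : 0 < complex.Im (act g z) by apply: act_H.
have [d d0 Hd] := hol_cont (hol_act Sg' (lt0r_neq0 Imgz)) e0.
have [y Yy [yz yd]] := dY _ Ygz d d0; have Imy := YH _ Yy.
exists (act (invmx g) y); first by split; rewrite ?actKV //; apply: act_H.
split; last by have := Hd y yd; rewrite actK.
by apply: contraNneq yz => <-; rewrite actKV.
Qed.

Lemma polarized_act (I : finType) (a b : I -> C -> C) g z : polarized (fun i u => a i (act g u))
  (fun i u => b i (act g u)) z (conjc z) = polarized a b (act g z) (conjc (act g z)).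
Proof. by rewrite /polarized !conjcK. Qed.

(** Carries oo to 0, while [unit_inversion] carries oo to 1. *)
Definition inversion : 'M[int]_2 := mat2 0 (-1) 1 0.
Definition unit_inversion : 'M[int]_2 := mat2 1 (-1) 1 0.

Lemma circ_inversion A ka D z : z != 0 -> circ A ka D (act inversion z) = 0 ->
  circ D (- conjc ka) A z = 0.
Proof.
move=> z0; have zb0 : conjc z != 0 by rewrite fmorph_eq0.
have -> : act inversion z = - z^-1.
  by rewrite actE /cden !mat2E mul0r add0r mul1r addr0 mulN1r.
have h : z * conjc z != 0 by rewrite mulf_neq0.
move=> /(congr1 (fun x => x * (z * conjc z))); rewrite mul0r => <-.
rewrite /circ.
have -> : conjc (- z^-1) = - (conjc z)^-1 by rewrite rmorphN /= fmorphV.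
have -> : conjc (- conjc ka) = - ka by rewrite rmorphN /= conjcK.
by move: (conjc z) zb0 (conjc ka) => w w0 k; field; rewrite z0 w0.
Qed.

(** The new leading coefficient is the value of the form at 1, so it vanishes exactly when the
    circle passes through that cusp. *)
Lemma circ_unit_inversion A ka D z : z != 0 ->
  circ A ka D (act unit_inversion z) = 0 ->
  circ (A + 2 * complex.Re ka + D) (- A%:C - conjc ka) A z = 0.
Proof.
move=> z0; have zb0 : conjc z != 0 by rewrite fmorph_eq0.
have -> : act unit_inversion z = 1 - z^-1.
  by rewrite actE /cden !mat2E mul1r addr0 mulrDl divff // mulN1r.
have h : z * conjc z != 0 by rewrite mulf_neq0.
move=> /(congr1 (fun x => x * (z * conjc z))); rewrite mul0r => <-.
have re : (2 * complex.Re ka)%:C = ka + conjc ka.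
  by apply: complex_ext; rewrite !(ReD, ImD) ?ReJ ?ImJ /=; ring.
rewrite /circ; have -> : (A + 2 * complex.Re ka + D)%:C = A%:C + (ka + conjc ka) + D%:C.
  by rewrite !rmorphD /= re.
have -> : conjc (1 - z^-1) = 1 - (conjc z)^-1 by rewrite rmorphB rmorph1 fmorphV.
have -> : conjc (- A%:C - conjc ka) = - A%:C - ka.
  by apply: complex_ext; rewrite !(ReJ, ImJ, ReD, ImD, ReN, ImN) /=; ring.
move: (conjc z) zb0 (conjc ka) => w w0 k.
by field; rewrite z0 w0.
Qed.

(* The relation transported to the cusps oo, 0 and 1: at each of them, either the
   circle passes through the cusp or its centre is a rational point. *)
Theorem rational_circ N (I : finType) (a b : I -> C -> C) Y A ka D z1 : (0 < N)%N ->
  (forall i, modular N (a i)) -> (forall i, modular N (b i)) ->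
  Y `<=` @upper_half_plane R -> dense_in_itself Y ->
  (forall z, Y z -> polarized a b z (conjc z) = 0) ->
  0 < complex.Im z1 -> polarized a b z1 (conjc z1) != 0 ->
  (forall z, Y z -> circ A ka D z = 0) -> ~ [/\ A = 0, ka = 0 & D = 0] ->
  exists (p q r : rat) (c : R), [/\ c != 0, A = ratr p * c, ka = (ratr q * c)%:C &
    D = ratr r * c].
Proof.
move=> N0 ma mb YH dY Vz z10 V1 Hc nz.
have cusp g A' ka' D' : SL2Z g ->
    (forall z, 0 < complex.Im z -> circ A ka D (act g z) = 0 -> circ A' ka' D' z = 0) ->
    A' = 0 \/ complex.Im ka' = 0 /\ exists r : rat, complex.Re ka' = ratr r * A'.
  move=> Sg Hg; pose Yg := [set z | 0 < complex.Im z /\ Y (act g z)].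
  apply: (@cusp_circ N _ (fun i z => a i (act g z)) (fun i z => b i (act g z)) Yg
    A' ka' D' (act (invmx g) z1)) => //.
  - by move=> i; apply: modular_act.
  - by move=> i; apply: modular_act.
  - by move=> z [].
  - exact: dense_in_itself_act.
  - by move=> z [_ Yz]; rewrite polarized_act Vz.
  - by apply: act_H => //; apply: SL2Z_inv.
  - by rewrite polarized_act actKV.
  by move=> z [Imz Yz]; apply: Hg => //; apply: Hc.
have Im_neq0 z : 0 < complex.Im z -> z != 0.
  by move=> h; apply: contraTneq h => ->; rewrite ltxx.
have c1 := cusp_circ N0 ma mb YH dY Vz z10 V1 Hc.
have c2 := cusp inversion D (- conjc ka) A.
have c3 := cusp unit_inversion (A + 2 * complex.Re ka + D) (- A%:C - conjc ka) A.
have {c2} : D = 0 \/ complex.Im ka = 0 /\ exists r : rat, complex.Re ka = ratr r * D.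
  have [||->|[]] := c2; [by apply: SL2Z_mat2| |by left|].
    by move=> z /Im_neq0 h; apply: circ_inversion.
  rewrite ImN ReN ImJ ReJ opprK => -> [r E]; right; split=> //; exists (- r).
  by rewrite rmorphN mulNr -E opprK.
have {c3} : A + 2 * complex.Re ka + D = 0 \/ complex.Im ka = 0 /\
    exists r : rat, complex.Re ka + A = ratr r * (A + 2 * complex.Re ka + D).
  have [||->|[]] := c3; [by apply: SL2Z_mat2| |by left|].
    by move=> z /Im_neq0 h; apply: circ_unit_inversion.
  have eI : complex.Im (- A%:C - conjc ka) = complex.Im ka.
    by rewrite ImD !ImN ImJ /= oppr0 add0r opprK.
  have eR : complex.Re (- A%:C - conjc ka) = - (A + complex.Re ka).
    by rewrite ReD !ReN ReJ /= opprD.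
  rewrite eI eR => -> [r E]; right; split=> //; exists (- r).
  by rewrite rmorphN mulNr -E opprK addrC.
move=> c3 c2; have [[z0 Yz0] _] := dY.
(* If the form vanishes at all three cusps, it reduces to a multiple of Im ka Im z, and Y lies in
   H. *)
have Imka : complex.Im ka = 0.
  have [A0|[//]] := c1; have [D0|[//]] := c2; have [B0|[//]] := c3.
  have := Hc z0 Yz0; rewrite /circ A0 D0 mul0r add0r addr0 => /(congr1 (@complex.Re R)).
  have {}B0 : complex.Re ka = 0 by move: B0; rewrite A0 D0; lra.
  rewrite ReD !ReM ReJ !ImJ ReJ /= B0 !mul0r !sub0r mulrN mulNr opprK -mulr2n => /eqP.
  by rewrite mulrn_eq0 /= mulf_eq0 (gt_eqF (YH _ Yz0)) orbF => /eqP.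
have rat0 : ratr 0 = 0 :> R by rewrite rmorph0.
have rat1 : ratr 1 = 1 :> R by rewrite rmorph1.
have ratN1 : ratr (-1) = -1 :> R by rewrite rmorphN1.
have kaE : ka = (complex.Re ka)%:C by apply: complex_ext.
move: (complex.Re ka) kaE c1 c2 c3 nz => B -> c1 c2 c3 nz.
have [A0|A0] := eqVneq A 0.
  have [D0|D0] := eqVneq D 0.
    have B0 : B != 0 by apply: contra_notN nz => /eqP ->; rewrite rmorph0.
    by exists 0, 1, 0, B; rewrite rat0 rat1 !mul0r mul1r.
  have [/eqP|[_ [r ->]]] := c2; first by rewrite (negPf D0).
  by exists 0, r, 1, D; rewrite rat0 rat1 mul0r mul1r.
have [/eqP|[_ [r1 BA]]] := c1; first by rewrite (negPf A0).
have [D0|D0] := eqVneq D 0.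
  by exists 1, r1, 0, A; rewrite rat0 rat1 mul0r mul1r BA.
have [/eqP|[_ [r2 BD]]] := c2; first by rewrite (negPf D0).
have [r20|r20] := eqVneq r2 0; last first.
  exists 1, r1, (r1 / r2), A; rewrite rat1 mul1r -BA; split=> //.
  have r2R : ratr r2 != 0 :> R by rewrite fmorph_eq0.
  by apply: (mulfI r2R); rewrite -BD BA fmorph_div mulrA mulrCA divff // mulr1.
(* With centre 0 the cusps oo and 0 say nothing about D / A; the cusp 1 decides. *)
have B0 : B = 0 by rewrite BD r20 rmorph0 mul0r.
have [E|[_ [r3 E]]] := c3.
  exists 1, 0, (-1), A; rewrite B0 ratN1 rat1 rat0 mul1r mul0r mulN1r.
  by split=> //; move: E; rewrite B0; lra.
have E' : A = ratr r3 * (A + D) by move: E; rewrite B0 mulr0 add0r addr0.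
have r3R : ratr r3 != 0 :> R.
  by apply: contraNneq A0 => r30; rewrite E' r30 mul0r.
exists 1, 0, (r3^-1 - 1), A; rewrite B0 rat1 rat0 mul1r mul0r; split=> //.
rewrite [ratr _]rmorphB /= rat1 fmorphV; apply: (mulfI r3R).
by rewrite mulrA mulrBr divff // mulr1 mulrBl mul1r {1}E'; ring.
Qed.
End RationalCircle.

(** * Functions of the surface and the circle equation *)

Section SurfaceFunctions.
Context {R : realType}.
Local Notation C := R[i].
Implicit Types (z w : C) (X Y : set C).

(** Sums of products a conj(b) of modular functions form an algebra, which contains Re f = (f + conj
    f) / 2 and Im f = (f - conj f) / (2 i). *)
Lemma surface_function_polarized N G (u : C -> R) : (0 < N)%N ->
  principal_congruence N `<=` G -> surface_function G u ->
  exists (I : finType) (a b : I -> C -> C), [/\ forall i, modular N (a i),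
    forall i, modular N (b i) &
    forall z, 0 < complex.Im z -> (u z)%:C = polarized a b z (conjc z)].
Proof.
move=> N0 NG; have cst c : modular N (fun=> c : C) by apply: modular_cst.
elim=> {u} [c|f fG|f fG|u v _ [I [a [b [ma mb E]]]] _ [J [a' [b' [ma' mb' E']]]]
  |u v _ [I [a [b [ma mb E]]]] _ [J [a' [b' [ma' mb' E']]]]].
- exists unit, (fun _ _ => c%:C), (fun _ _ => 1); split=> // z _.
  by rewrite /polarized big_const card_unit iterS rmorph1 mulr1 addr0.
- have mf := curve_function_modular NG fG.
  exists bool, (fun i => if i then (fun z => 2^-1 * f z) else fun=> 2^-1),
    (fun i => if i then (fun=> 1) else f); split=> [[|]|[|]|z _] //.
    by apply: modular_mul.
  rewrite [RHS](_ : _ = 2^-1 * f z * conjc 1 + 2^-1 * conjc (f (conjc (conjc z))));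
    last by rewrite /polarized big_bool.
  rewrite rmorph1 conjcK mulr1.
  apply: (mulfI (_ : 2 != 0 :> C)); first by rewrite pnatr_eq0.
  rewrite mulrDr !mulrA divff ?pnatr_eq0 // !mul1r.
  by apply: complex_ext; rewrite mulr_natl !mulr2n !(ReD, ImD) ?ReJ ?ImJ /=; ring.
- have mf := curve_function_modular NG fG; pose k : C := (2 * 'i)^-1.
  have i0 : 2 * 'i != 0 :> C by rewrite mulf_neq0 ?neq0Ci ?pnatr_eq0.
  exists bool, (fun i => if i then (fun z => k * f z) else fun=> - k),
    (fun i => if i then (fun=> 1) else f); split=> [[|]|[|]|z _] //.
    by apply: modular_mul.
  rewrite [RHS](_ : _ = k * f z * conjc 1 + - k * conjc (f (conjc (conjc z))));
    last by rewrite /polarized big_bool.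
  rewrite rmorph1 conjcK mulr1; apply: (mulfI i0).
  rewrite mulrDr mulNr mulrN !mulrA divff // !mul1r.
  apply: complex_ext; rewrite -mulrA mulr_natl !mulr2n !(ReD, ImD, ReN, ImN, ReM, ImM) ?ReJ ?ImJ /=; ring.
- exists (I + J)%type, (fun i => match i with inl i => a i | inr j => a' j end),
    (fun i => match i with inl i => b i | inr j => b' j end).
  split=> [[i|j]|[i|j]|z z0] //; rewrite rmorphD /= E // E' //.
  by rewrite /polarized big_sumType.
exists (I * J)%type, (fun i z => a i.1 z * a' i.2 z), (fun i z => b i.1 z * b' i.2 z).
split=> [i|i|z z0]; [exact: modular_mul|exact: modular_mul|].
rewrite rmorphM /= E // E' // /polarized big_distrlr pair_bigA /=.
by apply: eq_bigr => i _; rewrite rmorphM /=; ring.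
Qed.

Lemma surface_function_invariant G (u : C -> R) g z : surface_function G u ->
  G g -> 0 < complex.Im z -> u (act g z) = u z.
Proof.
move=> Su Gg z0; elim: Su => {u} [//|f [_ fG _]|f [_ fG _]|u v _ -> _ ->|u v _ -> _ ->] //;
by rewrite fG.
Qed.

(** Properness of W gives an orbit off it, hence an equation u of W nonzero at some z1; invariance
    of u carries its vanishing from orbits in W to the points of X. *)
Lemma bialgebraic_surface_function X : weakly_bialgebraic X ->
  exists G u z1, [/\ congruence_subgroup G, surface_function G u, 0 < complex.Im z1,
    u z1 != 0 & forall z, X z -> u z = 0].
Proof.
move=> [[XH _] [G [cG _ [W [[S [Ssurf WE]] [WY YW] XW]] _]]].
have [_ G1 _ _ _] := cG.
have [z1 [z10 [u [Su uz1]]]] : exists z1, 0 < complex.Im z1 /\ exists u, S u /\ u z1 <> 0.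
  apply: contra_notP YW => h _ [z z0 <-]; rewrite WE; exists z => //; split=> // u Su.
  by apply: contra_notP h => uz; exists z; split=> //; exists u.
exists G, u, z1; split=> //; [exact: Ssurf|exact/eqP|].
move=> x Xx; have /XW : (Defs.proj G @` X) (Defs.proj G x) by exists x.
rewrite WE => -[z [z0 zS] zx].
have : Defs.proj G x x by exists 1%:M => //; rewrite act1.
rewrite -zx => -[g Gg <-]; rewrite (surface_function_invariant (Ssurf _ Su)) //.
exact: zS.
Qed.

(** The relation plus its conjugate is a Hermitian equation, and so is i times their difference.
    Both are trivial only if the relation is, so one of them is a genuine circle or line. *)
Theorem conj_curve_circle N (I : finType) (a b : I -> C -> C) Y Q0 z1 : (0 < N)%N ->
  (forall i, modular N (a i)) -> (forall i, modular N (b i)) ->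
  Y `<=` @upper_half_plane R -> conj_curve Y Q0 ->
  (forall z, Y z -> polarized a b z (conjc z) = 0) ->
  0 < complex.Im z1 -> polarized a b z1 (conjc z1) != 0 ->
  exists2 Y', Y' `<=` Y & dense_in_itself Y' /\ exists p q r : rat,
    [|| p != 0, q != 0 | r != 0] /\ forall z, Y' z ->
    ratr p * (complex.Re z ^+ 2 + complex.Im z ^+ 2) + 2 * ratr q * complex.Re z +
    ratr r = 0.
Proof.
move=> N0 ma mb YH cY Vz z10 V1.
have [Y' Y'Y [dY' [al [be [ga [ka [nz _ rel]]]]]]] :=
  cusp_relation N0 ma mb YH cY Vz z10 V1.
exists Y' => //; split=> //.
have rel' z : Y' z -> conjc ga * (z * conjc z) + conjc ka * z - conjc al * conjc z -
    conjc be = 0.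
  move=> /rel /(congr1 (conjc : C -> C)) /eqP; rewrite -subr_eq0 => /eqP h.
  by rewrite -h !rmorphM !rmorphD !rmorphM /= conjcK; ring.
have {}rel z : Y' z -> ga * (z * conjc z) + ka * conjc z - al * z - be = 0.
  by move=> /rel /eqP; rewrite -subr_eq0 => /eqP <-; ring.
have [A [k [D [Hc cnz]]]] : exists A k D, (forall z, Y' z -> circ A k D z = 0) /\
    ~ [/\ A = 0, k = 0 & D = 0].
  have ReE (x : C) : (2 * complex.Re x)%:C = x + conjc x.
    by apply: complex_ext; rewrite !(ReD, ImD) ?ReJ ?ImJ /=; ring.
  have ImE (x : C) : (- (2 * complex.Im x))%:C = 'i%C * (x - conjc x).
    by apply: complex_ext; rewrite !(ReM, ImM, ReD, ImD, ReN, ImN) ?ReJ ?ImJ /=; ring.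
  have [h|h] := pselect ([/\ 2 * complex.Re ga = 0, ka - conjc al = 0 &
      - (2 * complex.Re be) = 0]); last first.
    exists (2 * complex.Re ga), (ka - conjc al), (- (2 * complex.Re be)); split=> // z Yz.
    transitivity ((ga * (z * conjc z) + ka * conjc z - al * z - be) +
      (conjc ga * (z * conjc z) + conjc ka * z - conjc al * conjc z - conjc be)).
      by rewrite /circ [(- _)%:C]rmorphN /= !ReE rmorphB /= conjcK; ring.
    by rewrite rel // rel' // addr0.
  exists (- (2 * complex.Im ga)), ('i%C * (ka + conjc al)), (- - (2 * complex.Im be)).
  split=> [z Yz|[h1 h2 h3]].
    transitivity ('i%C * ((ga * (z * conjc z) + ka * conjc z - al * z - be) -
      (conjc ga * (z * conjc z) + conjc ka * z - conjc al * conjc z - conjc be))).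
      rewrite /circ [(- - _)%:C]rmorphN /= !ImE.
      have -> : conjc ('i%C * (ka + conjc al)) = - 'i%C * (conjc ka + al).
        rewrite rmorphM rmorphD /= conjcK; congr (_ * _).
        by apply: complex_ext; rewrite /= ?oppr0.
      by ring.
    by rewrite rel // rel' // subrr mulr0.
  case: h => a1 a2 a3.
  have ga0 : ga = 0 by apply: complex_ext => /=; [move: a1|move: h1]; lra.
  have be0 : be = 0 by apply: complex_ext => /=; [move: a3|move: h3]; lra.
  have ka0 : ka = 0.
    move/eqP: h2; rewrite mulf_eq0 => /orP[/eqP/(congr1 (@complex.Im R))/= /eqP|].
      by rewrite oner_eq0.
    move=> /eqP h2; have : ka + ka = 0 by rewrite -[RHS](addr0 0) -{1}h2 -a2; ring.
    by move/eqP; rewrite -mulr2n mulrn_eq0 /= => /eqP.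
  have al0 : al = 0.
    by apply/eqP; rewrite -conjc_eq0 -oppr_eq0 -[X in X == _]add0r -{1}ka0 a2.
  by move: nz; rewrite ga0 be0 ka0 al0 eqxx.
have Y'H := subset_trans Y'Y YH.
have Vz' z : Y' z -> polarized a b z (conjc z) = 0 by move/Y'Y; apply: Vz.
have [p [q [r [c [c0 AE kE DE]]]]] := rational_circ N0 ma mb Y'H dY' Vz' z10 V1 Hc cnz.
exists p, q, r; split.
  apply: contra_notT cnz; rewrite !negb_or !negbK => /and3P[/eqP p0 /eqP q0 /eqP r0].
  by rewrite AE kE DE p0 q0 r0 !rmorph0 !mul0r rmorph0.
move=> z Yz; apply: (mulIf c0); rewrite mul0r.
have := congr1 (@complex.Re R) (Hc z Yz).
rewrite /circ AE kE DE !ReD !ReM !ImM ReJ ImJ /= => <-; ring.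
Qed.
End SurfaceFunctions.

(** * Real algebraic curves *)

Section RealCurves.
Context {R : realType}.
Local Notation C := R[i].
Implicit Types (z w : C) (X Y : set C) (P G T : {poly {poly R}}) (p : {poly R}).

Definition pev P z : R := P.[(complex.Im z)%:P].[complex.Re z].

Lemma pevC p z : pev p%:P z = p.[complex.Re z]. Proof. by rewrite /pev hornerC. Qed.
Lemma pevX z : pev 'X z = complex.Im z. Proof. by rewrite /pev hornerX hornerC. Qed.
Lemma pevD P G z : pev (P + G) z = pev P z + pev G z. Proof. by rewrite /pev !hornerD. Qed.
Lemma pevN P z : pev (- P) z = - pev P z. Proof. by rewrite /pev !hornerN. Qed.
Lemma pevM P G z : pev (P * G) z = pev P z * pev G z. Proof. by rewrite /pev !hornerM. Qed.
Lemma pevZ p P z : pev (p *: P) z = p.[complex.Re z] * pev P z.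
Proof. by rewrite /pev hornerZ hornerM. Qed.

Lemma real_finite_roots p : p != 0 -> finite_set [set x | p.[x] = 0].
Proof.
move=> p0; have p0' : map_poly (real_complex R) p != 0 by rewrite map_poly_eq0.
have := finite_image (@complex.Re R) (finite_roots p0').
apply: sub_finite_set => x px; exists x%:C => //=.
by rewrite horner_map px.
Qed.

Definition complexify P : {poly {poly C}} := map_poly (map_poly (real_complex R)) P.

Lemma complexify_neq0 P : P != 0 -> complexify P != 0.
Proof.
apply: contraNneq => h; apply/eqP; apply: (map_inj_poly (f := map_poly (real_complex R))).
- exact/map_inj_poly/rmorph0/fmorph_inj.
- exact: rmorph0.
by rewrite -/(complexify P) h map_poly0.
Qed.

Lemma ev_complexify P z :
  ev (complexify P) (complex.Re z)%:C (complex.Im z)%:C = (pev P z)%:C.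
Proof.
rewrite /ev /complexify -[(complex.Im z)%:C%:P](map_polyC (real_complex R)).
by rewrite horner_map horner_map.
Qed.

Lemma ev_complexify_conj P z w :
  ev (complexify P) (conjc z) (conjc w) = conjc (ev (complexify P) z w).
Proof.
have cp (p : {poly R}) : map_poly conjc (map_poly (real_complex R) p) = map_poly (real_complex R) p.
  by apply/polyP => i; rewrite !coef_map /= oppr0.
elim/poly_ind: P => [|P p IH]; first by rewrite /complexify map_poly0 !ev0 rmorph0.
rewrite /complexify !(rmorphD, rmorphM) /= map_polyX map_polyC -/(complexify P) /=.
rewrite !evMXaddC IH rmorphD rmorphM; congr (_ + _).
by rewrite -[RHS](horner_map conjc) /= cp.
Qed.

(** The complexified equation has a branch y = S(x); for real x, conj(S x) is a root near the same
    point, so uniqueness makes S x real. *)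
Lemma real_branch P z0 (e : R) : 0 < e -> pev P z0 = 0 -> pev (deriv P) z0 != 0 ->
  exists z, [/\ z != z0, nm (z - z0) < e & pev P z = 0].
Proof.
move=> e0 P0 P'0; pose x0 := (complex.Re z0)%:C; pose y0 := (complex.Im z0)%:C.
have e20 : 0 < e / 2 by rewrite divr_gt0.
have PC0 : ev (complexify P) x0 y0 = 0 by rewrite ev_complexify P0.
have PC'0 : ev (deriv (complexify P)) x0 y0 != 0.
  by rewrite /complexify deriv_map -/(complexify _) ev_complexify fmorph_eq0.
have [S [r [d [r0 d0 de HS]]]] := implicit_function e20 PC0 PC'0.
pose t : R := Num.min r (e / 2) / 2; have m0 : 0 < Num.min r (e / 2) by rewrite lt_min r0.
have [tr te t0] : [/\ t < r, t < e / 2 & 0 < t].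
  have h1 : Num.min r (e / 2) <= r by rewrite ge_min lexx.
  have h2 : Num.min r (e / 2) <= e / 2 by rewrite ge_min lexx orbT.
  by rewrite /t; split; lra.
pose x := (complex.Re z0 + t)%:C.
have xx0 : nm (x - x0) = t by rewrite -rmorphB nm_real addrC addKr gtr0_norm.
have [|Sd SP _ uniq] := HS x; first by rewrite xx0.
have Sreal : conjc (S x) = S x.
  apply: uniq.
    have -> : y0 = conjc y0 by rewrite /y0 /= oppr0.
    by rewrite -rmorphB nmJ.
  have {1}-> : x = conjc x by rewrite /x /= oppr0.
  by rewrite ev_complexify_conj SP rmorph0.
have ImS : complex.Im (S x) = 0.
  by have := congr1 (@complex.Im R) Sreal; rewrite ImJ; lra.
have SE : S x = (complex.Re (S x))%:C by apply: complex_ext.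
exists ((complex.Re z0 + t) +i* complex.Re (S x))%C; split.
- apply: contra_ltN t0 => /eqP/(congr1 (@complex.Re R)) /=; lra.
- have -> : ((complex.Re z0 + t) +i* complex.Re (S x))%C - z0 =
      (x - x0) + (0 +i* 1)%C * (S x - y0).
    rewrite SE; apply: complex_ext; rewrite !(ReM, ImM, ReD, ImD, ReN, ImN) /=; ring.
  rewrite (le_lt_trans (nmD _ _)) // nmM xx0.
  have -> : nm (0 +i* 1)%C = 1 :> R by rewrite /nm /= expr0n expr1n add0r sqrtr1.
  by rewrite mul1r; have := lt_le_trans Sd de; lra.
apply/eqP; rewrite -(fmorph_eq0 (real_complex R)) /= -ev_complexify /= -SE; exact/eqP.
Qed.

Lemma ev_eq0 (H : {poly {poly C}}) : (forall z w, ev H z w = 0) -> H = 0.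
Proof.
have no_value (p : {poly C}) : (forall z, p.[z] = 0) -> p = 0.
  move=> p0; apply/eqP; apply: contraT => /horner_lower[c c0 [M HM]].
  have := HM (`|M|)%:C; rewrite nm_real normr_id ler_norm p0 nm0 => /(_ isT).
  by rewrite leNgt c0.
move=> H0; apply/polyP => i; rewrite coef0; apply: (no_value _) => z.
have F0 : fiber H z = 0 by apply: (no_value (fiber H z)) => w; rewrite fiberE.
have : (fiber H z)`_i = 0 by rewrite F0 coef0.
by rewrite /fiber coef_map.
Qed.

(** The change of variables under which w = conj z corresponds to the real points (Re z, Im z). *)
Lemma rotate_coordinates (H : {poly {poly C}}) : exists Q, forall z w,
  ev Q z w = ev H ((z + w) / 2) ((z - w) / (2 * 'i)).
Proof.
have inner (p : {poly C}) : exists Q, forall z w, ev Q z w = p.[(z + w) / 2].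
  elim/poly_ind: p => [|p c [Q HQ]]; first by exists 0 => z w; rewrite ev0 horner0.
  exists (Q * (('X%:P + 'X) * (2^-1)%:P%:P) + c%:P%:P) => z w.
  by rewrite evD !evM evD evX !evC HQ !hornerE.
elim/poly_ind: H => [|H p [Q HQ]]; first by exists 0 => z w; rewrite !ev0.
have [Q' HQ'] := inner p.
exists (Q * (('X%:P - 'X) * ((2 * 'i)^-1)%:P%:P) + Q') => z w.
by rewrite evMXaddC evD !evM evD evN evX !evC HQ HQ' !hornerE.
Qed.

Lemma conj_curve_real P Y : P != 0 -> dense_in_itself Y ->
  (forall z, Y z -> pev P z = 0) -> exists Q, conj_curve Y Q.
Proof.
move=> P0 dY PY; have [Q HQ] := rotate_coordinates (complexify P).
have i2 : 2 * 'i != 0 :> C by rewrite mulf_neq0 ?neq0Ci ?pnatr_eq0.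
exists Q; split.
  apply: contraNneq (complexify_neq0 P0) => Q0; apply/eqP/ev_eq0 => x y.
  have := HQ (x + 'i * y) (x - 'i * y); rewrite Q0 ev0.
  have -> : (x + 'i * y + (x - 'i * y)) / 2 = x by field.
  have -> : (x + 'i * y - (x - 'i * y)) / (2 * 'i) = y.
    by apply: (mulIf i2); rewrite mulfVK //; ring.
  by move=> <-.
exists Y => //; split=> // z Yz; rewrite HQ.
have -> : (z + conjc z) / 2 = (complex.Re z)%:C.
  apply: (mulIf (_ : 2 != 0)); rewrite ?pnatr_eq0 // mulfVK ?pnatr_eq0 //.
  by apply: complex_ext; rewrite mulr_natr mulr2n !(ReD, ImD) ?ReJ ?ImJ /=; ring.
have -> : (z - conjc z) / (2 * 'i) = (complex.Im z)%:C.
  apply: (mulIf i2); rewrite mulfVK // mulrCA mulr_natl mulr2n.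
  by apply: complex_ext; rewrite !(ReM, ImM, ReD, ImD, ReN, ImN) ?ReJ ?ImJ /=; ring.
by rewrite ev_complexify PY.
Qed.
End RealCurves.

(** * Irreducible real curves *)

Section Irreducible.
Context {R : realType}.
Local Notation C := R[i].
Implicit Types (z w : C) (X Y : set C) (P G T : {poly {poly R}}) (p : {poly R}).

Definition vanishes P X := forall z, X z -> pev P z = 0.

Lemma plane_algebraic_inter X P : plane_algebraic X ->
  plane_algebraic (X `&` [set z | pev P z = 0]).
Proof.
move=> [S ->]; exists (S `|` [set P]); apply/seteqP; split=> z /=.
  by move=> [[z0 Sz] Pz]; split=> // G [/Sz//|->].
by move=> [z0 Sz]; split; [split=> // G SG; apply: Sz; left|apply: Sz; right].
Qed.

Lemma vanishes_prime X P G : plane_algebraic X -> plane_irreducible X ->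
  vanishes (P * G) X -> vanishes P X \/ vanishes G X.
Proof.
move=> aX [_ irrX] PG; have [hP|hP] := pselect (vanishes P X); [by left|right].
have proper (F : {poly {poly R}}) : ~ vanishes F X -> X `&` [set z | pev F z = 0] `<` X.
  move=> hF; split; first by move=> z [].
  by move=> h; apply: hF => z /h[].
apply: contra_notP irrX => hG; exists (X `&` [set z | pev P z = 0]),
  (X `&` [set z | pev G z = 0]); split; [exact: plane_algebraic_inter..| | |].
- apply/seteqP; split=> [z Xz|z [[]|[]]//]; have := PG z Xz.
  by rewrite pevM => /eqP; rewrite mulf_eq0 => /orP[] /eqP ?; [left|right].
- exact: proper.
exact: proper.
Qed.

Lemma vanishes_prod (T : eqType) X (s : seq T) (F : T -> {poly {poly R}}) :
  plane_algebraic X -> plane_irreducible X -> vanishes (\prod_(i <- s) F i) X ->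
  exists2 i, i \in s & vanishes (F i) X.
Proof.
move=> aX iX; elim: s => [|i s IH].
  rewrite big_nil; have [[z Xz] _] := iX => /(_ z Xz).
  by rewrite pevC hornerC => /eqP; rewrite oner_eq0.
rewrite big_cons => /(vanishes_prime aX iX)[h|/IH[j js h]].
  by exists i => //; rewrite mem_head.
by exists j => //; rewrite inE js orbT.
Qed.

Lemma finite_irreducible_point X : plane_algebraic X -> plane_irreducible X ->
  finite_set X -> exists z, X = [set z].
Proof.
move=> aX iX /finite_seqP[s Xs]; have [[z Xz] _] := iX.
have [|a _ Xa] := vanishes_prod (s := s) (F := fun u => ('X - (complex.Re u)%:P)%:P) aX iX.
  move=> u; rewrite Xs /= => us; rewrite (big_rem u us) /= pevM pevC !hornerE subrr.
  by rewrite mul0r.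
have [|b _ Xb] := vanishes_prod (s := s) (F := fun u => 'X - (complex.Im u)%:P%:P) aX iX.
  move=> u; rewrite Xs /= => us; rewrite (big_rem u us) /= pevM pevD pevN pevX pevC.
  by rewrite hornerC subrr mul0r.
have XE u : X u -> u = (complex.Re a +i* complex.Im b)%C.
  move=> Xu; apply: complex_ext => /=; apply/eqP; rewrite -subr_eq0.
    by have := Xa u Xu; rewrite pevC !hornerE => ->.
  by have := Xb u Xu; rewrite pevD pevN pevX pevC hornerC => ->.
exists z; apply/seteqP; split=> [u Xu|u ->//] /=; by rewrite (XE u) // [in RHS](XE z).
Qed.

Lemma large_nonroot p : p != 0 -> exists M, forall x, M <= x -> p.[x] != 0.
Proof.
rewrite -(map_poly_eq0 (real_complex R)) => /horner_lower[c c0 [M HM]].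
exists M => x Mx; have := HM x%:C; rewrite nm_real => /(_ (le_trans Mx (ler_norm x))).
by apply: contraTneq => px; rewrite horner_map px nm0 -ltNge.
Qed.

Definition circle_poly (q s : R) : {poly {poly R}} :=
  'X^2 + (('X + q%:P) ^+ 2 - s%:P)%:P.

Lemma pev_circle_poly q s z : pev (circle_poly q s) z =
  complex.Im z ^+ 2 + (complex.Re z + q) ^+ 2 - s.
Proof. by rewrite /circle_poly pevD !expr2 pevM pevX pevC !hornerE /=; ring. Qed.

Lemma size_circle_poly q s : size (circle_poly q s) = 3%N.
Proof. by rewrite size_polyDl size_polyXn // (leq_ltn_trans (size_polyC_leq1 _)). Qed.

Lemma circle_poly_monic q s : circle_poly q s \is monic.
Proof.
rewrite monicE lead_coefDl ?lead_coefXn // size_polyXn.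
by rewrite (leq_ltn_trans (size_polyC_leq1 _)).
Qed.

(** Divide G by the monic T = y^2 + t(x), with remainder r1 y + r0. On Y this gives r0^2 + r1^2 t =
    0, and y > 0 is determined by x, so the identity holds at infinitely many x and hence in R[x].
    For large x, t is positive, so r1 = 0 and then r0 = 0. *)
Lemma circle_poly_divides (q s : R) Y G : infinite_set Y ->
  Y `<=` @upper_half_plane R -> vanishes (circle_poly q s) Y -> vanishes G Y ->
  exists B, G = B * circle_poly q s.
Proof.
move=> infY YH TY GY; pose t : {poly R} := ('X + q%:P) ^+ 2 - s%:P.
have sT := size_circle_poly q s; have mT := circle_poly_monic q s.
have E := Pdiv.RingMonic.rdivp_eq mT G; set B := Pdiv.Ring.rdivp _ _ in E.
set R1 := Pdiv.Ring.rmodp _ _ in E; exists B.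
have sR1 : (size R1 <= 2)%N.
  by rewrite -ltnS -sT Pdiv.Ring.ltn_rmodpN0 // monic_neq0.
have R1E : R1 = R1`_1 *: 'X + (R1`_0)%:P.
  apply/polyP => i; rewrite coefD coefZ coefX coefC.
  case: i => [|[|i]] /=; rewrite ?mulr0 ?mulr1 ?add0r ?addr0 //.
  by rewrite nth_default // (leq_trans sR1).
move: (R1`_1) (R1`_0) R1E => r1 r0 R1E.
have rel z : Y z -> complex.Im z = Num.sqrt (- t.[complex.Re z]) /\
    r0.[complex.Re z] ^+ 2 + r1.[complex.Re z] ^+ 2 * t.[complex.Re z] = 0.
  move=> Yz; have y2 : complex.Im z ^+ 2 = - t.[complex.Re z].
    have := TY z Yz; rewrite pev_circle_poly /t !hornerE; lra.
  split; first by rewrite -y2 sqrtr_sqr gtr0_norm //; apply: YH.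
  have := GY z Yz; rewrite E pevD pevM TY // mulr0 add0r R1E pevD pevZ pevX pevC => h.
  have -> : r0.[complex.Re z] = - (r1.[complex.Re z] * complex.Im z) by lra.
  by rewrite sqrrN exprMn y2 -mulrDr addNr mulr0.
have key : r0 ^+ 2 + r1 ^+ 2 * t = 0.
  apply: contra_notP infY => /eqP/real_finite_roots fin.
  have := finite_image (fun x => (x +i* Num.sqrt (- t.[x]))%C) fin.
  apply: sub_finite_set => z Yz; have [y e] := rel z Yz.
  exists (complex.Re z) => /=; first by rewrite hornerD horner_exp hornerM horner_exp.
  by rewrite -y; case: (z).
have r10 : r1 = 0.
  apply/eqP; apply: contraT => /large_nonroot[M HM].
  pose x := Num.max M (`|q| + `|s| + 1).
  have xM : M <= x by rewrite le_max lexx.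
  have xq : `|q| + `|s| + 1 <= x by rewrite le_max lexx orbT.
  have tx : 0 < t.[x].
    have q1 := ler_norm (- q); have s1 := ler_norm s; rewrite normrN in q1.
    rewrite /t !hornerE; have s0 := normr_ge0 s; nra.
  have : 0 < r1.[x] ^+ 2 * t.[x] by rewrite mulr_gt0 // exprn_even_gt0 ?HM.
  have : (r0 ^+ 2 + r1 ^+ 2 * t).[x] = 0 by rewrite key horner0.
  rewrite hornerD horner_exp hornerM horner_exp => e; have := sqr_ge0 r0.[x]; lra.
move: key; rewrite r10 expr0n /= mul0r addr0 => /eqP; rewrite expf_eq0 /= => /eqP r00.
by rewrite E R1E r10 r00 scale0r add0r addr0.
Qed.

Lemma minimal_equation X : plane_algebraic X -> X `<` @upper_half_plane R ->
  exists P, [/\ P != 0, vanishes P X &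
    forall G, vanishes G X -> (size G < size P)%N -> G = 0].
Proof.
move=> [S ->] [_ nsub].
have [P0 [P0n VP0]] : exists P, P != 0 /\ vanishes P (plane_zeros S).
  apply: contra_notP nsub => h z z0; split=> // P SP.
  have [->|Pn] := eqVneq P 0; first by rewrite !horner0.
  by case: h; exists P; split=> // u [_ /(_ P SP)].
pose D n := `[< exists P, [/\ P != 0, vanishes P (plane_zeros S) & size P = n] >].
have [|n /asboolP[P [Pn VP sP]] minP] := @ex_minnP D.
  by exists (size P0); apply/asboolP; exists P0.
exists P; split=> // G VG sG; apply/eqP; apply: contraT => Gn.
have := minP (size G); rewrite leqNgt -sP sG => h.
by apply: h; apply/asboolP; exists G.
Qed.

(** P depends on x alone, so irreducibility leaves one linear factor x - a. On that line every
    equation of X is a polynomial in y with infinitely many zeros, so X is the whole half-line. *)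
Lemma vertical_line X P : plane_algebraic X -> plane_irreducible X ->
  infinite_set X -> P != 0 -> vanishes P X -> (size P <= 1)%N ->
  exists a, X = [set z | 0 < complex.Im z /\ complex.Re z = a].
Proof.
move=> aX iX infX Pn VP /size1_polyC PE.
have p0 : P`_0 != 0 by apply: contraNneq Pn => p0; rewrite PE p0.
have /finite_seqP[s rs] := real_finite_roots p0.
have [|a _ Xa] := vanishes_prod (s := s) (F := fun c => ('X - c%:P)%:P) aX iX.
  move=> z Xz; have : [set` s] (complex.Re z) by rewrite -rs /= -pevC -PE VP.
  move=> /= us; rewrite (big_rem _ us) /= pevM pevC !hornerE subrr.
  by rewrite mul0r.
have XE z : X z -> complex.Re z = a.
  by move=> /Xa; rewrite pevC !hornerE => /eqP; rewrite subr_eq0 => /eqP.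
exists a; have [S XS] := aX; apply/seteqP; split=> z.
  by move=> Xz; split; [move: Xz; rewrite XS => -[]|exact: XE].
move=> [z0 za]; rewrite XS; split=> // G SG.
pose g := map_poly (horner_eval a) G.
have gE y : g.[y] = G.[y%:P].[a].
  by rewrite -[y in LHS](hornerC y a) /g (horner_map (horner_eval a)).
rewrite za -gE; have [->|gn] := eqVneq g 0; first by rewrite horner0.
case: infX; have := finite_image (fun y => (a +i* y)%C) (real_finite_roots gn).
apply: sub_finite_set => u Xu; exists (complex.Im u) => /=.
  by rewrite gE -(XE u) //; move: Xu; rewrite XS => -[_ /(_ G SG)].
by rewrite -(XE u Xu); case: (u).
Qed.

(** Minimality keeps the y-derivative and the leading coefficient of P from vanishing on X, hence
    also their product. Near a point where both are nonzero, X is all of P = 0, and [real_branch]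
    provides further points. *)
Lemma smooth_part X P : plane_algebraic X -> plane_irreducible X ->
  X `<=` @upper_half_plane R -> vanishes P X -> (1 < size P)%N ->
  (forall G, vanishes G X -> (size G < size P)%N -> G = 0) ->
  exists Y, [/\ Y `<=` X, dense_in_itself Y &
    forall z, Y z -> (lead_coef P).[complex.Re z] != 0].
Proof.
move=> aX iX XH VP sP minP.
have Pn : P != 0 by rewrite -size_poly_gt0 ltnW.
have lP : lead_coef P != 0 by rewrite lead_coef_eq0.
pose good := [set z | pev (deriv P) z != 0 /\ (lead_coef P).[complex.Re z] != 0].
have P'n : deriv P != 0.
  apply: contraTneq sP => P'0; rewrite -leqNgt.
  have := congr1 (fun G : {poly {poly R}} => G`_(size P).-2) P'0.
  rewrite coef_deriv coef0; move: lP; rewrite lead_coefE.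
  case: (size P) => [|[|n]] //= ln /eqP; rewrite -mulr_natr mulf_eq0 (negPf ln) /=.
  by rewrite -polyC_natr polyC_eq0 pnatr_eq0.
have [z0 [Xz0 gz0]] : exists z, X z /\ good z.
  apply: contrapT => h; move/negP: (lP); apply; rewrite -polyC_eq0.
  have : vanishes (deriv P * (lead_coef P)%:P) X.
    move=> z Xz; rewrite pevM pevC; apply/eqP; rewrite mulf_eq0.
    by apply: contra_notT h; rewrite negb_or => /andP[? ?]; exists z.
  case/(vanishes_prime aX iX) => V.
    by move: P'n; rewrite (minP _ V) ?eqxx // lt_size_deriv.
  apply/eqP/minP => //.
  by rewrite (leq_ltn_trans (size_polyC_leq1 _)).
pose Y := [set z | 0 < complex.Im z /\ pev P z = 0] `&` good.
have YX : Y `<=` X.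
  move=> z [[Imz Pz] [_ lz]]; have [S XS] := aX; rewrite XS; split=> // G SG.
  (* Pseudo-division multiplies G by a power of the leading coefficient, which is why its zeros are
     left out; the remainder vanishes on X and is 0 by minimality. *)
  have E := Pdiv.Idomain.divp_eq G P.
  have VG : vanishes G X by move=> u; rewrite XS => -[_ /(_ G SG)].
  have R0 : G %% P = 0.
    apply: minP; last by rewrite ltn_modp.
    move=> u Xu; have := congr1 (pev ^~ u) E.
    by rewrite /= pevZ pevD pevM VG // VP // !mulr0 add0r.
  have := congr1 (pev ^~ z) E; rewrite /= R0 addr0 pevZ pevM Pz mulr0 => /eqP.
  by rewrite mulf_eq0 horner_exp expf_eq0 (negPf lz) andbF => /eqP.
exists Y; split=> //; last by move=> z [_ []].
pose U (z : C) := [&& 0 < complex.Im z, pev (deriv P) z != 0 &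
  (lead_coef P).[complex.Re z] != 0].
have oU z : U z -> exists2 e : R, 0 < e & forall z', nm (z' - z) < e -> U z'.
  case/and3P => Imz P'z lz.
  have near (F : {poly {poly R}}) : pev F z != 0 -> exists2 e : R, 0 < e & forall z',
      nm (z' - z) < e -> pev F z' != 0.
    rewrite -(fmorph_eq0 (real_complex R)) /= -ev_complexify.
    move=> /ev_cont_neq0[e e0 He]; exists e => // z' z'e.
    rewrite -(fmorph_eq0 (real_complex R)) /= -ev_complexify He //.
      by rewrite -rmorphB nm_real -ReN -ReD (le_lt_trans (nm_Re _)).
    by rewrite -rmorphB nm_real -ImN -ImD (le_lt_trans (nm_Im _)).
  have [e1 e10 H1] := near _ P'z.
  have [|e2 e20 H2] := near (lead_coef P)%:P; first by rewrite pevC.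
  exists (Num.min (complex.Im z) (Num.min e1 e2)); first by rewrite !lt_min Imz e10.
  move=> z'; rewrite !lt_min => /and3P[h0 h1 h2]; rewrite /U H1 //= -pevC H2 // andbT.
  by have := ImB_lt h0; lra.
have YU z : Y z -> U z by move=> [[? _] [? ?]]; apply/and3P.
split; first by exists z0; split=> //; split; [exact: XH|exact: VP].
move=> z Yz e e0; have [d d0 Hd] := oU z (YU z Yz).
have [[Imz Pz] [P'z lz]] := Yz.
have [|z' [z'z z'd Pz']] := @real_branch R P z (Num.min d e) _ Pz P'z.
  by rewrite lt_min d0.
move: z'd; rewrite lt_min => /andP[z'd z'e]; exists z' => //.
by have /and3P[? ? ?] := Hd z' z'd; split.
Qed.

End Irreducible.

(** * Bialgebraic sets are points or rational circles *)

Section Bialgebraic.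
Context {R : realType}.
Local Notation C := R[i].
Implicit Types (z w : C) (X Y : set C).

Definition rational_circle (p q r : rat) : set C := [set z | 0 < complex.Im z /\
  ratr p * (complex.Re z ^+ 2 + complex.Im z ^+ 2) + 2 * ratr q * complex.Re z +
  ratr r = 0].

Lemma vertical_dense (a : R) :
  dense_in_itself [set z : C | 0 < complex.Im z /\ complex.Re z = a].
Proof.
split; first by exists (a +i* 1)%C => /=; split.
move=> z [z0 za] e e0; exists (a +i* (complex.Im z + e / 2))%C => /=.
  by split=> //; rewrite addr_gt0 // divr_gt0.
split.
  apply/eqP => /(congr1 (@complex.Im R)) /= h; lra.
have -> : (a +i* (complex.Im z + e / 2))%C - z = (0 +i* 1)%C * (e / 2)%:C.
  by apply: complex_ext; rewrite !(ReM, ImM, ReD, ImD, ReN, ImN) /= ?za; ring.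
have -> : nm ((0 +i* 1)%C * (e / 2)%:C : C) = e / 2.
  rewrite nmM nm_real gtr0_norm ?divr_gt0 //.
  by rewrite /nm /= expr0n expr1n add0r sqrtr1 mul1r.
lra.
Qed.

Lemma rational_relation_on_curve X P Y : weakly_bialgebraic X -> Y `<=` X ->
  dense_in_itself Y -> P != 0 -> vanishes P Y ->
  exists2 Y', Y' `<=` Y & dense_in_itself Y' /\ exists p q r : rat,
    [|| p != 0, q != 0 | r != 0] /\ Y' `<=` rational_circle p q r.
Proof.
move=> bX YX dY Pn VP; have [[XH _] _] := bX; have YH := subset_trans YX XH.
have [G [u [z1 [[_ _ _ _ [N N0 NG]] Su z10 uz1 uX]]]] := bialgebraic_surface_function bX.
have [I [a [b [ma mb uE]]]] := surface_function_polarized N0 NG Su.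
have [Q cQ] := conj_curve_real Pn dY VP.
have [||Y' Y'Y [dY' [p [q [r [nz rel]]]]]] := conj_curve_circle N0 ma mb YH cQ _ z10 _.
- by move=> z Yz; rewrite -uE; [rewrite (uX _ (YX z Yz))|exact: YH].
- by rewrite -uE // fmorph_eq0.
exists Y' => //; split=> //; exists p, q, r; split=> // z Yz; split; last exact: rel.
exact/YH/Y'Y.
Qed.

Theorem bialgebraic_circle X : weakly_bialgebraic X -> (exists z, X = [set z]) \/
  exists p q r : rat, [/\ (p != 0) || (q != 0), X !=set0 & X = rational_circle p q r].
Proof.
move=> bX; have [pX [Gam [_ aX _ iX]]] := bX; have [XH _] := pX.
have [finX|infX] := pselect (finite_set X).
  by left; apply: finite_irreducible_point.
right; have [X0 _] := iX; have [P [Pn VP minP]] := minimal_equation aX pX.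
have q_neq0 (p q r : rat) Y z : p = 0 -> Y `<=` rational_circle p q r -> Y z ->
    [|| p != 0, q != 0 | r != 0] -> q != 0.
  move=> p0 Yc Yz; rewrite p0 eqxx /=; apply: contraTneq => q0; rewrite q0 eqxx /=.
  have [_] := Yc z Yz; rewrite p0 q0 !rmorph0 mulr0 !mul0r !add0r => /eqP.
  by rewrite fmorph_eq0 negbK.
have [sP|sP] := leqP (size P) 1.
  have [a XE] := vertical_line aX iX infX Pn VP sP.
  have dX : dense_in_itself X by rewrite XE; apply: vertical_dense.
  have [Y' Y'X [dY' [p [q [r [nz Yc]]]]]] :=
    rational_relation_on_curve bX (@subset_refl _ X) dX Pn VP.
  have Ya z : Y' z -> 0 < complex.Im z /\ complex.Re z = a by move=> /Y'X; rewrite XE.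
  have [[z0 Yz0] _] := dY'.
  (* For nonzero p the equation determines Im z^2 from Re z = a, leaving a single point of H. *)
  have p0 : p = 0.
    apply/eqP; apply: contraT => pn; have pR : ratr p != 0 :> R by rewrite fmorph_eq0.
    case: (dense_in_itself_infinite dY').
    apply: (sub_finite_set (B := [set z0])); last exact: finite_set1.
    move=> z Yz /=; have [y0 xa] := Ya z Yz; have [y00 x0a] := Ya z0 Yz0.
    apply: complex_ext; first by rewrite xa.
    apply/eqP; rewrite -(@eqrXn2 _ 2) ?ltW //; apply/eqP/(mulfI pR).
    by have [_] := Yc z Yz; have [_] := Yc z0 Yz0; rewrite xa x0a; lra.
  have qn := q_neq0 _ _ _ _ _ p0 Yc Yz0 nz.
  have qR : ratr q != 0 :> R by rewrite fmorph_eq0.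
  have [_] := Yc z0 Yz0; have [_ ->] := Ya z0 Yz0; rewrite p0 rmorph0 mul0r add0r => qa.
  exists 0, q, r; split=> //.
  rewrite {1}XE; apply/seteqP; split=> z [z0' h]; split=> //.
    by rewrite rmorph0 mul0r add0r h.
  move: h; rewrite rmorph0 mul0r add0r => h; apply: (mulfI qR); lra.
have [Y [YX dY lY]] := smooth_part aX iX XH VP sP minP.
have VPY : vanishes P Y by move=> z /YX; apply: VP.
have [Y' Y'Y [dY' [p [q [r [nz Yc]]]]]] := rational_relation_on_curve bX YX dY Pn VPY.
have [[z0 Yz0] _] := dY'; have infY := dense_in_itself_infinite dY'.
have Y'X := subset_trans Y'Y YX.
have pn : p != 0.
  (* With p = 0, Y' would lie on a vertical line; P restricted to it would be zero, against the
     choice of Y off the zeros of the leading coefficient. *)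
  apply/eqP => p0; have qn := q_neq0 _ _ _ _ _ p0 Yc Yz0 nz.
  have qR : ratr q != 0 :> R by rewrite fmorph_eq0.
  have Re_eq z : Y' z -> complex.Re z = complex.Re z0.
    move=> Yz; have [_] := Yc z Yz; have [_] := Yc z0 Yz0.
    rewrite p0 rmorph0 !mul0r !add0r => h1 h2; apply: (mulfI qR); lra.
  pose f := map_poly (horner_eval (complex.Re z0)) P.
  have fE z : Y' z -> f.[complex.Im z] = 0.
    move=> Yz; rewrite -[complex.Im z](hornerC _ (complex.Re z0)) /f.
    rewrite (horner_map (horner_eval _)) /= /horner_eval -(Re_eq z Yz).
    exact: VPY (Y'Y _ Yz).
  have f0 : f = 0.
    apply: contra_notP infY => /eqP/real_finite_roots fin.
    have := finite_image (fun y => (complex.Re z0 +i* y)%C) fin.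
    apply: sub_finite_set => z Yz; exists (complex.Im z); first exact: fE.
    by rewrite -(Re_eq z Yz); case: (z).
  have /eqP[] := lY z0 (Y'Y _ Yz0); have : f`_(size P).-1 = 0 by rewrite f0 coef0.
  by rewrite /f coef_map /= /horner_eval -lead_coefE.
have pR : ratr p != 0 :> R by rewrite fmorph_eq0.
pose q' : R := ratr q / ratr p; pose s : R := q' ^+ 2 - ratr r / ratr p.
have circE z : ratr p * (complex.Re z ^+ 2 + complex.Im z ^+ 2) +
    2 * ratr q * complex.Re z + ratr r = ratr p * pev (circle_poly q' s) z.
  rewrite pev_circle_poly /s /q'; field; exact: pR.
have VY : vanishes (circle_poly q' s) Y'.
  by move=> z /Yc[_]; rewrite circE => /eqP; rewrite mulf_eq0 (negPf pR) => /eqP.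
have Y'H := subset_trans Y'X XH.
have div G : vanishes G X -> exists B, G = B * circle_poly q' s.
  move=> VG; apply: (circle_poly_divides infY Y'H VY) => z /Y'X; exact: VG.
exists p, q, r; split=> //; first by rewrite pn.
have [S XS] := aX; apply/seteqP; split=> z; last first.
  move=> [z0'] /eqP; rewrite circE mulf_eq0 (negPf pR) /= => /eqP Tz.
  rewrite XS; split=> // G SG.
  have [|B GE] := div G; first by move=> u; rewrite XS => -[_ /(_ G SG)].
  by rewrite -/(pev G z) GE pevM Tz mulr0.
move=> Xz; split; first exact: XH.
rewrite circE; suff -> : pev (circle_poly q' s) z = 0 by rewrite mulr0.
have [B PE] := div P VP.
(* The cofactor B has degree in y smaller by two than P, so minimality forbids it to vanish on X. *)
have [VB|] : vanishes B X \/ vanishes (circle_poly q' s) X.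
  by apply: vanishes_prime => // u Xu; rewrite -PE VP.
  have Bn : B != 0 by apply: contraNneq Pn => B0; rewrite PE B0 mul0r.
  case/eqP: (Bn); apply: (minP _) => //.
  rewrite PE size_Mmonic ?circle_poly_monic // size_circle_poly addn3 /=.
  by rewrite ltnS leqnSn.
exact.
Qed.
End Bialgebraic.

(** * Special geodesics *)

Section QuadraticAlgebra.
Variables (E : comUnitAlgType rat) (al be : E -> rat) (th : E) (D : rat).
Hypothesis coordE : forall u, u = al u *: 1 + be u *: th.
Hypothesis al_coord : forall a b, al (a *: 1 + b *: th) = a.
Hypothesis be_coord : forall a b, be (a *: 1 + b *: th) = b.
Hypothesis thD : th * th = D *: 1.

Let linE c u v : c *: u + v =
  (c * al u + al v) *: 1 + (c * be u + be v) *: th.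
Proof.
rewrite {1}(coordE u) {1}(coordE v) scalerDr !scalerA !scalerDl.
by rewrite addrACA.
Qed.

Let mulE u v : u * v =
  (al u * al v + D * (be u * be v)) *: 1 + (al u * be v + be u * al v) *: th.
Proof.
rewrite {1}(coordE u) {1}(coordE v) mulrDl !mulrDr -!scalerAl !mul1r -!scalerAr.
rewrite mulr1 thD !scalerA !scalerDl [D * _]mulrC -!addrA; congr (_ + _).
by rewrite addrA addrC.
Qed.

Lemma quadratic_linear c u v : al (c *: u + v) = c * al u + al v /\
  be (c *: u + v) = c * be u + be v.
Proof. by rewrite linE al_coord be_coord. Qed.

Lemma quadratic_mul u v : al (u * v) = al u * al v + D * (be u * be v) /\
  be (u * v) = al u * be v + be u * al v.
Proof. by rewrite mulE al_coord be_coord. Qed.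

Lemma quadratic_1 : al 1 = 1 /\ be 1 = 0.
Proof.
have -> : (1 : E) = 1 *: 1 + 0 *: th by rewrite scale1r scale0r addr0.
by rewrite al_coord be_coord.
Qed.

Lemma quadratic_gen : al th = 0 /\ be th = 1.
Proof.
have -> : th = 0 *: 1 + 1 *: th by rewrite scale1r scale0r add0r.
by rewrite al_coord be_coord.
Qed.

(** Both sides have a basis element of square D over 1, so th |-> M respects products; Q x Q and
    quadratic fields are treated at once. *)
Lemma quadratic_embedding (M : 'M[rat]_2) : M * M = D *: 1 ->
  exists iota : {lrmorphism E -> 'M[rat]_2}, forall u, iota u = al u *: 1 + be u *: M.
Proof.
move=> MD; pose f u : 'M[rat]_2 := al u *: 1 + be u *: M.
have fl : linear f.
  move=> c u v; rewrite /f; have [-> ->] := quadratic_linear c u v.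
  by rewrite scalerDr !scalerA !scalerDl addrACA.
have fm : monoid_morphism f.
  split=> [|u v]; rewrite /f.
    by have [-> ->] := quadratic_1; rewrite scale1r scale0r addr0.
  have [-> ->] := quadratic_mul u v.
  rewrite mulrDl !mulrDr -!scalerAl !mul1r -!scalerAr.
  rewrite mulr1 MD !scalerA !scalerDl [D * _]mulrC -!addrA; congr (_ + _).
  by rewrite addrC -addrA.
pose fL := GRing.isLinear.Build rat E 'M[rat]_2 *:%R f fl.
pose fM := GRing.isMonoidMorphism.Build E 'M[rat]_2 f fm.
pose F : {lrmorphism E -> 'M[rat]_2} := HB.pack f fL fM.
by exists F.
Qed.

Lemma quadratic_real_embedding (R : realType) : 0 <= D -> inhabited {rmorphism E -> R}.
Proof.
move=> D0; pose s : R := Num.sqrt (ratr D).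
have sD : s * s = ratr D by rewrite -expr2 sqr_sqrtr // ler0q.
pose f u : R := ratr (al u) + ratr (be u) * s.
have fa : zmod_morphism f.
  move=> u v; rewrite /f.
  have -> : u - v = (-1) *: v + u by rewrite scaleN1r addrC.
  have [-> ->] := quadratic_linear (-1) v u.
  by rewrite !mulN1r !rmorphD !rmorphN /=; ring.
have fm : monoid_morphism f.
  split=> [|u v]; rewrite /f.
    by have [-> ->] := quadratic_1; rewrite rmorph1 rmorph0 mul0r addr0.
  have [-> ->] := quadratic_mul u v.
  by rewrite !rmorphD !rmorphM /= -sD; ring.
pose fA := GRing.isZmodMorphism.Build E R f fa.
pose fM := GRing.isMonoidMorphism.Build E R f fm.
pose F : {rmorphism E -> R} := HB.pack f fA fM.
by constructor; exact: F.
Qed.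
End QuadraticAlgebra.

(** In Q x Q the element th = (d, -d) has square d^2. *)
Lemma split_algebra_coordinates (d : rat) : d != 0 ->
  exists (al be : (rat^o * rat^o)%type -> rat) (th : (rat^o * rat^o)%type),
  [/\ forall u, u = al u *: 1 + be u *: th,
    forall a b, al (a *: 1 + b *: th) = a, forall a b, be (a *: 1 + b *: th) = b &
    th * th = d ^+ 2 *: 1].
Proof.
move=> d0; have pair_ext (u v : (rat^o * rat^o)%type) : u.1 = v.1 -> u.2 = v.2 -> u = v.
  by case: u v => [? ?] [? ?] /= -> ->.
exists (fun u => (u.1 + u.2) / 2), (fun u => (u.1 - u.2) / (2 * d)),
  ((d : rat^o), (- d : rat^o)).
split.
- move=> [x y]; apply: pair_ext; rewrite /= /GRing.scale /= ?mulr1; field; exact: d0.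
- by move=> a b; rewrite /= /GRing.scale /= ?mulr1; field.
- by move=> a b; rewrite /= /GRing.scale /= ?mulr1; field; exact: d0.
by apply: pair_ext; rewrite /= /GRing.scale /= ?mulr1; ring.
Qed.

Lemma quadratic_field_coordinates (D : rat) : (forall x, x ^+ 2 != D) ->
  exists (E : fieldExtType rat) (al be : E -> rat) (th : E),
  [/\ \dim {:E} = 2%N, forall u, u = al u *: 1 + be u *: th,
    forall a b, al (a *: 1 + b *: th) = a, forall a b, be (a *: 1 + b *: th) = b &
    th * th = D *: 1].
Proof.
move=> nsq; pose f : {poly rat} := 'X^2 - D%:P.
have sf : size f = 3%N by rewrite size_polyDl size_polyXn // size_polyN (leq_ltn_trans (size_polyC_leq1 _)).
have irrf : irreducible_poly f.
  apply: cubic_irreducible; first by rewrite sf.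
  by move=> x; rewrite rootE !hornerE subr_eq0 nsq.
have [E dimE [th rth Eth]] := irredp_FAdjoin irrf; rewrite sf /= in dimE.
have thD : th * th = D *: 1.
  move: rth; rewrite rootE /f rmorphB /= map_polyXn map_polyC hornerD hornerN.
  by rewrite hornerXn hornerC subr_eq0 -expr2 => /eqP.
pose X := [tuple (1 : E); th].
have freeX : free X.
  rewrite /= free_cons seq1_free span_seq1; apply/andP; split.
    (* A relation 1 = k th would make k^-1 a rational square root of D. *)
    apply/negP => /vlineP[k e].
    have th0 : th != 0.
      by apply: contraTneq (oner_neq0 E) => th0; rewrite e th0 scaler0 eqxx.
    have k0 : k != 0.
      by apply: contraTneq (oner_neq0 E) => k0; rewrite e k0 scale0r eqxx.
    have thE : th = k^-1 *: 1 by rewrite e scalerA mulVf // scale1r.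
    have := nsq k^-1; move: thD; rewrite thE -scalerAl mul1r scalerA => h.
    rewrite expr2; apply/negP; rewrite negbK -subr_eq0.
    have /eqP : (k^-1 * k^-1 - D) *: (1 : E) = 0 by rewrite scalerBl h subrr.
    by rewrite scaler_eq0 oner_eq0 orbF.
  apply: contraTneq (nsq 0) => th0; move: thD; rewrite th0 mul0r expr0n /= => h.
  rewrite negbK eq_sym; have /eqP : D *: (1 : E) = 0 by rewrite -h.
  by rewrite scaler_eq0 oner_eq0 orbF.
have bX : basis_of fullv X by rewrite basisEfree freeX subvf dimE.
have coordE u : u = coord X 0 u *: 1 + coord X 1 u *: th.
  rewrite {1}(coord_basis bX (memvf u)) !big_ord_recl big_ord0 addr0 /=.
  by have -> : lift 0 0 = 1 :> 'I_2 by apply: val_inj.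
have c1 j : coord X j 1 = (0 == j)%:R by have := coord_free 0 j freeX.
have cth j : coord X j th = (1 == j)%:R by have := coord_free 1 j freeX.
exists E, (coord X 0), (coord X 1), th; split=> // a b;
by rewrite linearD !linearZ /= c1 cth /= /GRing.scale /= ?mulr1 ?mulr0 ?addr0 ?add0r.
Qed.

(** * Fixed points of the embedded torus *)

Section SpecialGeodesic.
Context {R : realType}.
Local Notation C := R[i].
Variables (E : comUnitAlgType rat) (al be : E -> rat) (th : E) (p q r : rat).
Let D := q ^+ 2 - p * r.
Let M : 'M[rat]_2 := mat2 (- q) (- r) p q.
Hypothesis coordE : forall u, u = al u *: 1 + be u *: th.
Hypothesis al_coord : forall a b, al (a *: 1 + b *: th) = a.
Hypothesis be_coord : forall a b, be (a *: 1 + b *: th) = b.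
Hypothesis thD : th * th = D *: 1.
Hypothesis D0 : 0 < D.
Hypothesis pq0 : (p != 0) || (q != 0).
Variable iota : {lrmorphism E -> 'M[rat]_2}.
Hypothesis iotaE : forall u, iota u = al u *: 1 + be u *: M.

Lemma iota_entries u : [/\ iota u 0 0 = al u - be u * q, iota u 0 1 = - (be u * r),
  iota u 1 0 = be u * p & iota u 1 1 = al u + be u * q].
Proof.
by rewrite iotaE; split; rewrite !mxE /= ?mulr1n ?mulr0n ?mulr1 ?mulr0 ?add0r ?mulrN.
Qed.

Lemma iota_inj : injective iota.
Proof.
apply: raddf_inj => u u0; have [e00 e01 e10 e11] := iota_entries u.
rewrite u0 !mxE in e00 e01 e10 e11.
have bu : be u = 0.
  have bp : be u * p = 0 by rewrite -e10.
  have bq : be u * q = 0 by lra.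
  case/orP: pq0 => n0; apply: (mulIf n0); by rewrite mul0r.
have au : al u = 0 by move: e00; rewrite bu mul0r subr0.
by rewrite (coordE u) au bu !scale0r addr0.
Qed.

Let quad (t : C) : C := ratr p * t ^+ 2 + 2 * ratr q * t + ratr r.

(** Every iota u is a combination of 1 and M, so it fixes the fixed points of M. A zero denominator
    would make (t, 1) a kernel vector of an invertible matrix. *)
Lemma iota_fixes u (t : C) : u \is a GRing.unit -> quad t = 0 ->
  moebius_P1 (map_mx ratr (iota u)) (Some t) = Some t.
Proof.
move=> uu qt; have [e00 e01 e10 e11] := iota_entries u.
have du : \det (iota u) != 0.
  have : iota u \is a GRing.unit by apply: rmorph_unit.
  by rewrite unitmxE unitfE.
rewrite /moebius_P1 /moebius !mxE.
have num : ratr (iota u 0 0) * t + ratr (iota u 0 1) =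
    t * (ratr (iota u 1 0) * t + ratr (iota u 1 1)) :> C.
  apply/eqP; rewrite -subr_eq0; apply/eqP.
  rewrite e00 e01 e10 e11 !(rmorphD, rmorphN, rmorphM) /=.
  transitivity (- ratr (be u) * quad t); first by rewrite /quad; ring.
  by rewrite qt mulr0.
have den : ratr (iota u 1 0) * t + ratr (iota u 1 1) != 0 :> C.
  apply/eqP => den; move: num; rewrite den mulr0 => num.
  have : ratr (\det (iota u)) = 0 :> C.
    rewrite det2 rmorphB !rmorphM /=.
    have -> : ratr (iota u 1 1) = - (ratr (iota u 1 0) * t) :> C.
      by apply/eqP; rewrite -addr_eq0 addrC den.
    have -> : ratr (iota u 0 1) = - (ratr (iota u 0 0) * t) :> C.
      by apply/eqP; rewrite -addr_eq0 addrC num.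
    by ring.
  by move/eqP; rewrite fmorph_eq0 (negPf du).
by rewrite (negPf den) num mulfK.
Qed.

Lemma th_unit : th \is a GRing.unit.
Proof.
apply/unitrP; exists (D^-1 *: th); rewrite -scalerAl -scalerAr thD scalerA mulVf ?scale1r //.
by rewrite gt_eqF.
Qed.

Lemma iota_th : iota th = M.
Proof.
have [a0 b1] := quadratic_gen al_coord be_coord.
by rewrite iotaE a0 b1 scale0r scale1r add0r.
Qed.

Lemma fixed_quad (t : C) : moebius_P1 (map_mx ratr (iota th)) (Some t) = Some t ->
  quad t = 0.
Proof.
rewrite iota_th /moebius_P1 /moebius !mxE /=; case: eqP => // /eqP den [] /eqP.
rewrite eq_sym -subr_eq0 => /eqP h; rewrite -[LHS]mul1r -(divff den).
rewrite /quad; have : t * (ratr p * t + ratr q) - (ratr (- q) * t + ratr (- r)) = 0.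
  rewrite -[RHS](mul0r (ratr p * t + ratr q)) -h mulrBl divfK //.
rewrite !rmorphN /= => h'.
have -> : ratr p * t ^+ 2 + 2 * ratr q * t + ratr r = 0 by rewrite -[RHS]h'; ring.
by rewrite mulr0.
Qed.

(** The single unit th already fixes nothing but the roots of [quad], together with oo when p = 0,
    and all units fix these. They are the endpoints: - r / (2 q) and oo, or (- q + s) / p and (- q -
    s) / p with s^2 = D. *)
Lemma geodesic_of_iota : geodesic_of_embedding iota (@rational_circle R p q r).
Proof.
have ratC x : ratr x = (ratr x : R)%:C :> C by rewrite -(fmorph_eq_rat (real_complex R \o ratr)).
have twoC : 2 = (2 : R)%:C :> C by rewrite rmorph_nat.
have quadC x : quad x%:C = (ratr p * x ^+ 2 + 2 * ratr q * x + ratr r : R)%:C.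
  by rewrite /quad twoC !ratC -!(rmorphXn, rmorphM, rmorphD).
have [p0|pn] := eqVneq p 0.
  have qn : q != 0 by move: pq0; rewrite p0 eqxx.
  have qR : ratr q != 0 :> R by rewrite fmorph_eq0.
  have qC : ratr q != 0 :> C by rewrite fmorph_eq0.
  have q2C : 2 * ratr q != 0 :> C by rewrite mulf_neq0 // pnatr_eq0.
  have q2R : 2 * ratr q != 0 :> R by rewrite mulf_neq0 // pnatr_eq0.
  pose a : R := - ratr r / (2 * ratr q).
  have qa : 2 * ratr q * a + ratr r = 0 by rewrite /a; field.
  exists (Some a), None; split=> //.
    apply/seteqP; split=> [[t|] /=|_ /= [->|->]].
    - move=> /(_ th th_unit)/fixed_quad h; left; congr Some.
      have := quadC a; rewrite p0 rmorph0 mul0r add0r qa rmorph0 => h'.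
      move: h h'; rewrite /quad p0 rmorph0 !mul0r !add0r => h h'.
      by apply: (mulfI q2C); apply: (addIr (ratr r)); rewrite h h'.
    - by move=> _; right.
    - move=> u uu; apply: iota_fixes => //; rewrite quadC p0 rmorph0 mul0r add0r qa.
      by rewrite rmorph0.
    move=> u uu; rewrite /moebius_P1 mxE; have [_ _ -> _] := iota_entries u.
    by rewrite p0 mulr0 rmorph0 eqxx.
  apply/seteqP; split=> z /= [z0 h]; split=> //.
    move: h; rewrite p0 rmorph0 mul0r add0r => h.
    apply: (mulfI q2R); by apply: (addIr (ratr r)); rewrite h qa.
  by rewrite p0 rmorph0 mul0r add0r h qa.
have pR : ratr p != 0 :> R by rewrite fmorph_eq0.
have pC : ratr p != 0 :> C by rewrite fmorph_eq0.
pose s : R := Num.sqrt (ratr D); have s0 : 0 < s by rewrite sqrtr_gt0 ltr0q.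
have sD : s ^+ 2 = ratr q ^+ 2 - ratr p * ratr r.
  by rewrite sqr_sqrtr ?ler0q ?ltW // /D rmorphB rmorphXn rmorphM.
pose a : R := (- ratr q + s) / ratr p; pose b : R := (- ratr q - s) / ratr p.
have quad_fact (t : C) : ratr p * quad t = ratr p ^+ 2 * ((t - a%:C) * (t - b%:C)).
  have -> : ratr p ^+ 2 * ((t - a%:C) * (t - b%:C)) =
      (ratr p * t - ratr p * a%:C) * (ratr p * t - ratr p * b%:C) by ring.
  have -> : ratr p * a%:C = - ratr q + s%:C.
    have e : - ratr q + s = ratr p * a by rewrite /a mulrC divfK.
    by rewrite !ratC -rmorphM -e rmorphD rmorphN.
  have -> : ratr p * b%:C = - ratr q - s%:C.
    have e : - ratr q - s = ratr p * b by rewrite /b mulrC divfK.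
    by rewrite !ratC -rmorphM -e rmorphB rmorphN.
  have sC : s%:C ^+ 2 = ratr q ^+ 2 - ratr p * ratr r :> C.
    by rewrite !ratC -!(rmorphXn (real_complex R)) -rmorphM -rmorphB sD.
  have -> : (ratr p * t - (- ratr q + s%:C)) * (ratr p * t - (- ratr q - s%:C)) =
      (ratr p * t + ratr q) ^+ 2 - s%:C ^+ 2 by ring.
  by rewrite sC /quad; ring.
have quad0 (t : C) : quad t = 0 <-> t = a%:C \/ t = b%:C.
  split=> [h|h].
    have := quad_fact t; rewrite h mulr0 => /esym/eqP.
    rewrite mulf_eq0 (negPf (expf_neq0 2 pC)) /= mulf_eq0 !subr_eq0.
    by move=> /orP[] /eqP ->; [left|right].
  apply: (mulfI pC); rewrite quad_fact mulr0.
  by case: h => ->; rewrite subrr ?mul0r ?mulr0.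
exists (Some a), (Some b); split.
- move=> [] /(congr1 (fun x => x * ratr p)); rewrite !divfK // => /addrI h.
  by move: s0 h; move: (s) => y y0 h; have := addr_gt0 y0 y0; rewrite {1}h addNr ltxx.
- apply/seteqP; split=> [[t|] /=|_ /= [->|->] u uu].
  + move=> /(_ th th_unit)/fixed_quad/quad0[->|->]; [by left|by right].
  + move=> /(_ th th_unit); rewrite /moebius_P1 iota_th !mxE /=.
    by rewrite (negPf pC).
  + by apply: iota_fixes => //; apply/quad0; left.
  + by apply: iota_fixes => //; apply/quad0; right.
have mid : (a + b) / 2 = - (ratr q / ratr p) by rewrite /a /b; field.
have rad : ((a - b) / 2) ^+ 2 = s ^+ 2 / ratr p ^+ 2 by rewrite /a /b; field.
apply/seteqP; split=> z /= [z0 h]; split=> //; rewrite ?mid ?rad ?sD.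
  apply: (mulfI (_ : ratr p ^+ 2 != 0)); first by rewrite expf_neq0.
  rewrite [RHS]mulrC divfK ?expf_neq0 //.
  transitivity (ratr p * (ratr p * (complex.Re z ^+ 2 + complex.Im z ^+ 2) +
    2 * ratr q * complex.Re z + ratr r) + (ratr q ^+ 2 - ratr p * ratr r)).
    by field.
  by rewrite h mulr0 add0r.
move: h; rewrite mid rad sD => /(congr1 (fun x => x * ratr p ^+ 2)).
rewrite divfK ?expf_neq0 // => h; apply: (mulfI pR); rewrite mulr0.
transitivity (((complex.Re z - - (ratr q / ratr p)) ^+ 2 + complex.Im z ^+ 2) * ratr p ^+ 2 -
  (ratr q ^+ 2 - ratr p * ratr r)); first by field.
by rewrite h subrr.
Qed.
End SpecialGeodesic.

(** A point of the circle in H makes D positive: q^2 - p r = (p x + q)^2 + (p y)^2 if p != 0, and D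
    = q^2 if p = 0. According to whether D is a rational square, the algebra is Q x Q or the real
    quadratic field of its square root. *)
Lemma rational_circle_special (R : realType) (p q r : rat) :
  (p != 0) || (q != 0) -> @rational_circle R p q r !=set0 ->
  special_geodesic (@rational_circle R p q r).
Proof.
move=> pq0 [z [z0 h]]; pose D := q ^+ 2 - p * r.
have D0 : 0 < D.
  rewrite -(ltr0q R) /D rmorphB rmorphXn rmorphM /=.
  have [p0|pn] := eqVneq p 0.
    rewrite p0 rmorph0 mul0r subr0 exprn_even_gt0 //= fmorph_eq0.
    by move: pq0; rewrite p0 eqxx.
  have pR : ratr p != 0 :> R by rewrite fmorph_eq0.
  have -> : ratr q ^+ 2 - ratr p * ratr r =
      (ratr p * complex.Re z + ratr q) ^+ 2 + (ratr p * complex.Im z) ^+ 2.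
    apply/eqP; rewrite -subr_eq0; apply/eqP.
    by rewrite -[RHS](mulr0 (- ratr p)) -h; ring.
  by rewrite ltr_wpDl ?sqr_ge0 // exprn_even_gt0 //= mulf_neq0 // gt_eqF.
pose M : 'M[rat]_2 := mat2 (- q) (- r) p q.
have MD : M * M = D *: 1.
  by apply: mx2_ext; rewrite [LHS]mulmx2 !mxE /= /D ?mulr1n ?mulr0n; ring.
have [[d dE]|nsq] := pselect (exists d, d ^+ 2 = D).
  have d0 : d != 0 by apply: contraTneq D0 => d0; rewrite -dE d0 expr0n ltxx.
  have [al [be [th [uE alE beE thD]]]] := split_algebra_coordinates d0.
  rewrite dE in thD.
  have [iota iE] := quadratic_embedding uE alE beE thD MD.
  left; exists iota; split; first exact: (@iota_inj _ al be th p q r uE pq0 iota iE).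
  exact: (@geodesic_of_iota R _ al be th p q r alE beE thD D0 pq0 iota iE).
have [|E [al [be [th [dimE uE alE beE thD]]]]] := @quadratic_field_coordinates D.
  by move=> x; apply/eqP => xE; apply: nsq; exists x.
have [iota iE] := quadratic_embedding uE alE beE thD MD.
right; exists E, iota; split=> //.
- exact: (quadratic_real_embedding uE alE beE thD R (ltW D0)).
- exact: (@iota_inj E al be th p q r uE pq0 iota iE).
exact: (@geodesic_of_iota R E al be th p q r alE beE thD D0 pq0 iota iE).
Qed.

Theorem theorem3p12 (R : realType) (X : set R[i])
    (hX : weakly_bialgebraic X) :
  (exists z : R[i], X = [set z]) \/ special_geodesic X.
Proof.
have [|[p [q [r [pq0 X0 XE]]]]] := bialgebraic_circle hX; first by left.
by right; rewrite XE in X0 *; apply: rational_circle_special.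
Qed.
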